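(* Let $s$ be a complex number with $\operatorname{Re}s<1$, and let $\zeta'(s,\alpha)=\frac{\partial}{\partial s}\zeta(s,\alpha)$. As a function of $\alpha$ on the unit interval $[0,1]$, $\zeta'(s,\alpha)$ has the Fourier series $$\zeta'(s,\alpha)=\Gamma(1-s)\sum_{|n|\ge1}e^{2\pi i n\alpha}(2\pi i n)^{s-1}\left(\log(2\pi i n)-\frac{\Gamma'}{\Gamma}(1-s)\right),$$ the equality holding for $0<\alpha<1$.
   Context: The Hurwitz zeta function $\zeta(s,\alpha)$ is defined by $\zeta(s,\alpha)=\sum_{n\ge 0}(n+\alpha)^{-s}$ for $\operatorname{Re}s>1$ and by analytic continuation in $s$. Logarithms and complex powers take their principal values. The Fourier series on $[0,1]$ of an integrable function $f$ is $\sum_{n\in\mathbb Z}c_n e^{2\pi i n\alpha}$ with $c_n=\int_0^1 f(\alpha)e^{-2\pi i n\alpha}\,d\alpha$; sums over $|n|\ge1$ run over all nonzero integers and are limits of symmetric partial sums. *)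

(* Defs.v *)
From Stdlib Require Import Reals ZArith.
From Coquelicot Require Import Coquelicot.

Open Scope R_scope.

Definition Cexp (z : C) : C := (exp (Re z) * cos (Im z), exp (Re z) * sin (Im z)).

(* Principal argument, with values in (-PI, PI]; [Carg 0] is a junk value. *)
Definition Carg (z : C) : R :=
  if Rle_dec 0 (Im z) then acos (Re z / Cmod z) else - acos (Re z / Cmod z).

Definition Clog (z : C) : C := (ln (Cmod z), Carg z).

(* Principal value of z ^ w, meaningful for z <> 0 (Coquelicot's [Cpow] only
   has natural exponents). *)
Definition Cpower (z w : C) : C := Cexp (w * Clog z)%C.

(* Euler's integral, i.e. the Gamma function on the half-plane 0 < Re z. *)
Definition CGamma (z : C) : C :=
  RInt_gen (V := C_R_CompleteNormedModule)
    (fun t : R => (Cpower t (z - 1) * Cexp (- t))%C)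
    (at_right 0) (Rbar_locally p_infty).

Definition Cdigamma (z : C) : C := (C_derive CGamma z / CGamma z)%C.

Definition analytic_on (D : C -> Prop) (f : C -> C) : Prop :=
  forall z0 : C, D z0 ->
  exists (a : nat -> C) (r : R), 0 < r /\
  forall z : C, Cmod (z - z0) < r ->
    is_pseries (K := C_AbsRing) (V := C_NormedModule) a (z - z0)%C (f z).

(* [zeta s alpha] is the Hurwitz zeta function: for each alpha > 0, the
   Dirichlet series for 1 < Re s and its analytic continuation to C \ {1},
   which is unique by the identity theorem.  Nothing is required of the value
   at the pole s = 1. *)
Definition is_hurwitz_zeta (zeta : C -> R -> C) : Prop :=
  forall alpha : R, 0 < alpha ->
    analytic_on (fun s : C => s <> 1) (fun s : C => zeta s alpha) /\
    forall s : C, 1 < Re s ->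
      is_series (K := C_AbsRing) (V := C_NormedModule)
        (fun n : nat => Cpower (INR n + alpha) (- s)) (zeta s alpha).

(* Integrability on [0,1] and Fourier coefficients.  Integrals are improper at
   both endpoints, so f may be unbounded or undefined there; requiring the
   integral of |f| to converge makes them agree with Lebesgue integrals. *)
Definition integrable01 (f : R -> C) : Prop :=
  ex_RInt_gen (V := C_R_NormedModule) f (at_right 0) (at_left 1) /\
  ex_RInt_gen (V := R_NormedModule) (fun x : R => Cmod (f x))
    (at_right 0) (at_left 1).

Definition has_fourier_coefficients (f : R -> C) (c : Z -> C) : Prop :=
  integrable01 f /\
  forall n : Z,
    is_RInt_gen (V := C_R_NormedModule)
      (fun x : R => (f x * Cexp (- (2 * PI * Ci * IZR n * x)))%C)
      (at_right 0) (at_left 1) (c n).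

(* Sum over all nonzero integers, as the limit as N -> oo of the sums over
   1 <= |n| <= N. *)
Definition is_sum_nonzero (u : Z -> C) (l : C) : Prop :=
  is_series (K := C_AbsRing) (V := C_NormedModule)
    (fun k : nat => (u (Z.of_nat (S k)) + u (- Z.of_nat (S k))%Z)%C) l.

(* Main.v *)
(* For 0 < a < 1 put q = e^(2 pi i a - 2 pi x).  Expanding the geometric series
   q / (1 - q) under the integral of x^(-s) gives, for Re s < 1,
     sum_{n >= 1} e^(2 pi i n a) Gamma(1 - s) (2 pi n)^(s - 1) = int_0^oo x^(-s) q / (1 - q) dx,
   so the Fourier series in question, its analogue without the logarithm, their
   analyticity in s and a remainder bound integrable in a all come from one
   absolutely convergent integral; the bound also gives the Fourier coefficients
   of the sum, G(s, a).
   It remains to identify G with the Hurwitz zeta function.  Euler-Maclaurin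
   summation continues the Dirichlet series to Re s > 0, and by the identity
   theorem zeta(s, a) is, for 0 < s < 1, the limit of
   sum_{n < N} (n + a)^(-s) - (N + a)^(1 - s) / (1 - s), uniformly in a.  Its m-th
   Fourier coefficient is therefore int_0^oo x^(-s) e^(-2 pi i m x) dx, which
   rotating the ray of integration turns into Gamma(1 - s) (2 pi i m)^(s - 1).  So
   zeta(s, .) and G(s, .) agree for real s in (0, 1), hence for all Re s < 1 by the
   identity theorem, and one differentiates in s.
   Dividing by Gamma(1 - s) requires that Gamma has no zero. *)
Require Import Defs.
From Stdlib Require Import Reals ZArith Lra Lia ClassicalEpsilon.
From Coquelicot Require Import Coquelicot.

Open Scope R_scope.

(** * The complex exponential *)

(** No contour integral occurs. Analyticity is carried by Taylor expansions with explicit remainders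
    ([taylor_at]), which pass through series and parameter integrals by plain estimates, and a ray
    of integration is rotated by showing that a function of the angle has derivative zero. Limits
    and integrals are exchanged by means of majorants with a known primitive: [weight] on (0, oo)
    and [unit_weight] on (0, 1), since bounds uniform in a can fail near both endpoints. The range 0
    < s < 1 used for the identification is forced: the Euler-Maclaurin remainder of this order tends
    to 0 for s > 0, and a^(-s) is integrable at 0 for s < 1. There the integral for the m-th
    coefficient converges only conditionally, because 2 pi i m lies on the boundary of the
    half-plane of absolute convergence; it is reached as a limit from inside. The pole at 1 is met
    by clearing the factor s - 1 and by continuing along a segment that leaves the real axis. A zero
    z of Gamma would propagate to every z + n, where the integrand is too concentrated to cancel. *)

Lemma C_ext (z w : C) : Re z = Re w -> Im z = Im w -> z = w.
Proof. destruct z, w; simpl; intros; subst; reflexivity. Qed.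

Lemma Re_plus (z w : C) : Re (z + w)%C = Re z + Re w.
Proof. reflexivity. Qed.
Lemma Re_mult (z w : C) : Re (z * w)%C = Re z * Re w - Im z * Im w.
Proof. reflexivity. Qed.
Lemma Cexp_plus (z w : C) : Cexp (z + w) = (Cexp z * Cexp w)%C.
Proof.
  unfold Cexp; apply C_ext; cbn -[exp cos sin];
    rewrite exp_plus; [rewrite cos_plus | rewrite sin_plus]; unfold Re, Im; ring.
Qed.

Lemma Cexp_0 : Cexp 0 = 1%C.
Proof.
  unfold Cexp; apply C_ext; cbn -[exp cos sin];
    rewrite exp_0; [rewrite cos_0 | rewrite sin_0]; ring.
Qed.

Lemma Cmod_Cexp (z : C) : Cmod (Cexp z) = exp (Re z).
Proof.
  unfold Cexp, Cmod; cbn -[exp cos sin pow].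
  replace (_ + _) with ((exp (Re z))²).
  - apply sqrt_Rsqr, Rlt_le, exp_pos.
  - pose proof (sin2_cos2 (Im z)); unfold Rsqr in *; nra.
Qed.

Lemma Cexp_neq_0 (z : C) : Cexp z <> 0%C.
Proof.
  apply Cmod_gt_0; rewrite Cmod_Cexp; apply exp_pos.
Qed.

Lemma Cexp_opp (z : C) : Cexp (- z) = (/ Cexp z)%C.
Proof.
  assert (H : (Cexp z * Cexp (- z) = 1)%C).
  { rewrite <- Cexp_plus. replace (z + - z)%C with (RtoC 0) by ring. apply Cexp_0. }
  rewrite <- (Cmult_1_l (Cexp (- z))), <- (Cinv_l (Cexp z)) by apply Cexp_neq_0.
  rewrite <- Cmult_assoc, H. ring.
Qed.

Lemma Cexp_RtoC (x : R) : Cexp x = RtoC (exp x).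
Proof.
  unfold Cexp; apply C_ext; cbn -[exp cos sin]; rewrite ?cos_0, ?sin_0; ring.
Qed.

Lemma Cexp_INR_mult (n : nat) (z : C) : Cexp (INR n * z) = (Cexp z ^ n)%C.
Proof.
  induction n as [|n IH].
  - simpl. rewrite Cmult_0_l. apply Cexp_0.
  - rewrite S_INR, RtoC_plus, Cmult_plus_distr_r, Cexp_plus, IH, Cmult_1_l.
    simpl. apply Cmult_comm.
Qed.

(** * Derivatives of complex functions of a real variable *)

Lemma is_derive_continuity_pt (f : R -> R) (x l : R) : is_derive f x l -> continuity_pt f x.
Proof.
  intros H. apply continuity_pt_filterlim, (ex_derive_continuous (V := R_NormedModule) f x).
  exists l; exact H.
Qed.

Lemma is_derive_Rmult (f g : R -> R) (x lf lg : R) :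
  is_derive f x lf -> is_derive g x lg ->
  is_derive (fun u => f u * g u) x (lf * g x + f x * lg).
Proof.
  intros Hf Hg. exact (is_derive_mult f g x lf lg Hf Hg Rmult_comm).
Qed.

Lemma is_derive_Rplus (f g : R -> R) (x lf lg : R) :
  is_derive f x lf -> is_derive g x lg -> is_derive (fun u => f u + g u) x (lf + lg).
Proof. intros Hf Hg. exact (is_derive_plus f g x lf lg Hf Hg). Qed.

Lemma is_derive_Rminus (f g : R -> R) (x lf lg : R) :
  is_derive f x lf -> is_derive g x lg -> is_derive (fun u => f u - g u) x (lf - lg).
Proof. intros Hf Hg. exact (is_derive_minus f g x lf lg Hf Hg). Qed.

(** Componentwise, so that derivative rules and the mean value theorem reduce to the real ones;
    [is_Cderive_is_derive] leads back to the normed-module derivative. *)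
Definition is_Cderive (f : R -> C) (t : R) (l : C) : Prop :=
  is_derive (fun u => Re (f u)) t (Re l) /\ is_derive (fun u => Im (f u)) t (Im l).

Lemma is_Cderive_const (c : C) (t : R) : is_Cderive (fun _ => c) t 0.
Proof. split; [exact (is_derive_const (Re c) t) | exact (is_derive_const (Im c) t)]. Qed.

Lemma is_Cderive_RtoC (f : R -> R) (t l : R) :
  is_derive f t l -> is_Cderive (fun u => RtoC (f u)) t l.
Proof.
  intros H; split; [exact H | exact (is_derive_const 0 t)].
Qed.

Lemma is_Cderive_plus (f g : R -> C) (t : R) (lf lg : C) :
  is_Cderive f t lf -> is_Cderive g t lg ->
  is_Cderive (fun u => f u + g u)%C t (lf + lg)%C.
Proof.
  intros [H1 H2] [H3 H4]; split.
  - exact (is_derive_plus _ _ _ _ _ H1 H3).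
  - exact (is_derive_plus _ _ _ _ _ H2 H4).
Qed.

Lemma is_Cderive_mult (f g : R -> C) (t : R) (lf lg : C) :
  is_Cderive f t lf -> is_Cderive g t lg ->
  is_Cderive (fun u => f u * g u)%C t (lf * g t + f t * lg)%C.
Proof.
  intros [H1 H2] [H3 H4]; split.
  - replace (Re (lf * g t + f t * lg)%C) with
      ((Re lf * Re (g t) + Re (f t) * Re lg) - (Im lf * Im (g t) + Im (f t) * Im lg))
      by (cbn; unfold Re, Im; ring).
    apply (is_derive_Rminus (fun u => Re (f u) * Re (g u)) (fun u => Im (f u) * Im (g u))).
    + apply (is_derive_Rmult (fun u => Re (f u)) (fun u => Re (g u))); auto.
    + apply (is_derive_Rmult (fun u => Im (f u)) (fun u => Im (g u))); auto.
  - replace (Im (lf * g t + f t * lg)%C) with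
      ((Re lf * Im (g t) + Re (f t) * Im lg) + (Im lf * Re (g t) + Im (f t) * Re lg))
      by (cbn; unfold Re, Im; ring).
    apply (is_derive_Rplus (fun u => Re (f u) * Im (g u)) (fun u => Im (f u) * Re (g u))).
    + apply (is_derive_Rmult (fun u => Re (f u)) (fun u => Im (g u))); auto.
    + apply (is_derive_Rmult (fun u => Im (f u)) (fun u => Re (g u))); auto.
Qed.

Lemma is_Cderive_scal (c : C) (f : R -> C) (t : R) (lf : C) :
  is_Cderive f t lf -> is_Cderive (fun u => c * f u)%C t (c * lf)%C.
Proof.
  intros H. pose proof (is_Cderive_mult _ _ _ _ _ (is_Cderive_const c t) H) as H'.
  cbv beta in H'. replace (c * lf)%C with (0 * f t + c * lf)%C by ring. exact H'.
Qed.

Lemma is_Cderive_ext (f g : R -> C) (t : R) (l l' : C) :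
  (forall u, f u = g u) -> l = l' -> is_Cderive f t l -> is_Cderive g t l'.
Proof.
  intros E <- [H1 H2]; split;
    [eapply is_derive_ext; [|exact H1] | eapply is_derive_ext; [|exact H2]];
    intros u; simpl; now rewrite E.
Qed.

Lemma is_Cderive_Cexp (f : R -> C) (t : R) (l : C) :
  is_Cderive f t l -> is_Cderive (fun u => Cexp (f u)) t (l * Cexp (f t))%C.
Proof.
  intros [H1 H2].
  assert (He : is_derive (fun u => exp (Re (f u))) t (Re l * exp (Re (f t)))).
  { apply (is_derive_comp exp (fun u => Re (f u))); [apply is_derive_exp | exact H1]. }
  assert (Hc : is_derive (fun u => cos (Im (f u))) t (Im l * (- sin (Im (f t))))).
  { apply (is_derive_comp cos (fun u => Im (f u))); [apply is_derive_cos | exact H2]. }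
  assert (Hs : is_derive (fun u => sin (Im (f u))) t (Im l * cos (Im (f t)))).
  { apply (is_derive_comp sin (fun u => Im (f u))); [apply is_derive_sin | exact H2]. }
  split.
  - replace (Re (l * Cexp (f t))%C) with
      (Re l * exp (Re (f t)) * cos (Im (f t)) + exp (Re (f t)) * (Im l * - sin (Im (f t))))
      by (cbn -[exp cos sin]; unfold Re, Im; ring).
    exact (is_derive_Rmult _ _ _ _ _ He Hc).
  - replace (Im (l * Cexp (f t))%C) with
      (Re l * exp (Re (f t)) * sin (Im (f t)) + exp (Re (f t)) * (Im l * cos (Im (f t))))
      by (cbn -[exp cos sin]; unfold Re, Im; ring).
    exact (is_derive_Rmult _ _ _ _ _ He Hs).
Qed.

Lemma Re_le_Cmod (z : C) : Re z <= Cmod z.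
Proof. eapply Rle_trans; [apply Rle_abs | apply re_le_Cmod]. Qed.

(* Projecting on the direction of [f b - f a] reduces to the real mean value theorem. *)
Lemma mean_value_bound (f f' : R -> C) (Phi g : R -> R) (a b : R) :
  a <= b ->
  (forall t, a <= t <= b -> is_Cderive f t (f' t)) ->
  (forall t, a <= t <= b -> is_derive Phi t (g t)) ->
  (forall t, a <= t <= b -> Cmod (f' t) <= g t) ->
  Cmod (f b - f a) <= Phi b - Phi a.
Proof.
  intros Hab Hf HP Hg.
  set (c := Cconj (f b - f a)%C).
  destruct (Req_dec (Cmod (f b - f a)) 0) as [E|E].
  { rewrite E. destruct (MVT_gen Phi a b g) as [x [Hx ->]].
    - rewrite Rmin_left, Rmax_right by lra. intros; apply HP; lra.
    - rewrite Rmin_left, Rmax_right by lra. intros x Hx.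
      eapply is_derive_continuity_pt; apply HP; lra.
    - rewrite Rmin_left, Rmax_right in Hx by lra.
      apply Rmult_le_pos; [|lra]. eapply Rle_trans; [apply Cmod_ge_0 | apply Hg; lra]. }
  set (m := Cmod (f b - f a)) in *.
  assert (Hm : 0 < m) by (pose proof (Cmod_ge_0 (f b - f a)); unfold m in *; lra).
  assert (Hc : Cmod c = m) by apply Cmod_conj.
  assert (H : exists x, a <= x <= b /\
    (m * Phi b - Re (c * f b)%C) - (m * Phi a - Re (c * f a)%C)
      = (m * g x - Re (c * f' x)%C) * (b - a)).
  { assert (HD : forall t, a <= t <= b ->
      is_derive (fun t => m * Phi t - Re (c * f t)%C) t (m * g t - Re (c * f' t)%C)).
    { intros t Ht. apply (is_derive_Rminus (fun t => m * Phi t)).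
      - apply (is_derive_scal Phi). now apply HP.
      - apply (is_Cderive_scal c f t (f' t)). now apply Hf. }
    destruct (MVT_gen (fun t => m * Phi t - Re (c * f t)%C) a b
                (fun t => m * g t - Re (c * f' t)%C)) as [x [Hx Hx']].
    - rewrite Rmin_left, Rmax_right by lra. intros; apply HD; lra.
    - rewrite Rmin_left, Rmax_right by lra. intros x Hx.
      eapply is_derive_continuity_pt; apply HD; lra.
    - rewrite Rmin_left, Rmax_right in Hx by lra. exists x; split; [lra|exact Hx']. }
  destruct H as [x [Hx H]].
  assert (H1 : Re (c * f' x)%C <= m * g x).
  { eapply Rle_trans; [apply Re_le_Cmod|]. rewrite Cmod_mult, Hc.
    apply Rmult_le_compat_l; [lra | now apply Hg]. }
  assert (H2 : Re (c * f b)%C - Re (c * f a)%C = m * m).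
  { replace (Re (c * f b)%C - Re (c * f a)%C) with (Re (c * (f b - f a))%C)
      by (rewrite !Re_mult; cbn; unfold Re, Im; ring).
    unfold m. pose proof (Cmod2_alt (f b - f a)) as H3. simpl in H3.
    unfold c. rewrite Re_mult. cbn. unfold Re, Im in *. cbn in H3. lra. }
  assert (0 <= (m * g x - Re (c * f' x)%C) * (b - a)) by (apply Rmult_le_pos; lra).
  assert (m * m <= m * (Phi b - Phi a)) by lra.
  nra.
Qed.

(** * Taylor remainders of the exponential *)

Fixpoint Csum (a : nat -> C) (n : nat) : C :=
  match n with O => 0%C | S n => (Csum a n + a n)%C end.

Definition exp_rem (N : nat) (w : C) : C :=
  (Cexp w - Csum (fun k => w ^ k * RtoC (/ INR (fact k)))%C N)%C.

(** Along the ray u w, differentiation turns the remainder of order N + 1 into w times that of order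
    N. This drives the induction in [exp_rem_bound]. *)
Lemma exp_rem_derive (N : nat) (w : C) (t : R) :
  is_Cderive (fun u => exp_rem (S N) (u * w)%C) t (w * exp_rem N (t * w))%C.
Proof.
  assert (Ht : is_Cderive (fun u => u * w)%C t w).
  { eapply is_Cderive_ext; [| | apply (is_Cderive_mult (fun u => RtoC u) (fun _ => w) t 1 0)].
    - reflexivity.
    - cbv beta; ring.
    - apply (is_Cderive_RtoC (fun u => u)). exact (is_derive_id t).
    - exact (is_Cderive_const w t). }
  assert (Hp : forall k, is_Cderive (fun u => (u * w) ^ k)%C t
                 (match k with O => 0 | S j => RtoC (INR (S j)) * w * (t * w) ^ j end)%C).
  { induction k as [|k IH].
    - exact (is_Cderive_const 1 t).
    - eapply is_Cderive_ext; [| | exact (is_Cderive_mult _ _ _ _ _ Ht IH)].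
      + intros u; reflexivity.
      + destruct k as [|k].
        * simpl. ring.
        * rewrite (S_INR (S k)), RtoC_plus. rewrite (Cpow_S _ k). ring. }
  unfold exp_rem.
  induction N as [|N IH].
  - eapply is_Cderive_ext; [| | apply (is_Cderive_plus _ _ _ _ _ (is_Cderive_Cexp _ _ _ Ht)
      (is_Cderive_const (- 1) t))].
    + intros u; cbn [Csum Cpow]. change (INR (fact 0)) with 1. rewrite Rinv_1. ring.
    + cbn [Csum]. ring.
  - pose proof (is_Cderive_scal (RtoC (- / INR (fact (S N)))) _ _ _ (Hp (S N))) as H.
    eapply is_Cderive_ext; [| | apply (is_Cderive_plus _ _ _ _ _ IH H)].
    + intros u. cbv beta. cbn [Csum]. rewrite RtoC_opp. ring.
    + cbv beta. cbn [Csum].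
      rewrite RtoC_opp. rewrite fact_simpl, mult_INR, Rinv_mult, RtoC_mult.
      assert (E : (RtoC (/ INR (S N)) * RtoC (INR (S N)) = 1)%C).
      { rewrite <- RtoC_mult, Rinv_l; [reflexivity|]. apply not_0_INR; lia. }
      set (b := RtoC (/ INR (S N))) in *. set (c := RtoC (INR (S N))) in *.
      transitivity (w * (Cexp (t * w) - Csum (fun k : nat => (t * w) ^ k * RtoC (/ INR (fact k))) N)
        - (b * c) * w * (t * w) ^ N * RtoC (/ INR (fact N)))%C; [ring|].
      rewrite E. ring.
Qed.

Lemma exp_le_compat (x y : R) : x <= y -> exp x <= exp y.
Proof.
  intros [H | ->]; [now apply Rlt_le, exp_increasing | apply Rle_refl].
Qed.

(** Integrating the bound of order N along the segment from 0 to w gives the one of order N + 1. For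
    this the induction runs over all points t w of the segment, with the factor t^N kept
    explicit. *)
Lemma exp_rem_bound (N : nat) (w : C) :
  Cmod (exp_rem N w) <= Cmod w ^ N / INR (fact N) * exp (Cmod w).
Proof.
  assert (H : forall t, 0 <= t <= 1 ->
    Cmod (exp_rem N (t * w)) <= t ^ N * (Cmod w ^ N / INR (fact N) * exp (Cmod w))).
  { induction N as [|N IH]; intros t Ht.
    - unfold exp_rem; simpl. rewrite Rdiv_1_r, !Rmult_1_l.
      replace (Cexp (t * w) - 0)%C with (Cexp (t * w)) by ring.
      rewrite Cmod_Cexp. apply exp_le_compat.
      eapply Rle_trans; [apply Re_le_Cmod|]. rewrite Cmod_mult, Cmod_R, Rabs_right by lra.
      pose proof (Cmod_ge_0 w); nra.
    - set (K := Cmod w ^ S N / INR (fact (S N)) * exp (Cmod w)).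
      replace (exp_rem (S N) (t * w)) with (exp_rem (S N) (t * w) - exp_rem (S N) (0 * w))%C.
      2:{ assert (E : exp_rem (S N) (0 * w) = 0%C).
          { unfold exp_rem. rewrite Cmult_0_l, Cexp_0. clear.
            induction N as [|N IH].
            { cbn [Csum Cpow]. change (INR (fact 0)) with 1. rewrite Rinv_1. ring. }
            cbn [Csum] in *. rewrite Cpow_S, Cmult_0_l, Cmult_0_l, Cplus_0_r. exact IH. }
          rewrite E; ring. }
      replace (t ^ S N * K) with (t ^ S N * K - 0 ^ S N * K) by (simpl; ring).
      apply (mean_value_bound (fun u => exp_rem (S N) (u * w)%C) (fun u => w * exp_rem N (u * w))%C
               (fun u => u ^ S N * K) (fun u => INR (S N) * u ^ N * K)).
      + lra.
      + intros; apply exp_rem_derive.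
      + intros u Hu. auto_derive; [trivial|]. change (1 * (INR (S N) * u ^ N) * K = INR (S N) * u ^ N * K). ring.
      + intros u Hu. rewrite Cmod_mult.
        eapply Rle_trans; [apply Rmult_le_compat_l; [apply Cmod_ge_0 | apply IH; lra]|].
        apply Req_le. unfold K. rewrite fact_simpl, mult_INR. cbn [pow]. field.
        split; [apply not_0_INR, fact_neq_0 | apply not_0_INR; lia]. }
  specialize (H 1). rewrite pow1, Rmult_1_l in H.
  rewrite <- (Cmult_1_l w) at 1. apply H; lra.
Qed.

(** The derivative of e^u - u^(n+1)/(n+1)! is the same expression at order n, so positivity passes
    from n to n + 1 by the mean value theorem. *)
Lemma pow_div_fact_le_exp (x : R) (k : nat) : 0 <= x -> x ^ k / INR (fact k) <= exp x.
Proof.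
  intros Hx. destruct (Req_dec x 0) as [->|Hx0].
  { rewrite exp_0. destruct k; simpl; [lra|]. rewrite Rmult_0_l. unfold Rdiv; rewrite Rmult_0_l; lra. }
  assert (H : forall n t, 0 <= t -> t ^ n / INR (fact n) <= exp t).
  { induction n as [|n IH]; intros t Ht.
    - simpl. pose proof (exp_ineq1_le t). lra.
    - destruct (MVT_gen (fun u => exp u - u ^ S n / INR (fact (S n))) 0 t
        (fun u => exp u - u ^ n / INR (fact n))) as [c [Hc E]].
      + intros u _. auto_derive; [trivial|].
        change (1 * exp u - 1 * (INR (S n) * u ^ n) * / INR (fact (S n)) = exp u - u ^ n / INR (fact n)).
        rewrite fact_simpl, mult_INR. field.
        split; [apply not_0_INR, fact_neq_0 | apply not_0_INR; lia].
      + intros u _. eapply is_derive_continuity_pt. auto_derive; [trivial | reflexivity].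
      + rewrite Rmin_left, Rmax_right in Hc by lra.
        rewrite exp_0, Rminus_0_r in E. specialize (IH c ltac:(lra)).
        assert (0 <= (exp c - c ^ n / INR (fact n)) * t) by (apply Rmult_le_pos; lra).
        simpl (0 ^ S n) in E. unfold Rdiv in *. lra. }
  now apply H.
Qed.

(** * Improper integrals of complex functions *)

(** A common interface for integrals over (0, oo), (0, 1) and [0, 1]: [Fa] and [Fb] describe how the
    endpoints are approached, and [ib_prod] says that eventually both lie in P in the right
    order. *)
Record interval_between (P : R -> Prop) (Fa Fb : (R -> Prop) -> Prop) : Prop := {
  ib_left : ProperFilter Fa;
  ib_right : ProperFilter Fb;
  ib_convex : forall x y z, P x -> P z -> x <= y <= z -> P y;
  ib_prod : filter_prod Fa Fb (fun ab => fst ab <= snd ab /\ P (fst ab) /\ P (snd ab)) }.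

Lemma ib_convex_minmax P Fa Fb : interval_between P Fa Fb ->
  forall a b x, P a -> P b -> Rmin a b <= x <= Rmax a b -> P x.
Proof.
  intros H a b x Ha Hb Hx. destruct (Rle_dec a b) as [L|L].
  - rewrite Rmin_left, Rmax_right in Hx by lra. now apply (ib_convex _ _ _ H a x b).
  - rewrite Rmin_right, Rmax_left in Hx by lra. now apply (ib_convex _ _ _ H b x a).
Qed.

Lemma plus_minus_middle {G : AbelianGroup} (x y z : G) :
  minus (plus x (plus y z)) y = plus x z.
Proof.
  unfold minus. rewrite (plus_comm y z), plus_assoc, <- (plus_assoc _ y (opp y)).
  now rewrite plus_opp_r, plus_zero_r.
Qed.

Lemma is_RInt_gen_antiderivative {V : CompleteNormedModule R_AbsRing} P Fa Fb
    (F f : R -> V) (la lb : V) :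
  interval_between P Fa Fb ->
  (forall x, P x -> is_derive F x (f x)) -> (forall x, P x -> continuous f x) ->
  filterlim F Fa (locally la) -> filterlim F Fb (locally lb) ->
  is_RInt_gen f Fa Fb (minus lb la).
Proof.
  intros HI HD HC Hla Hlb.
  pose proof (ib_left _ _ _ HI). pose proof (ib_right _ _ _ HI).
  intros Q HQ. unfold filtermapi.
  assert (HL : filterlim (fun ab : R * R => minus (F (snd ab)) (F (fst ab)))
                 (filter_prod Fa Fb) (locally (minus lb la))).
  { eapply filterlim_comp_2 with (f := fun ab : R * R => F (snd ab))
      (g := fun ab : R * R => opp (F (fst ab))) (h := plus).
    - eapply filterlim_comp; [apply filterlim_snd | exact Hlb].
    - eapply filterlim_comp; [eapply filterlim_comp; [apply filterlim_fst | exact Hla]|].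
      apply (filterlim_opp la).
    - apply (filterlim_plus lb (opp la)). }
  specialize (HL Q HQ). unfold filtermap in HL.
  pose proof (ib_prod _ _ _ HI) as HP.
  eapply filter_imp; [| exact (filter_and _ _ HL HP)].
  intros [a b] [H1 [H2 [H3 H4]]]. simpl in *.
  eexists; split; [|exact H1].
  apply is_RInt_derive; intros x Hx; [apply HD | apply HC];
    now apply (ib_convex_minmax _ _ _ HI a b).
Qed.

(** Increments of the primitive Phi of g bound the partial integrals of f. Since Phi has limits at
    both ends, the partial integrals form a Cauchy filter, and B - A bounds the result. *)
Lemma ex_RInt_gen_dominated {V : CompleteNormedModule R_AbsRing} P Fa Fb
    (f : R -> V) (g Phi : R -> R) (A B : R) :
  interval_between P Fa Fb ->
  (forall x, P x -> continuous f x) -> (forall x, P x -> continuous g x) ->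
  (forall x, P x -> is_derive Phi x (g x)) -> (forall x, P x -> norm (f x) <= g x) ->
  filterlim Phi Fa (locally A) -> filterlim Phi Fb (locally B) ->
  exists l : V, is_RInt_gen f Fa Fb l /\ norm l <= B - A.
Proof.
  intros HI Hf Hg HD Hb HA HB.
  pose proof (ib_left _ _ _ HI) as PFa. pose proof (ib_right _ _ _ HI) as PFb.
  assert (Hex : forall a b, P a -> P b -> ex_RInt f a b).
  { intros a b Ha Hb'. apply (ex_RInt_continuous (V := V)). intros x Hx. apply Hf.
    now apply (ib_convex_minmax _ _ _ HI a b). }
  assert (Hn : forall a b, P a -> P b -> norm (RInt f a b) <= Rabs (Phi b - Phi a)).
  { assert (Hn : forall a b, P a -> P b -> a <= b -> norm (RInt f a b) <= Phi b - Phi a).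
    { intros a b Ha Hb' Hab.
      apply (norm_RInt_le f g a b); [lra | | |].
      - intros x Hx. apply Hb. now apply (ib_convex _ _ _ HI a x b).
      - apply (RInt_correct (V := V)). now apply Hex.
      - apply (is_RInt_derive (V := R_CompleteNormedModule) Phi g); intros x Hx; [apply HD | apply Hg];
          now apply (ib_convex_minmax _ _ _ HI a b). }
    intros a b Ha Hb'. destruct (Rle_dec a b) as [L|L].
    - eapply Rle_trans; [now apply Hn | apply Rle_abs].
    - rewrite <- (opp_RInt_swap f b a) by now apply Hex.
      rewrite Rabs_minus_sym. eapply Rle_trans; [apply Req_le, (norm_opp (V := V) (RInt f b a))|].
      eapply Rle_trans; [apply Hn; auto; lra | apply Rle_abs]. }
  assert (HlimA : forall eps : posreal, Fa (fun a => P a /\ Rabs (Phi a - A) < eps)).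
  { intros eps. apply filter_and.
    - destruct (ib_prod _ _ _ HI) as [Q R HQ HR HQR].
      destruct (filter_ex _ HR) as [b Hb'].
      eapply filter_imp; [|exact HQ]. intros a Ha. now destruct (HQR a b Ha Hb') as [_ [? _]].
    - apply (HA (fun y => Rabs (y - A) < eps)). exists eps. intros y Hy. exact Hy. }
  assert (HlimB : forall eps : posreal, Fb (fun a => P a /\ Rabs (Phi a - B) < eps)).
  { intros eps. apply filter_and.
    - destruct (ib_prod _ _ _ HI) as [Q R HQ HR HQR].
      destruct (filter_ex _ HQ) as [b Hb'].
      eapply filter_imp; [|exact HR]. intros a Ha. now destruct (HQR b a Hb' Ha) as [_ [_ ?]].
    - apply (HB (fun y => Rabs (y - B) < eps)). exists eps. intros y Hy. exact Hy. }
  pose (I := fun ab : R * R => RInt f (fst ab) (snd ab)).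
  destruct (proj1 (filterlim_locally_cauchy (F := filter_prod Fa Fb) I)) as [l Hl].
  { intros eps.
    assert (He : 0 < eps / 8) by (destruct eps; simpl; lra).
    pose (e := mkposreal _ He).
    exists (fun ab => (P (fst ab) /\ Rabs (Phi (fst ab) - A) < e) /\
                      (P (snd ab) /\ Rabs (Phi (snd ab) - B) < e)). split.
    - eapply Filter_prod; [apply (HlimA e) | apply (HlimB e) |]. intros; split; assumption.
    - intros [a b] [c d] [[Pa Ha] [Pb Hb']] [[Pc Hc] [Pd Hd]]. simpl in *.
      apply (norm_compat1 (V := V)). unfold I; simpl.
      assert (E : minus (RInt f c d) (RInt f a b) = plus (RInt f c a) (RInt f b d)).
      { rewrite <- (RInt_Chasles f c a d), <- (RInt_Chasles f a b d) by (apply Hex; assumption).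
        apply (plus_minus_middle (G := V)). }
      eapply Rle_lt_trans; [apply Req_le; exact (f_equal norm E)|].
      eapply Rle_lt_trans; [apply (norm_triangle (V := V))|].
      pose proof (Hn c a Pc Pa) as H1. pose proof (Hn b d Pb Pd) as H2.
      apply Rabs_def2 in Ha. apply Rabs_def2 in Hb'. apply Rabs_def2 in Hc. apply Rabs_def2 in Hd.
      assert (Rabs (Phi a - Phi c) < eps / 2) by (apply Rabs_def1; lra).
      assert (Rabs (Phi d - Phi b) < eps / 2) by (apply Rabs_def1; lra).
      lra. }
  assert (Hil : is_RInt_gen f Fa Fb l).
  { intros Q HQ. unfold filtermapi. specialize (Hl Q HQ). unfold filtermap in Hl.
    eapply filter_imp; [| exact (filter_and _ _ Hl (ib_prod _ _ _ HI))].
    intros [a b] [H1 [H2 [H3 H4]]]. simpl in *. exists (RInt f a b). split; [|exact H1].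
    apply (RInt_correct (V := V)). now apply Hex. }
  exists l; split; [exact Hil|].
  apply (RInt_gen_norm (Fa := Fa) (Fb := Fb) f g l (B - A)).
  - eapply filter_imp; [| exact (ib_prod _ _ _ HI)]. now intros ab [? _].
  - eapply filter_imp; [| exact (ib_prod _ _ _ HI)]. intros ab [_ [H1 H2]] x Hx.
    apply Hb. now apply (ib_convex _ _ _ HI (fst ab) x (snd ab)).
  - exact Hil.
  - apply (is_RInt_gen_antiderivative (V := R_CompleteNormedModule) P Fa Fb Phi g A B); assumption.
Qed.

(** * Continuity and integrals of complex functions of a real variable *)

Definition Ccont (f : R -> C) (x : R) : Prop :=
  continuous (fun t => Re (f t)) x /\ continuous (fun t => Im (f t)) x.

Lemma Ccont_continuous (f : R -> C) (x : R) :
  Ccont f x -> continuous (U := C_R_NormedModule) f x.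
Proof.
  intros [H1 H2] Q [eps He]. unfold filtermap.
  assert (K1 := H1 (fun y => ball (Re (f x)) eps y) (ex_intro _ eps (fun y h => h))).
  assert (K2 := H2 (fun y => ball (Im (f x)) eps y) (ex_intro _ eps (fun y h => h))).
  refine (filter_imp _ _ _ (filter_and (F := locally x) _ _ K1 K2)).
  intros t [h1 h2]. apply He. split; assumption.
Qed.

Lemma Ccont_ext (f g : R -> C) (x : R) : (forall t, f t = g t) -> Ccont f x -> Ccont g x.
Proof.
  intros E [H1 H2]; split;
    [eapply (continuous_ext (fun t => Re (f t))); [|exact H1]
    |eapply (continuous_ext (fun t => Im (f t))); [|exact H2]];
    intros t; simpl; now rewrite E.
Qed.

Lemma is_Cderive_Ccont (f : R -> C) (x : R) (l : C) : is_Cderive f x l -> Ccont f x.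
Proof.
  intros [H1 H2]; split.
  - apply (ex_derive_continuous (V := R_NormedModule) (fun t => Re (f t)) x). now exists (Re l).
  - apply (ex_derive_continuous (V := R_NormedModule) (fun t => Im (f t)) x). now exists (Im l).
Qed.

Lemma Ccont_const (c : C) (x : R) : Ccont (fun _ => c) x.
Proof. split; apply continuous_const. Qed.

Lemma Ccont_RtoC (f : R -> R) (x : R) : continuous f x -> Ccont (fun t => RtoC (f t)) x.
Proof. intros H; split; [exact H | exact (continuous_const 0 x)]. Qed.

Lemma Ccont_plus (f g : R -> C) (x : R) :
  Ccont f x -> Ccont g x -> Ccont (fun t => f t + g t)%C x.
Proof.
  intros [H1 H2] [H3 H4]; split.
  - exact (continuous_plus (V := R_NormedModule) _ _ x H1 H3).
  - exact (continuous_plus (V := R_NormedModule) _ _ x H2 H4).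
Qed.

Lemma Ccont_mult (f g : R -> C) (x : R) :
  Ccont f x -> Ccont g x -> Ccont (fun t => f t * g t)%C x.
Proof.
  intros [H1 H2] [H3 H4]; split.
  - exact (continuous_minus (V := R_NormedModule) _ _ x
      (continuous_mult (K := R_AbsRing) _ _ x H1 H3) (continuous_mult (K := R_AbsRing) _ _ x H2 H4)).
  - exact (continuous_plus (V := R_NormedModule) _ _ x
      (continuous_mult (K := R_AbsRing) _ _ x H1 H4) (continuous_mult (K := R_AbsRing) _ _ x H2 H3)).
Qed.

Lemma Ccont_minus (f g : R -> C) (x : R) :
  Ccont f x -> Ccont g x -> Ccont (fun t => f t - g t)%C x.
Proof.
  intros [H1 H2] [H3 H4]; split.
  - exact (continuous_minus (V := R_NormedModule) _ _ x H1 H3).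
  - exact (continuous_minus (V := R_NormedModule) _ _ x H2 H4).
Qed.

Lemma Ccont_Cexp (f : R -> C) (x : R) : Ccont f x -> Ccont (fun t => Cexp (f t)) x.
Proof.
  intros [H1 H2].
  assert (He : continuous (fun t => exp (Re (f t))) x).
  { apply (continuous_comp (fun t => Re (f t)) exp); [exact H1 | apply continuous_exp]. }
  assert (Hc : continuous (fun t => cos (Im (f t))) x).
  { apply (continuous_comp (fun t => Im (f t)) cos); [exact H2 | apply continuous_cos]. }
  assert (Hs : continuous (fun t => sin (Im (f t))) x).
  { apply (continuous_comp (fun t => Im (f t)) sin); [exact H2 | apply continuous_sin]. }
  split.
  - exact (continuous_mult (K := R_AbsRing) _ _ x He Hc).
  - exact (continuous_mult (K := R_AbsRing) _ _ x He Hs).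
Qed.

Lemma Ccont_pow (f : R -> C) (n : nat) (x : R) : Ccont f x -> Ccont (fun t => f t ^ n)%C x.
Proof.
  intros H. induction n as [|n IH].
  - exact (Ccont_const 1 x).
  - exact (Ccont_mult _ _ x H IH).
Qed.

Lemma Ccont_Cmod (f : R -> C) (x : R) : Ccont f x -> continuous (fun t => Cmod (f t)) x.
Proof.
  intros H. apply (continuous_ext (fun t => norm (K := R_AbsRing) (V := C_R_NormedModule) (f t))).
  - intros t. symmetry; apply Cmod_norm.
  - eapply filterlim_comp; [exact (Ccont_continuous f x H)|].
    exact (filterlim_norm (K := R_AbsRing) (V := C_R_NormedModule) (f x)).
Qed.

(** Writes f as Re f times 1 plus Im f times [Ci], that is, with real functions acting on constant
    vectors. *)
Lemma is_Cderive_is_derive (f : R -> C) (x : R) (l : C) :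
  is_Cderive f x l -> is_derive (V := C_R_NormedModule) f x l.
Proof.
  intros [H1 H2].
  pose proof (is_derive_scal_l (V := C_R_NormedModule) _ _ _ (RtoC 1) H1) as K1.
  pose proof (is_derive_scal_l (V := C_R_NormedModule) _ _ _ Ci H2) as K2.
  pose proof (is_derive_plus (V := C_R_NormedModule) _ _ _ _ _ K1 K2) as K.
  assert (E : forall a b : R, plus (G := C_R_NormedModule) (scal (V := C_R_NormedModule) a (RtoC 1))
                (scal (V := C_R_NormedModule) b Ci) = (a, b)).
  { intros a b. apply C_ext; cbn; unfold plus, scal, mult; simpl; unfold mult; simpl; ring. }
  rewrite E in K.
  replace (Re l, Im l) with l in K by (destruct l; reflexivity).
  eapply is_derive_ext; [|exact K].
  intros t. simpl. rewrite E. now destruct (f t).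
Qed.

Definition CInt (Fa Fb : (R -> Prop) -> Prop) (f : R -> C) (l : C) : Prop :=
  is_RInt_gen (V := C_R_NormedModule) f Fa Fb l.

Lemma CInt_RInt_gen (Fa Fb : (R -> Prop) -> Prop) (f : R -> C) (l : C) :
  ProperFilter Fa -> ProperFilter Fb ->
  CInt Fa Fb f l -> RInt_gen (V := C_R_CompleteNormedModule) f Fa Fb = l.
Proof.
  intros HA HB H.
  exact (is_RInt_gen_unique (V := C_R_CompleteNormedModule) f l H).
Qed.

Lemma CInt_unique (Fa Fb : (R -> Prop) -> Prop) (f : R -> C) (l l' : C) :
  ProperFilter Fa -> ProperFilter Fb -> CInt Fa Fb f l -> CInt Fa Fb f l' -> l = l'.
Proof.
  intros HA HB H H'.
  rewrite <- (CInt_RInt_gen Fa Fb f l), <- (CInt_RInt_gen Fa Fb f l'); auto.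
Qed.

Lemma CInt_plus (Fa Fb : (R -> Prop) -> Prop) (f g : R -> C) (lf lg : C) :
  Filter Fa -> Filter Fb -> CInt Fa Fb f lf -> CInt Fa Fb g lg ->
  CInt Fa Fb (fun x => f x + g x)%C (lf + lg)%C.
Proof.
  intros HA HB H H'. exact (is_RInt_gen_plus (V := C_R_NormedModule) f g lf lg H H').
Qed.

Lemma is_RInt_gen_map {V W : NormedModule R_AbsRing} (T : V -> W) (Fa Fb : (R -> Prop) -> Prop)
    (f : R -> V) (l : V) :
  Filter Fa -> Filter Fb ->
  (forall a b y, is_RInt f a b y -> is_RInt (fun x => T (f x)) a b (T y)) ->
  filterlim T (locally l) (locally (T l)) ->
  is_RInt_gen f Fa Fb l -> is_RInt_gen (fun x => T (f x)) Fa Fb (T l).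
Proof.
  intros HA HB HT HC H Q HQ. specialize (H _ (HC Q HQ)). unfold filtermapi in *.
  eapply filter_imp; [|exact H]. intros ab [y [H1 H2]]. exists (T y). split; [now apply HT | exact H2].
Qed.

(** Scalars of [C_R_NormedModule] are real, so multiplication by a complex constant goes through the
    components. *)
Lemma is_RInt_Cmult (c : C) (f : R -> C) (a b : R) (l : C) :
  is_RInt (V := C_R_NormedModule) f a b l ->
  is_RInt (V := C_R_NormedModule) (fun x => c * f x)%C a b (c * l)%C.
Proof.
  intros H.
  pose proof (is_RInt_fct_extend_fst (U := R_NormedModule) (V := R_NormedModule) f a b l H) as H1.
  pose proof (is_RInt_fct_extend_snd (U := R_NormedModule) (V := R_NormedModule) f a b l H) as H2.
  apply (is_RInt_fct_extend_pair (U := R_NormedModule) (V := R_NormedModule)).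
  - exact (is_RInt_minus (V := R_NormedModule) _ _ a b _ _
      (is_RInt_scal (V := R_NormedModule) _ a b (fst c) _ H1)
      (is_RInt_scal (V := R_NormedModule) _ a b (snd c) _ H2)).
  - exact (is_RInt_plus (V := R_NormedModule) _ _ a b _ _
      (is_RInt_scal (V := R_NormedModule) _ a b (fst c) _ H2)
      (is_RInt_scal (V := R_NormedModule) _ a b (snd c) _ H1)).
Qed.

Lemma CInt_scal (Fa Fb : (R -> Prop) -> Prop) (c : C) (f : R -> C) (l : C) :
  Filter Fa -> Filter Fb -> CInt Fa Fb f l -> CInt Fa Fb (fun x => c * f x)%C (c * l)%C.
Proof.
  intros HA HB H.
  apply (is_RInt_gen_map (V := C_R_NormedModule) (W := C_R_NormedModule) (fun z : C => c * z)%C); auto.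
  - intros a b y. apply is_RInt_Cmult.
  - intros Q [eps He].
    (* The factor 2 absorbs the sqrt 2 between [Cmod] and the maximum of the components, which
       defines the balls here; the + 1 covers c = 0. *)
    assert (Hp : 0 < eps / (2 * (Cmod c + 1))).
    { apply Rdiv_lt_0_compat; [apply cond_pos | pose proof (Cmod_ge_0 c); lra]. }
    exists (mkposreal _ Hp). intros y Hy. apply He.
    assert (Hb : Cmod (y - l) < eps / (Cmod c + 1)).
    { destruct Hy as [h1 h2]. unfold ball in h1, h2; simpl in h1, h2.
      unfold AbsRing_ball, abs, minus, plus, opp in h1, h2; simpl in h1, h2.
      eapply Rle_lt_trans; [apply Cmod_2Rmax|].
      assert (Rmax (Rabs (fst (y - l)%C)) (Rabs (snd (y - l)%C)) < eps / (2 * (Cmod c + 1))).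
      { apply Rmax_lub_lt; assumption. }
      replace (eps / (Cmod c + 1)) with (2 * (eps / (2 * (Cmod c + 1))))
        by (field; pose proof (Cmod_ge_0 c); lra).
      assert (sqrt 2 <= 2).
      { rewrite <- (sqrt_Rsqr 2) at 2 by lra. apply sqrt_le_1_alt. unfold Rsqr; lra. }
      assert (0 < sqrt 2) by (apply sqrt_lt_R0; lra).
      pose proof (Rabs_pos (fst (y - l)%C)). pose proof (Rmax_l (Rabs (fst (y - l)%C)) (Rabs (snd (y - l)%C))).
      apply Rle_lt_trans with (2 * Rmax (Rabs (fst (y - l)%C)) (Rabs (snd (y - l)%C)));
        [apply Rmult_le_compat_r | apply Rmult_lt_compat_l]; lra. }
    assert (Hm : Cmod (c * y - c * l) < eps).
    { replace (c * y - c * l)%C with (c * (y - l))%C by ring. rewrite Cmod_mult.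
      pose proof (Cmod_ge_0 c). pose proof (cond_pos eps).
      apply Rle_lt_trans with (Cmod c * (eps / (Cmod c + 1))).
      - apply Rmult_le_compat_l; lra.
      - apply Rmult_lt_reg_r with (Cmod c + 1); [lra|]. field_simplify; [|lra]. nra. }
    pose proof (Rmax_Cmod (c * y - c * l)%C) as Hx.
    pose proof (Rmax_l (Rabs (fst (c * y - c * l)%C)) (Rabs (snd (c * y - c * l)%C))).
    pose proof (Rmax_r (Rabs (fst (c * y - c * l)%C)) (Rabs (snd (c * y - c * l)%C))).
    split; [change (Rabs (fst (c * y - c * l)%C) < eps) | change (Rabs (snd (c * y - c * l)%C) < eps)]; lra.
Qed.

Lemma CInt_minus (Fa Fb : (R -> Prop) -> Prop) (f g : R -> C) (lf lg : C) :
  Filter Fa -> Filter Fb -> CInt Fa Fb f lf -> CInt Fa Fb g lg ->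
  CInt Fa Fb (fun x => f x - g x)%C (lf - lg)%C.
Proof.
  intros HA HB H H'. exact (is_RInt_gen_minus (V := C_R_NormedModule) f g lf lg H H').
Qed.

Lemma CInt_Re (Fa Fb : (R -> Prop) -> Prop) (f : R -> C) (l : C) :
  Filter Fa -> Filter Fb -> CInt Fa Fb f l ->
  is_RInt_gen (V := R_NormedModule) (fun x => Re (f x)) Fa Fb (Re l).
Proof.
  intros HA HB H.
  apply (is_RInt_gen_map (V := C_R_NormedModule) (W := R_NormedModule) Re); auto.
  - intros a b y. exact (is_RInt_fct_extend_fst (U := R_NormedModule) (V := R_NormedModule) f a b y).
  - intros Q [eps He]. exists eps. intros y [Hy _]. now apply He.
Qed.

Lemma CInt_ext P (Fa Fb : (R -> Prop) -> Prop) (f g : R -> C) (l : C) :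
  interval_between P Fa Fb -> (forall x, P x -> f x = g x) -> CInt Fa Fb f l -> CInt Fa Fb g l.
Proof.
  intros HI E H.
  pose proof (ib_left _ _ _ HI). pose proof (ib_right _ _ _ HI).
  refine (is_RInt_gen_ext (V := C_R_NormedModule) f g l _ H).
  eapply filter_imp; [| exact (ib_prod _ _ _ HI)].
  intros ab [_ [Pa Pb]] x Hx. apply E. apply (ib_convex_minmax _ _ _ HI (fst ab) (snd ab)); auto. lra.
Qed.

Lemma CInt_dominated P Fa Fb (f : R -> C) (g Phi : R -> R) (A B : R) :
  interval_between P Fa Fb ->
  (forall x, P x -> Ccont f x) -> (forall x, P x -> continuous g x) ->
  (forall x, P x -> is_derive Phi x (g x)) -> (forall x, P x -> Cmod (f x) <= g x) ->
  filterlim Phi Fa (locally A) -> filterlim Phi Fb (locally B) ->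
  exists l : C, CInt Fa Fb f l /\ Cmod l <= B - A.
Proof.
  intros HI Hf Hg HD Hb HA HB.
  destruct (ex_RInt_gen_dominated (V := C_R_CompleteNormedModule) P Fa Fb f g Phi A B) as [l [H1 H2]];
    auto.
  - intros x Hx. apply Ccont_continuous. auto.
  - intros x Hx. eapply Rle_trans; [|apply Hb, Hx]. apply Req_le. symmetry; apply Cmod_norm.
  - exists l; split; [exact H1|]. eapply Rle_trans; [apply Req_le, Cmod_norm | exact H2].
Qed.

Lemma CInt_bound P Fa Fb (f : R -> C) (g Phi : R -> R) (A B : R) (l : C) :
  interval_between P Fa Fb ->
  (forall x, P x -> Ccont f x) -> (forall x, P x -> continuous g x) ->
  (forall x, P x -> is_derive Phi x (g x)) -> (forall x, P x -> Cmod (f x) <= g x) ->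
  filterlim Phi Fa (locally A) -> filterlim Phi Fb (locally B) ->
  CInt Fa Fb f l -> Cmod l <= B - A.
Proof.
  intros HI Hf Hg HD Hb HA HB Hl.
  destruct (CInt_dominated P Fa Fb f g Phi A B) as [l' [H1 H2]]; auto.
  rewrite (CInt_unique Fa Fb f l l'); auto; [apply (ib_left _ _ _ HI) | apply (ib_right _ _ _ HI)].
Qed.

Lemma CInt_antiderivative P Fa Fb (F f : R -> C) (la lb : C) :
  interval_between P Fa Fb ->
  (forall x, P x -> is_Cderive F x (f x)) -> (forall x, P x -> Ccont f x) ->
  filterlim (fun x => Cmod (F x - la)) Fa (locally 0) ->
  filterlim (fun x => Cmod (F x - lb)) Fb (locally 0) ->
  CInt Fa Fb f (lb - la)%C.
Proof.
  intros HI HD HC Ha Hb.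
  assert (Hlim : forall (G : (R -> Prop) -> Prop) c, Filter G ->
    filterlim (fun x => Cmod (F x - c)) G (locally 0) ->
    filterlim F G (locally (T := C_R_NormedModule) c)).
  { intros G c HG H Q [eps He].
    assert (K := H (fun y => Rabs (y - 0) < eps) (ex_intro _ eps (fun y h => h))).
    unfold filtermap in *. eapply filter_imp; [|exact K].
    intros x Hx. apply He. cbv beta in Hx. rewrite Rminus_0_r, Rabs_right in Hx by apply Rle_ge, Cmod_ge_0.
    pose proof (Rmax_Cmod (F x - c)%C).
    pose proof (Rmax_l (Rabs (fst (F x - c)%C)) (Rabs (snd (F x - c)%C))).
    pose proof (Rmax_r (Rabs (fst (F x - c)%C)) (Rabs (snd (F x - c)%C))).
    split; [change (Rabs (fst (F x - c)%C) < eps) | change (Rabs (snd (F x - c)%C) < eps)]; lra. }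
  pose proof (ib_left _ _ _ HI). pose proof (ib_right _ _ _ HI).
  apply (is_RInt_gen_antiderivative (V := C_R_CompleteNormedModule) P Fa Fb F f la lb); auto.
  - intros x Hx. apply is_Cderive_is_derive; auto.
  - intros x Hx. apply Ccont_continuous; auto.
  - apply Hlim; auto. apply filter_filter.
  - apply Hlim; auto. apply filter_filter.
Qed.

(** * Power series expansions with remainder bounds *)

Definition Clim (u : nat -> C) (l : C) : Prop := is_lim_seq (fun n => Cmod (u n - l)) 0.

Lemma is_lim_seq_le_0 (u v : nat -> R) :
  (forall n, 0 <= u n <= v n) -> is_lim_seq v 0 -> is_lim_seq u 0.
Proof.
  intros H Hv. apply (is_lim_seq_le_le (fun _ => 0) u v 0); auto. apply is_lim_seq_const.
Qed.

Lemma Clim_const (c : C) : Clim (fun _ => c) c.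
Proof.
  unfold Clim. apply (is_lim_seq_ext (fun _ => 0)); [|apply is_lim_seq_const].
  intros n. replace (c - c)%C with (RtoC 0) by ring. now rewrite Cmod_0.
Qed.

Lemma Clim_ext (u v : nat -> C) (l l' : C) :
  (forall n, u n = v n) -> l = l' -> Clim u l -> Clim v l'.
Proof.
  intros E <-. unfold Clim. apply is_lim_seq_ext. intros n. now rewrite E.
Qed.

Lemma Clim_plus (u v : nat -> C) (l l' : C) :
  Clim u l -> Clim v l' -> Clim (fun n => u n + v n)%C (l + l')%C.
Proof.
  intros H H'. unfold Clim.
  apply (is_lim_seq_le_0 _ (fun n => Cmod (u n - l) + Cmod (v n - l'))).
  - intros n; split; [apply Cmod_ge_0|].
    replace (u n + v n - (l + l'))%C with ((u n - l) + (v n - l'))%C by ring. apply Cmod_triangle.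
  - replace 0 with (0 + 0) by ring. apply (is_lim_seq_plus' _ _ _ _ H H').
Qed.

Lemma Clim_scal (c : C) (u : nat -> C) (l : C) :
  Clim u l -> Clim (fun n => c * u n)%C (c * l)%C.
Proof.
  intros H. unfold Clim.
  apply (is_lim_seq_ext (fun n => Cmod c * Cmod (u n - l))).
  - intros n. rewrite <- Cmod_mult. f_equal. ring.
  - replace 0 with (Cmod c * 0) by ring. apply (is_lim_seq_scal_l _ (Cmod c) 0 H).
Qed.

Lemma Clim_bound (u : nat -> C) (l : C) (b : R) :
  Clim u l -> (exists N, forall n, (N <= n)%nat -> Cmod (u n) <= b) -> Cmod l <= b.
Proof.
  intros H [N HN].
  assert (K : is_lim_seq (fun n => b + Cmod (u n - l)) (b + 0)).
  { apply is_lim_seq_plus'; [apply is_lim_seq_const | exact H]. }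
  rewrite Rplus_0_r in K.
  apply (is_lim_seq_le_loc (fun _ => Cmod l) _ (Cmod l) b) in K; [exact K | | apply is_lim_seq_const].
  exists N. intros n Hn.
  replace l with (u n + - (u n - l))%C at 1 by ring.
  eapply Rle_trans; [apply Cmod_triangle|]. rewrite Cmod_opp. specialize (HN n Hn). lra.
Qed.

Lemma Clim_bound_eventually (u : nat -> C) (l c : C) (b : nat -> R) :
  Clim u l -> (forall n, Cmod (u n - c) <= b n) -> is_lim_seq b 0 -> c = l.
Proof.
  intros H Hb Hl.
  assert (K : Cmod (c - l) = 0).
  { assert (K : is_lim_seq (fun n => b n + Cmod (u n - l)) (0 + 0)).
    { apply is_lim_seq_plus'; assumption. }
    rewrite Rplus_0_r in K.
    apply (is_lim_seq_le (fun _ => Cmod (c - l)) _ (Cmod (c - l)) 0) in K;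
      [| | apply is_lim_seq_const].
    - simpl in K. pose proof (Cmod_ge_0 (c - l)). lra.
    - intros n. replace (c - l)%C with (- (u n - c) + (u n - l))%C by ring.
      eapply Rle_trans; [apply Cmod_triangle|]. rewrite Cmod_opp. specialize (Hb n). lra. }
  apply Cmod_eq_0 in K. replace c with ((c - l) + l)%C by ring. rewrite K. ring.
Qed.

Lemma Clim_unique (u : nat -> C) (l l' : C) : Clim u l -> Clim u l' -> l = l'.
Proof.
  intros H H'. apply (Clim_bound_eventually u l' l (fun n => Cmod (u n - l))); auto.
  intros; apply Rle_refl.
Qed.

(** * Partial sums and convergence of series *)

Lemma Csum_plus (u v : nat -> C) (n : nat) :
  Csum (fun k => u k + v k)%C n = (Csum u n + Csum v n)%C.
Proof. induction n as [|n IH]; cbn [Csum]; [ring | rewrite IH; ring]. Qed.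

Lemma Csum_scal (c : C) (u : nat -> C) (n : nat) :
  Csum (fun k => c * u k)%C n = (c * Csum u n)%C.
Proof. induction n as [|n IH]; cbn [Csum]; [ring | rewrite IH; ring]. Qed.

Lemma Csum_ext (u v : nat -> C) (n : nat) :
  (forall k, (k < n)%nat -> u k = v k) -> Csum u n = Csum v n.
Proof.
  induction n as [|n IH]; intros H; cbn [Csum]; [reflexivity|].
  rewrite IH, H; auto.
Qed.

Lemma Csum_sum_n (u : nat -> C) (n : nat) :
  sum_n (G := C_AbelianMonoid) u n = Csum u (S n).
Proof.
  induction n as [|n IH].
  - rewrite sum_O. exact (eq_sym (Cplus_0_l (u 0%nat))).
  - rewrite sum_Sn, IH. reflexivity.
Qed.

Lemma is_series_Clim (u : nat -> C) (l : C) :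
  is_series (K := C_AbsRing) (V := C_NormedModule) u l <-> Clim (Csum u) l.
Proof.
  split.
  - intros H. unfold Clim. apply is_lim_seq_incr_1.
    apply is_lim_seq_spec. intros eps.
    assert (K := H (fun y => Cmod (y - l) < eps)).
    assert (Hl : locally (T := C_NormedModule) l (fun y => Cmod (y - l) < eps)).
    { apply (locally_le_locally_norm (K := C_AbsRing) (V := C_NormedModule)).
      exists eps. intros y Hy. exact Hy. }
    specialize (K Hl). destruct K as [N HN]. exists N. intros n Hn.
    rewrite Rminus_0_r, Rabs_right by apply Rle_ge, Cmod_ge_0.
    rewrite <- Csum_sum_n. apply HN, Hn.
  - intros H Q HQ.
    apply (locally_norm_le_locally (K := C_AbsRing) (V := C_NormedModule)) in HQ.
    destruct HQ as [eps He].
    apply is_lim_seq_incr_1 in H.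
    apply is_lim_seq_spec in H. destruct (H eps) as [N HN].
    exists N. intros n Hn. apply He. specialize (HN n Hn).
    rewrite Rminus_0_r, Rabs_right in HN by apply Rle_ge, Cmod_ge_0.
    rewrite <- Csum_sum_n in HN. exact HN.
Qed.

Lemma Clim_components (u : nat -> C) (a b : R) :
  is_lim_seq (fun n => Re (u n)) a -> is_lim_seq (fun n => Im (u n)) b -> Clim u (a, b).
Proof.
  intros Ha Hb. unfold Clim.
  apply (is_lim_seq_le_0 _ (fun n => 2 * (Rabs (Re (u n) - a) + Rabs (Im (u n) - b)))).
  - intros n; split; [apply Cmod_ge_0|].
    replace (u n - (a, b))%C with (RtoC (Re (u n) - a) + Ci * RtoC (Im (u n) - b))%C
      by (apply C_ext; cbn; unfold Re, Im; ring).
    eapply Rle_trans; [apply Cmod_triangle|].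
    rewrite Cmod_mult, Cmod_Ci, !Cmod_R.
    pose proof (Rabs_pos (Re (u n) - a)). pose proof (Rabs_pos (Im (u n) - b)). lra.
  - assert (K : forall v c, is_lim_seq v (Finite c) -> is_lim_seq (fun n => Rabs (v n - c)) 0).
    { intros v c Hv. apply is_lim_seq_spec in Hv. apply is_lim_seq_spec. intros eps.
      destruct (Hv eps) as [N HN]. exists N. intros n Hn.
      rewrite Rminus_0_r, Rabs_Rabsolu. now apply HN. }
    replace 0 with (2 * (0 + 0)) by ring.
    apply (is_lim_seq_scal_l _ 2 (0 + 0)). apply is_lim_seq_plus'; now apply K.
Qed.

(* Convergence tests are phrased with a telescoping majorant [T n - T (S n)],
   so that [T N] is also the bound on the remainder. *)
Lemma Csum_telescope_bound (u : nat -> C) (T : nat -> R) (n m : nat) :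
  (forall k, Cmod (u k) <= T k - T (S k)) ->
  Cmod (Csum u (n + m) - Csum u n) <= T n - T (n + m)%nat.
Proof.
  intros H. induction m as [|m IH].
  - rewrite Nat.add_0_r. replace (Csum u n - Csum u n)%C with (RtoC 0) by ring. rewrite Cmod_0. lra.
  - rewrite Nat.add_succ_r. cbn [Csum].
    replace (Csum u (n + m) + u (n + m)%nat - Csum u n)%C
      with ((Csum u (n + m) - Csum u n) + u (n + m)%nat)%C by ring.
    eapply Rle_trans; [apply Cmod_triangle|]. specialize (H (n + m)%nat). lra.
Qed.

(** T decreases to 0, hence is nonnegative, and T n bounds every increment of the partial sums
    beyond n. They are therefore Cauchy in each component. *)
Lemma Clim_telescope (u : nat -> C) (T : nat -> R) :
  (forall k, Cmod (u k) <= T k - T (S k)) -> is_lim_seq T 0 ->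
  exists l, Clim (Csum u) l /\ forall N, Cmod (l - Csum u N) <= T N.
Proof.
  intros H HT.
  assert (Hd : forall k, T (S k) <= T k).
  { intros k. pose proof (Cmod_ge_0 (u k)). specialize (H k). lra. }
  assert (Hp : forall k, 0 <= T k).
  { intros k. apply (is_lim_seq_decr_compare T 0 HT Hd k). }
  assert (Hc : forall n m, (n <= m)%nat -> Cmod (Csum u m - Csum u n) <= T n).
  { intros n m L. replace m with (n + (m - n))%nat by lia.
    eapply Rle_trans; [apply Csum_telescope_bound, H|]. specialize (Hp (n + (m - n))%nat). lra. }
  assert (Hcomp : forall p : C -> R, (forall z w, p (z - w)%C = p z - p w) ->
     (forall z, Rabs (p z) <= Cmod z) -> exists a : R, is_lim_seq (fun n => p (Csum u n)) a).
  { intros p Hp1 Hp2. apply ex_lim_seq_cauchy_corr. intros eps.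
    apply is_lim_seq_spec in HT. destruct (HT (pos_div_2 eps)) as [N HN].
    exists N. intros n m Hn Hm.
    assert (K : forall j, (N <= j)%nat -> Rabs (p (Csum u j) - p (Csum u N)) < eps / 2).
    { intros j Hj. rewrite <- Hp1. eapply Rle_lt_trans; [apply Hp2|].
      eapply Rle_lt_trans; [apply Hc, Hj|]. specialize (HN N (le_n N)). rewrite Rminus_0_r in HN.
      eapply Rle_lt_trans; [apply Rle_abs | exact HN]. }
    pose proof (K n Hn) as K1. pose proof (K m Hm) as K2.
    apply Rabs_def2 in K1. apply Rabs_def2 in K2. apply Rabs_def1; lra. }
  destruct (Hcomp Re) as [a Ha]; [reflexivity | apply re_le_Cmod |].
  destruct (Hcomp Im) as [b Hb]; [reflexivity | |].
  { intros z. eapply Rle_trans; [apply Rmax_r | apply (Rmax_Cmod z)]. }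
  exists (a, b). split; [now apply Clim_components|].
  intros N. apply (Clim_bound (fun m => Csum u m - Csum u N)%C).
  - apply (Clim_ext (fun m => Csum u m + (- Csum u N))%C _ ((a, b) + - Csum u N)%C);
      [reflexivity | reflexivity |].
    apply Clim_plus; [now apply Clim_components | apply Clim_const].
  - exists N. intros; now apply Hc.
Qed.

Lemma is_lim_seq_geom_le (C0 q : R) : 0 <= q < 1 -> is_lim_seq (fun n => C0 * q ^ n) 0.
Proof.
  intros Hq. replace 0 with (C0 * 0) by ring.
  apply (is_lim_seq_scal_l _ C0 0). apply is_lim_seq_geom. rewrite Rabs_right; lra.
Qed.

(* Bounding the remainders, rather than asking for convergence only, yields the
   value at [N = 1], the derivative at [N = 2] and termwise summability. *)
Definition taylor_at (f : C -> C) (z0 : C) (r M : R) (a : nat -> C) : Prop :=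
  0 < r /\ forall h N, Cmod h < r ->
    Cmod (f (z0 + h)%C - Csum (fun k => a k * h ^ k)%C N) <= M * (Cmod h / r) ^ N.

Lemma taylor_at_bound_nonneg f z0 r M a : taylor_at f z0 r M a -> 0 <= M.
Proof.
  intros [Hr H]. specialize (H 0 0%nat).
  rewrite Cmod_0 in H. specialize (H Hr). simpl in H.
  pose proof (Cmod_ge_0 (f (z0 + 0) - 0)%C). lra.
Qed.

Lemma taylor_at_shrink f z0 r r' M a :
  0 < r' <= r -> taylor_at f z0 r M a -> taylor_at f z0 r' M a.
Proof.
  intros Hr' H. pose proof (taylor_at_bound_nonneg _ _ _ _ _ H) as HM. destruct H as [Hr H].
  split; [lra|]. intros h N Hh.
  eapply Rle_trans; [apply H; lra|]. apply Rmult_le_compat_l; [exact HM|].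
  pose proof (Cmod_ge_0 h). apply pow_incr. split.
  - apply Rmult_le_pos; [lra | apply Rlt_le, Rinv_0_lt_compat; lra].
  - apply Rmult_le_compat_l; [lra|]. apply Rinv_le_contravar; lra.
Qed.

Lemma taylor_at_plus f g z0 r M M' a b :
  taylor_at f z0 r M a -> taylor_at g z0 r M' b ->
  taylor_at (fun z => f z + g z)%C z0 r (M + M') (fun k => a k + b k)%C.
Proof.
  intros [Hr H] [_ H']. split; [exact Hr|]. intros h N Hh.
  rewrite (Csum_ext _ (fun k => a k * h ^ k + b k * h ^ k)%C) by (intros; ring).
  rewrite Csum_plus.
  match goal with |- Cmod ?e <= _ => replace e with
    ((f (z0 + h) - Csum (fun k => a k * h ^ k) N) + (g (z0 + h) - Csum (fun k => b k * h ^ k) N))%C by ring end.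
  eapply Rle_trans; [apply Cmod_triangle|].
  specialize (H h N Hh). specialize (H' h N Hh). lra.
Qed.

Lemma taylor_at_scal c f z0 r M a :
  taylor_at f z0 r M a -> taylor_at (fun z => c * f z)%C z0 r (Cmod c * M) (fun k => c * a k)%C.
Proof.
  intros [Hr H]. split; [exact Hr|]. intros h N Hh.
  rewrite (Csum_ext _ (fun k => c * (a k * h ^ k))%C) by (intros; ring).
  rewrite Csum_scal.
  match goal with |- Cmod ?e <= _ => replace e with
    (c * (f (z0 + h) - Csum (fun k => a k * h ^ k) N))%C by ring end.
  rewrite Cmod_mult, Rmult_assoc. apply Rmult_le_compat_l; [apply Cmod_ge_0 | auto].
Qed.

(** At z = z0 + h the factor is (z0 - c) + h. The part with h shifts the coefficients by one, and
    the order lost in the remainder is made up by |h| <= r. This is how the factors s - 1 and s of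
    the continuation formula are handled. *)
Lemma taylor_at_linear c f z0 r M a :
  taylor_at f z0 r M a ->
  taylor_at (fun z => (z - c) * f z)%C z0 r ((Cmod (z0 - c) + r) * M)
    (fun k => (z0 - c) * a k + match k with O => 0 | S j => a j end)%C.
Proof.
  intros HT. pose proof (taylor_at_bound_nonneg _ _ _ _ _ HT) as HM. destruct HT as [Hr H].
  split; [exact Hr|]. intros h N Hh.
  assert (E : Csum (fun k => ((z0 - c) * a k + match k with O => 0 | S j => a j end) * h ^ k)%C N =
     ((z0 - c) * Csum (fun k => a k * h ^ k) N + h * match N with O => 0 | S j => Csum (fun k => a k * h ^ k) j end)%C).
  { induction N as [|N IH]; [cbn [Csum]; ring|]. cbn [Csum]. rewrite IH.
    destruct N as [|N]; cbn [Csum Cpow]; ring. }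
  rewrite E. clear E.
  pose proof (Cmod_ge_0 h) as Hh0. pose proof (Cmod_ge_0 (z0 - c)) as Hc0.
  assert (Hq : 0 <= Cmod h / r) by (apply Rmult_le_pos; [lra | apply Rlt_le, Rinv_0_lt_compat, Hr]).
  pose proof (pow_le _ N Hq) as HqN.
  assert (H1 : Cmod h * Cmod (f (z0 + h) - match N with O => 0 | S j => Csum (fun k => a k * h ^ k) j end)%C
             <= r * M * (Cmod h / r) ^ N).
  { destruct N as [|N].
    - pose proof (H h 0%nat Hh) as H0. simpl in *. rewrite Rmult_1_r in *.
      apply Rmult_le_compat; try lra. apply Cmod_ge_0.
    - pose proof (H h N Hh) as H0. 
      apply Rle_trans with (Cmod h * (M * (Cmod h / r) ^ N)).
      + apply Rmult_le_compat_l; assumption.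
      + apply Req_le. simpl. field. lra. }
  match goal with |- Cmod ?e <= _ => replace e with
    ((z0 - c) * (f (z0 + h) - Csum (fun k => a k * h ^ k) N)
     + h * (f (z0 + h) - match N with O => 0 | S j => Csum (fun k => a k * h ^ k) j end))%C by ring end.
  eapply Rle_trans; [apply Cmod_triangle|]. rewrite !Cmod_mult.
  pose proof (H h N Hh) as H0.
  assert (Cmod (z0 - c) * Cmod (f (z0 + h) - Csum (fun k => a k * h ^ k) N)%C
     <= Cmod (z0 - c) * (M * (Cmod h / r) ^ N)) by (apply Rmult_le_compat_l; lra).
  lra.
Qed.

(** The term of degree k is the difference of the remainders of orders k and k + 1. At |h| = r / 2
    these are at most M / 2^k and M / 2^(k+1), whose sum is below 2 M / 2^k. *)
Lemma taylor_at_coef_bound f z0 r M a k :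
  taylor_at f z0 r M a -> Cmod (a k) <= 2 * M / r ^ k.
Proof.
  intros HT. pose proof (taylor_at_bound_nonneg _ _ _ _ _ HT) as HM. destruct HT as [Hr H].
  set (h := RtoC (r / 2)).
  assert (Hh : Cmod h = r / 2) by (unfold h; rewrite Cmod_R, Rabs_right; lra).
  pose proof (H h k ltac:(lra)) as H1. pose proof (H h (S k) ltac:(lra)) as H2.
  rewrite Hh in *. replace (r / 2 / r) with (/ 2) in * by (field; lra).
  cbn [Csum] in H2.
  assert (H3 : Cmod (a k) * (r / 2) ^ k <= M * (/ 2) ^ k + M * (/ 2) ^ S k).
  { rewrite <- Hh, <- Cmod_pow, <- Cmod_mult.
    replace (a k * h ^ k)%C with ((f (z0 + h) - Csum (fun k => a k * h ^ k) k)
      + - (f (z0 + h) - (Csum (fun k => a k * h ^ k) k + a k * h ^ k)))%C by ring.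
    eapply Rle_trans; [apply Cmod_triangle|]. rewrite Cmod_opp. lra. }
  assert (Hpos : 0 < (/ 2) ^ k) by (apply pow_lt; lra).
  assert (Hrk : 0 < r ^ k) by (apply pow_lt; lra).
  replace ((r / 2) ^ k) with (r ^ k * (/ 2) ^ k) in H3 by (rewrite <- Rpow_mult_distr; reflexivity).
  simpl in H3.
  assert (H4 : Cmod (a k) * r ^ k <= 2 * M).
  { apply Rmult_le_reg_r with ((/ 2) ^ k); [exact Hpos|]. nra. }
  apply Rmult_le_reg_r with (r ^ k); [exact Hrk|].
  unfold Rdiv. rewrite (Rmult_assoc (2 * M)), Rinv_l by lra. lra.
Qed.

(** Plays the role of Weierstrass' theorem on series of analytic functions. The telescoping bounds
    make the coefficients summable degree by degree, and summing the remainders of the terms bounds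
    the remainder of the sum, on the same disc. *)
Lemma taylor_at_series (f : nat -> C -> C) (F : C -> C) z0 r (T : nat -> R) (a : nat -> nat -> C) :
  (forall n, taylor_at (f n) z0 r (T n - T (S n)) (a n)) -> is_lim_seq T 0 ->
  (forall h, Cmod h < r -> Clim (Csum (fun n => f n (z0 + h)%C)) (F (z0 + h)%C)) ->
  exists b, taylor_at F z0 r (T 0%nat) b.
Proof.
  intros Hf HT HF.
  assert (Hr : 0 < r) by (destruct (Hf 0%nat); assumption).
  assert (Hd : forall k, T (S k) <= T k).
  { intros k. pose proof (taylor_at_bound_nonneg _ _ _ _ _ (Hf k)). lra. }
  assert (Hp : forall k, 0 <= T k).
  { intros k. apply (is_lim_seq_decr_compare T 0 HT Hd k). }
  assert (Hb : forall k, exists b, Clim (Csum (fun n => a n k)) b).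
  { intros k. destruct (Clim_telescope (fun n => a n k) (fun n => 2 / r ^ k * T n)) as [b [Hb _]].
    - intros n. pose proof (taylor_at_coef_bound _ _ _ _ _ k (Hf n)). unfold Rdiv in *. lra.
    - replace 0 with (2 / r ^ k * 0) by ring. apply (is_lim_seq_scal_l T (2 / r ^ k) 0 HT).
    - now exists b. }
  pose (b := fun k => proj1_sig (constructive_indefinite_description _ (Hb k))).
  assert (Hbk : forall k, Clim (Csum (fun n => a n k)) (b k)).
  { intros k. exact (proj2_sig (constructive_indefinite_description _ (Hb k))). }
  exists b. split; [exact Hr|]. intros h N Hh.
  assert (Hc : Clim (Csum (fun n => Csum (fun k => a n k * h ^ k)%C N)) (Csum (fun k => b k * h ^ k)%C N)).
  { induction N as [|N IH].
    - apply (Clim_ext (fun _ => RtoC 0) _ 0); [|reflexivity | apply Clim_const].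
      intros n. induction n as [|n IHn]; cbn [Csum] in *; [reflexivity | rewrite <- IHn; ring].
    - cbn [Csum].
      apply (Clim_ext (fun n => Csum (fun i => Csum (fun k => a i k * h ^ k)%C N) n
               + h ^ N * Csum (fun i => a i N) n)%C _ (Csum (fun k => b k * h ^ k) N + h ^ N * b N)%C).
      + intros n. rewrite Csum_plus. f_equal. rewrite <- Csum_scal. apply Csum_ext. intros; ring.
      + ring.
      + apply Clim_plus; [exact IH | apply Clim_scal, Hbk]. }
  assert (Hdiff : Clim (Csum (fun n => f n (z0 + h) + (- 1) * Csum (fun k => a n k * h ^ k) N)%C)
                    (F (z0 + h) + (- 1) * Csum (fun k => b k * h ^ k) N)%C).
  { apply (Clim_ext (fun n => Csum (fun i => f i (z0 + h)%C) n
             + (- 1) * Csum (fun i => Csum (fun k => a i k * h ^ k) N) n)%C _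
             (F (z0 + h) + (- 1) * Csum (fun k => b k * h ^ k) N)%C); [|reflexivity|].
    - intros n. now rewrite Csum_plus, Csum_scal.
    - apply Clim_plus; [now apply HF | now apply Clim_scal]. }
  match goal with |- Cmod ?e <= _ => replace e with
    (F (z0 + h) + (- 1) * Csum (fun k => b k * h ^ k) N)%C by ring end.
  apply (Clim_bound _ _ _ Hdiff). exists 0%nat. intros n _.
  set (q := (Cmod h / r) ^ N).
  assert (Hq : 0 <= q).
  { apply pow_le. pose proof (Cmod_ge_0 h). apply Rmult_le_pos; [lra | apply Rlt_le, Rinv_0_lt_compat, Hr]. }
  pose proof (Csum_telescope_bound (fun n => f n (z0 + h) + (- 1) * Csum (fun k => a n k * h ^ k) N)%C
    (fun n => q * T n) 0 n) as K.
  cbn [Nat.add] in K.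
  eapply Rle_trans; [|eapply Rle_trans; [apply K|]].
  - apply Req_le. f_equal. cbn [Csum]. ring.
  - intros k. destruct (Hf k) as [_ Hk]. specialize (Hk h N Hh).
    replace (f k (z0 + h) + -1 * Csum (fun j => a k j * h ^ j) N)%C
      with (f k (z0 + h) - Csum (fun j => a k j * h ^ j) N)%C by ring.
    unfold q. lra.
  - specialize (Hp n). nra.
Qed.

(** Expands e^(h lambda) under the integral. The remainder of order N is at most (|h| |lambda|)^N /
    N! times e^(|h| |lambda|); pulling out (|h| / r)^N leaves two factors, each at most e^(r
    |lambda|), whence the weight e^(2 r |lambda|) in the hypothesis. It serves for Mellin transforms
    in s, Laplace transforms in p and the Euler-Maclaurin steps. *)
Lemma taylor_at_exp_integral P Fa Fb (phi lambda : R -> C) (s0 : C) (r : R) (g Phi : R -> R) (A B : R) :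
  interval_between P Fa Fb -> 0 < r ->
  (forall x, P x -> Ccont phi x) -> (forall x, P x -> Ccont lambda x) ->
  (forall x, P x -> continuous g x) -> (forall x, P x -> is_derive Phi x (g x)) ->
  (forall x, P x -> Cmod (phi x) * Cmod (Cexp (s0 * lambda x)) * exp (2 * r * Cmod (lambda x)) <= g x) ->
  filterlim Phi Fa (locally A) -> filterlim Phi Fb (locally B) ->
  exists a : nat -> C,
    (forall k, CInt Fa Fb (fun x => phi x * Cexp (s0 * lambda x)
                             * (lambda x ^ k * RtoC (/ INR (fact k))))%C (a k)) /\
    (forall h, Cmod h < r ->
       (exists l, CInt Fa Fb (fun x => phi x * Cexp ((s0 + h) * lambda x))%C l) /\
       forall l N, CInt Fa Fb (fun x => phi x * Cexp ((s0 + h) * lambda x))%C l ->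
         Cmod (l - Csum (fun k => a k * h ^ k)%C N) <= (B - A) * (Cmod h / r) ^ N).
Proof.
  intros HI Hr Hphi Hlam Hg HD Hb HA HB.
  pose proof (ib_left _ _ _ HI) as PFa. pose proof (ib_right _ _ _ HI) as PFb.
  assert (Hce : forall z x, P x -> Ccont (fun x => Cexp (z * lambda x))%C x).
  { intros z x Hx. apply Ccont_Cexp, Ccont_mult; [apply Ccont_const | auto]. }
  assert (Hterm : forall k x, P x -> Ccont (fun x => phi x * Cexp (s0 * lambda x)
                             * (lambda x ^ k * RtoC (/ INR (fact k))))%C x).
  { intros k x Hx. apply Ccont_mult; [apply Ccont_mult; auto|].
    apply Ccont_mult; [apply Ccont_pow; auto | apply Ccont_const]. }
  assert (Hdom : forall c f, 0 <= c -> (forall x, P x -> Ccont f x) ->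
    (forall x, P x -> Cmod (f x) <= c * (Cmod (phi x) * Cmod (Cexp (s0 * lambda x)) * exp (2 * r * Cmod (lambda x)))) ->
    exists l, CInt Fa Fb f l /\ Cmod l <= c * (B - A)).
  { intros c f Hc Hf Hle.
    destruct (CInt_dominated P Fa Fb f (fun x => c * g x) (fun x => c * Phi x) (c * A) (c * B)) as [l [H1 H2]]; auto.
    - intros x Hx. apply (continuous_mult (K := R_AbsRing) (fun _ => c) g x); [apply continuous_const | auto].
    - intros x Hx. apply (is_derive_scal Phi). auto.
    - intros x Hx. eapply Rle_trans; [apply Hle, Hx|]. apply Rmult_le_compat_l; auto.
    - eapply filterlim_comp; [exact HA | apply (filterlim_scal_r c A)].
    - eapply filterlim_comp; [exact HB | apply (filterlim_scal_r c B)].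
    - exists l; split; [exact H1 | lra]. }
  assert (He1 : forall x, 1 <= exp (r * Cmod (lambda x))).
  { intros x. rewrite <- exp_0. apply exp_le_compat.
    apply Rmult_le_pos; [lra | apply Cmod_ge_0]. }
  assert (Hsplit : forall x, exp (2 * (r * Cmod (lambda x))) = exp (r * Cmod (lambda x)) * exp (r * Cmod (lambda x))).
  { intros x. rewrite <- exp_plus. f_equal. ring. }
  assert (Hex : forall k, exists a, CInt Fa Fb (fun x => phi x * Cexp (s0 * lambda x)
                             * (lambda x ^ k * RtoC (/ INR (fact k))))%C a).
  { intros k. assert (Hrk : 0 < r ^ k) by now apply pow_lt.
    destruct (Hdom (/ r ^ k) (fun x => phi x * Cexp (s0 * lambda x)
                             * (lambda x ^ k * RtoC (/ INR (fact k))))%C) as [l [Hl _]].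
    - apply Rlt_le, Rinv_0_lt_compat, Hrk.
    - auto.
    - intros x Hx. rewrite !Cmod_mult, Cmod_pow, Cmod_R.
      rewrite (Rabs_right (/ _)) by (apply Rle_ge, Rlt_le, Rinv_0_lt_compat, INR_fact_lt_0).
      rewrite <- Rmult_assoc, (Rmult_comm (/ r ^ k)), !Rmult_assoc.
      apply Rmult_le_compat_l; [apply Cmod_ge_0|]. apply Rmult_le_compat_l; [apply Cmod_ge_0|].
      apply Rmult_le_reg_r with (r ^ k); [exact Hrk|].
      rewrite (Rmult_assoc (exp _)), Rinv_l, Rmult_1_r by lra.
      rewrite Hsplit. pose proof (pow_div_fact_le_exp (r * Cmod (lambda x)) k) as K.
      rewrite Rpow_mult_distr in K.
      assert (0 <= r * Cmod (lambda x)) by (apply Rmult_le_pos; [lra | apply Cmod_ge_0]).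
      specialize (K ltac:(assumption)). specialize (He1 x). unfold Rdiv in K.
      pose proof (exp_pos (r * Cmod (lambda x))). nra.
    - now exists l. }
  pose (a := fun k => proj1_sig (constructive_indefinite_description _ (Hex k))).
  assert (Ha : forall k, CInt Fa Fb (fun x => phi x * Cexp (s0 * lambda x)
                             * (lambda x ^ k * RtoC (/ INR (fact k))))%C (a k)).
  { intros k. exact (proj2_sig (constructive_indefinite_description _ (Hex k))). }
  exists a. split; [exact Ha|]. intros h Hh.
  assert (Hrem : forall N, (forall x, P x -> Ccont (fun x => phi x * Cexp (s0 * lambda x) * exp_rem N (h * lambda x))%C x) /\
     (forall x, P x -> Cmod (phi x * Cexp (s0 * lambda x) * exp_rem N (h * lambda x))
        <= (Cmod h / r) ^ N * (Cmod (phi x) * Cmod (Cexp (s0 * lambda x)) * exp (2 * r * Cmod (lambda x))))).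
  { intros N; split.
    - intros x Hx. apply Ccont_mult; [apply Ccont_mult; auto|]. unfold exp_rem. apply Ccont_minus; [auto|].
      induction N as [|N IH]; [exact (Ccont_const 0 x)|]. cbn [Csum]. apply Ccont_plus; [exact IH|].
      apply Ccont_mult; [|apply Ccont_const]. apply Ccont_pow, Ccont_mult; [apply Ccont_const | auto].
    - intros x Hx. rewrite !Cmod_mult.
      rewrite (Rmult_comm ((Cmod h / r) ^ N)), !Rmult_assoc.
      apply Rmult_le_compat_l; [apply Cmod_ge_0|]. apply Rmult_le_compat_l; [apply Cmod_ge_0|].
      eapply Rle_trans; [apply exp_rem_bound|].
      pose proof (Cmod_ge_0 h) as H0. pose proof (Cmod_ge_0 (lambda x)) as H1.
      rewrite Cmod_mult, Rpow_mult_distr, Hsplit.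
      pose proof (pow_div_fact_le_exp (r * Cmod (lambda x)) N ltac:(apply Rmult_le_pos; lra)) as K.
      assert (K2 : exp (Cmod h * Cmod (lambda x)) <= exp (r * Cmod (lambda x))).
      { apply exp_le_compat. apply Rmult_le_compat_r; lra. }
      replace (Cmod h ^ N * Cmod (lambda x) ^ N / INR (fact N))
        with ((Cmod h / r) ^ N * ((r * Cmod (lambda x)) ^ N / INR (fact N))).
      2:{ unfold Rdiv at 1. rewrite !Rpow_mult_distr, pow_inv. field.
          split; [apply INR_fact_neq_0 | apply pow_nonzero; lra]. }
      assert (Hq : 0 <= (Cmod h / r) ^ N).
      { apply pow_le, Rmult_le_pos; [lra | apply Rlt_le, Rinv_0_lt_compat, Hr]. }
      assert (HT : (r * Cmod (lambda x)) ^ N / INR (fact N) * exp (Cmod h * Cmod (lambda x))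
                    <= exp (r * Cmod (lambda x)) * exp (r * Cmod (lambda x))).
      { apply Rmult_le_compat; try assumption; [|apply Rlt_le, exp_pos].
        apply Rmult_le_pos; [apply pow_le, Rmult_le_pos; lra | apply Rlt_le, Rinv_0_lt_compat, INR_fact_lt_0]. }
      rewrite Rmult_assoc, (Rmult_comm _ ((Cmod h / r) ^ N)).
      apply Rmult_le_compat_l; assumption. }
  assert (Hfull : forall x, (phi x * Cexp (s0 * lambda x) * exp_rem 0 (h * lambda x)
                       = phi x * Cexp ((s0 + h) * lambda x))%C).
  { intros x. unfold exp_rem. cbn [Csum]. rewrite Cmult_plus_distr_r, Cexp_plus. ring. }
  assert (Hq : forall N, 0 <= (Cmod h / r) ^ N).
  { intros N. apply pow_le, Rmult_le_pos; [apply Cmod_ge_0 | apply Rlt_le, Rinv_0_lt_compat, Hr]. }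
  split.
  - destruct (Hrem 0%nat) as [H1 H2].
    destruct (Hdom _ _ (Hq 0%nat) H1 H2) as [l [Hl _]]. exists l.
    eapply (CInt_ext P); [exact HI | | exact Hl]. intros; apply Hfull.
  - intros l N Hl.
    destruct (Hrem N) as [H1 H2].
    destruct (Hdom _ _ (Hq N) H1 H2) as [l' [Hl' Hb']].
    rewrite (Rmult_comm (B - A)).
    replace (l - Csum (fun k => a k * h ^ k) N)%C with l'; [exact Hb'|].
    apply (CInt_unique Fa Fb (fun x => phi x * Cexp (s0 * lambda x) * exp_rem N (h * lambda x))%C); auto.
    assert (Hs : CInt Fa Fb (fun x => phi x * Cexp (s0 * lambda x) *
        Csum (fun k => (h * lambda x) ^ k * RtoC (/ INR (fact k))) N)%C (Csum (fun k => a k * h ^ k) N)%C).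
    { clear - Ha HI PFa PFb. induction N as [|N IH].
      - pose proof (CInt_scal Fa Fb 0 _ _ _ _ (Ha 0%nat)) as K.
        replace (Csum (fun k => a k * h ^ k) 0)%C with (0 * a 0%nat)%C by (cbn [Csum]; ring).
        eapply (CInt_ext P); [exact HI | | exact K]. intros; cbn [Csum]. cbv beta. ring.
      - cbn [Csum].
        pose proof (CInt_plus Fa Fb _ _ _ _ _ _ IH (CInt_scal Fa Fb (h ^ N)%C _ _ _ _ (Ha N))) as K.
        replace (Csum (fun k => a k * h ^ k) N + a N * h ^ N)%C
          with (Csum (fun k => a k * h ^ k) N + h ^ N * a N)%C by ring.
        eapply (CInt_ext P); [exact HI | | exact K]. intros x Hx; cbn [Csum]. cbv beta.
        rewrite Cpow_mult_l. ring. }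
    eapply (CInt_ext P); [exact HI | | exact (CInt_minus Fa Fb _ _ _ _ _ _ Hl Hs)].
    intros x Hx. cbv beta. unfold exp_rem. rewrite Cmult_plus_distr_r, Cexp_plus. ring.
Qed.

Lemma taylor_at_Cexp (K c z0 : C) :
  exists M a, taylor_at (fun z => K * Cexp (z * c))%C z0 1 M a.
Proof.
  exists (Cmod K * Cmod (Cexp (z0 * c)) * (exp (Cmod c) * exp (Cmod c))).
  exists (fun k => K * Cexp (z0 * c) * (c ^ k * RtoC (/ INR (fact k))))%C.
  split; [lra|]. intros h N Hh.
  assert (E : (K * Cexp ((z0 + h) * c) - Csum (fun k => K * Cexp (z0 * c) * (c ^ k * RtoC (/ INR (fact k))) * h ^ k) N
     = K * Cexp (z0 * c) * exp_rem N (h * c))%C).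
  { unfold exp_rem. rewrite Cmult_plus_distr_r, Cexp_plus.
    rewrite (Csum_ext _ (fun k => K * Cexp (z0 * c) * ((h * c) ^ k * RtoC (/ INR (fact k))))%C).
    - rewrite Csum_scal. ring.
    - intros k _. rewrite Cpow_mult_l. ring. }
  rewrite E, !Cmod_mult, !Rmult_assoc.
  apply Rmult_le_compat_l; [apply Cmod_ge_0|]. apply Rmult_le_compat_l; [apply Cmod_ge_0|].
  eapply Rle_trans; [apply exp_rem_bound|].
  pose proof (Cmod_ge_0 h). pose proof (Cmod_ge_0 c).
  rewrite Cmod_mult, Rpow_mult_distr, Rdiv_1_r.
  pose proof (pow_div_fact_le_exp (Cmod c) N ltac:(lra)) as K1.
  assert (K2 : exp (Cmod h * Cmod c) <= exp (Cmod c)) by (apply exp_le_compat; nra).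
  pose proof (pow_le (Cmod h) N ltac:(lra)).
  pose proof (exp_pos (Cmod c)). pose proof (exp_pos (Cmod h * Cmod c)).
  assert (0 <= Cmod c ^ N / INR (fact N)).
  { apply Rmult_le_pos; [apply pow_le; lra | apply Rlt_le, Rinv_0_lt_compat, INR_fact_lt_0]. }
  replace (Cmod h ^ N * Cmod c ^ N / INR (fact N) * exp (Cmod h * Cmod c))
    with (Cmod h ^ N * (Cmod c ^ N / INR (fact N) * exp (Cmod h * Cmod c))) by (unfold Rdiv; ring).
  replace (exp (Cmod c) * (exp (Cmod c) * Cmod h ^ N)) with (Cmod h ^ N * (exp (Cmod c) * exp (Cmod c))) by ring.
  apply Rmult_le_compat_l; [assumption|]. apply Rmult_le_compat; lra.
Qed.

(** * The identity theorem *)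

Lemma pow_n_Cpow (z : C) (k : nat) : pow_n (K := C_AbsRing) z k = (z ^ k)%C.
Proof. induction k as [|k IH]; [reflexivity|]. simpl. rewrite IH. reflexivity. Qed.

Lemma Clim_bounded (u : nat -> C) (l : C) : Clim u l -> exists B, forall n, Cmod (u n) <= B.
Proof.
  intros H.
  destruct (filterlim_bounded (K := R_AbsRing) (V := R_NormedModule) (fun n => Cmod (u n - l))) as [B HB].
  { exists 0. exact H. }
  exists (B + Cmod l). intros n. replace (u n) with ((u n - l) + l)%C by ring.
  eapply Rle_trans; [apply Cmod_triangle|]. specialize (HB n).
  unfold norm in HB; simpl in HB. unfold abs in HB; simpl in HB.
  rewrite Rabs_right in HB by apply Rle_ge, Cmod_ge_0. lra.
Qed.

(** Convergence at h = r / 2 bounds the partial sums there by some B, hence each term by 2 B. For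
    |h| < r / 4 the terms are then dominated by a geometric series of ratio q < 1/2, and 2 B / (1 -
    q) <= 4 B. *)
Lemma taylor_at_pseries (f : C -> C) (z0 : C) (a : nat -> C) (r : R) :
  0 < r ->
  (forall z, Cmod (z - z0) < r -> is_pseries (K := C_AbsRing) (V := C_NormedModule) a (z - z0)%C (f z)) ->
  exists r' M, taylor_at f z0 r' M a.
Proof.
  intros Hr H.
  assert (HS : forall h, Cmod h < r -> Clim (Csum (fun k => a k * h ^ k)%C) (f (z0 + h)%C)).
  { intros h Hh. specialize (H (z0 + h)%C).
    replace (z0 + h - z0)%C with h in H by ring. specialize (H Hh).
    apply is_series_Clim in H.
    eapply Clim_ext; [| reflexivity | exact H].
    intros n. apply Csum_ext. intros k _.
    change (scal (K := C_AbsRing) (V := C_NormedModule) (pow_n (K := C_AbsRing) h k) (a k)) with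
      (pow_n (K := C_AbsRing) h k * a k)%C.
    rewrite pow_n_Cpow. ring. }
  set (h1 := RtoC (r / 2)).
  assert (Hh1 : Cmod h1 = r / 2) by (unfold h1; rewrite Cmod_R, Rabs_right; lra).
  destruct (Clim_bounded _ _ (HS h1 ltac:(lra))) as [B HB].
  assert (HB0 : 0 <= B).
  { specialize (HB 0%nat). pose proof (Cmod_ge_0 (Csum (fun k => a k * h1 ^ k)%C 0)). lra. }
  assert (Hak : forall k, Cmod (a k) * (r / 2) ^ k <= 2 * B).
  { intros k. rewrite <- Hh1, <- Cmod_pow, <- Cmod_mult.
    replace (a k * h1 ^ k)%C with (Csum (fun k => a k * h1 ^ k) (S k) + - Csum (fun k => a k * h1 ^ k) k)%C
      by (cbn [Csum]; ring).
    eapply Rle_trans; [apply Cmod_triangle|]. rewrite Cmod_opp.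
    pose proof (HB k). pose proof (HB (S k)). lra. }
  exists (r / 4), (4 * B). split; [lra|]. intros h N Hh.
  pose proof (Cmod_ge_0 h) as Hh0.
  set (q := Cmod h / (r / 2)).
  assert (Hq0 : 0 <= q) by (apply Rmult_le_pos; [lra | apply Rlt_le, Rinv_0_lt_compat; lra]).
  assert (Hq : q < / 2).
  { unfold q. apply Rmult_lt_reg_r with (r / 2); [lra|]. field_simplify; lra. }
  destruct (Clim_telescope (fun k => a k * h ^ k)%C (fun k => 2 * B / (1 - q) * q ^ k)) as [l [Hl Hl2]].
  - intros k. rewrite Cmod_mult, Cmod_pow.
    replace (2 * B / (1 - q) * q ^ k - 2 * B / (1 - q) * q ^ S k) with (2 * B * q ^ k) by (simpl; field; lra).
    replace (Cmod (a k) * Cmod h ^ k) with (Cmod (a k) * (r / 2) ^ k * q ^ k).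
    + apply Rmult_le_compat_r; [now apply pow_le | apply Hak].
    + unfold q. rewrite Rmult_assoc, <- Rpow_mult_distr. do 2 f_equal. field. lra.
  - apply is_lim_seq_geom_le. lra.
  - rewrite (Clim_unique _ _ _ (HS h ltac:(lra)) Hl).
    eapply Rle_trans; [apply Hl2|].
    apply Rmult_le_compat.
    + apply Rmult_le_pos; [lra | apply Rlt_le, Rinv_0_lt_compat; lra].
    + now apply pow_le.
    + apply Rmult_le_reg_r with (1 - q); [lra|]. unfold Rdiv. rewrite Rmult_assoc, Rinv_l by lra. nra.
    + apply pow_incr. split; [exact Hq0|]. unfold q.
      apply Rmult_le_compat_l; [lra|]. apply Rinv_le_contravar; lra.
Qed.

Lemma taylor_at_analytic (D : C -> Prop) (f : C -> C) (z0 : C) :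
  analytic_on D f -> D z0 -> exists r M a, taylor_at f z0 r M a.
Proof.
  intros H Hz. destruct (H z0 Hz) as [a [r [Hr Ha]]].
  destruct (taylor_at_pseries f z0 a r Hr Ha) as [r' [M HT]]. now exists r', M, a.
Qed.

(** If a_N were the first nonzero coefficient, then a zero at distance |h| would give |a_N| |h|^N <=
    M (|h| / r)^(N+1), which fails for small h. With all coefficients zero, f is equal to its own
    remainders, and these tend to 0. *)
Lemma taylor_at_zeros (f : C -> C) (z0 : C) r M a :
  taylor_at f z0 r M a ->
  (forall e, 0 < e -> exists h, 0 < Cmod h < e /\ f (z0 + h)%C = 0) ->
  forall h, Cmod h < r -> f (z0 + h)%C = 0.
Proof.
  intros HT HZ. pose proof (taylor_at_bound_nonneg _ _ _ _ _ HT) as HM. destruct HT as [Hr H].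
  (* The vanishing of a sum of moduli states in one equation that all earlier coefficients vanish,
     so that plain induction does the work of strong induction. *)
  assert (Ha : forall N, Csum (fun k => Cmod (a k)) N = 0%C).
  { induction N as [|N IH]; [reflexivity|]. cbn [Csum]. rewrite IH.
    assert (Hk : forall k, (k < N)%nat -> a k = 0%C).
    { assert (HK : forall n, Csum (fun k => Cmod (a k)) n = 0%C -> forall k, (k < n)%nat -> a k = 0%C).
      { induction n as [|n IHn]; intros E k Hk; [lia|]. cbn [Csum] in E.
        assert (Hs : exists x : R, 0 <= x /\ Csum (fun k => Cmod (a k)) n = x).
        { clear. induction n as [|n [x [Hx E]]]; [exists 0; split; [lra|reflexivity]|].
          exists (x + Cmod (a n)). split; [pose proof (Cmod_ge_0 (a n)); lra|].
          cbn [Csum]. now rewrite E, RtoC_plus. }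
        destruct Hs as [x [Hx Ex]]. rewrite Ex, <- RtoC_plus in E. apply RtoC_inj in E.
        pose proof (Cmod_ge_0 (a n)).
        destruct (Nat.eq_dec k n) as [->|Hkn].
        - apply Cmod_eq_0. lra.
        - apply IHn; [|lia]. rewrite Ex. f_equal. lra. }
      apply HK, IH. }
    assert (HaN : Cmod (a N) = 0).
    { destruct (Rle_lt_or_eq_dec 0 (Cmod (a N)) (Cmod_ge_0 _)) as [L|E]; [|auto]. exfalso.
      assert (He : 0 < Rmin r (Cmod (a N) * r ^ S N / (M + 1))).
      { apply Rmin_pos; [exact Hr|]. apply Rdiv_lt_0_compat; [|lra].
        apply Rmult_lt_0_compat; [exact L | now apply pow_lt]. }
      destruct (HZ _ He) as [h [[Hh0 Hh1] Hh2]].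
      pose proof (H h (S N) (Rlt_le_trans _ _ _ Hh1 (Rmin_l _ _))) as H1.
      rewrite Hh2 in H1. cbn [Csum] in H1.
      rewrite (Csum_ext _ (fun k => 0 * 0)%C) in H1 by (intros k Hk'; rewrite Hk by assumption; ring).
      rewrite Csum_scal in H1.
      match type of H1 with Cmod ?e <= _ => replace e with (- (a N * h ^ N))%C in H1 by ring end.
      rewrite Cmod_opp, Cmod_mult, Cmod_pow in H1.
      pose proof (Rlt_le_trans _ _ _ Hh1 (Rmin_r _ _)) as H2.
      assert (HhN : 0 < Cmod h ^ N) by now apply pow_lt.
      assert (HrN : 0 < r ^ S N) by now apply pow_lt.
      assert (H3 : Cmod (a N) <= M * Cmod h / r ^ S N).
      { apply Rmult_le_reg_r with (Cmod h ^ N); [exact HhN|].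
        eapply Rle_trans; [exact H1|]. apply Req_le. unfold Rdiv. rewrite Rpow_mult_distr, pow_inv. simpl. ring. }
      assert (H4 : Cmod (a N) * r ^ S N <= M * Cmod h).
      { apply Rmult_le_reg_r with (/ r ^ S N); [now apply Rinv_0_lt_compat|].
        rewrite Rmult_assoc, Rinv_r, Rmult_1_r by lra. exact H3. }
      assert (H5 : Cmod h * (M + 1) < Cmod (a N) * r ^ S N).
      { apply Rmult_lt_reg_r with (/ (M + 1)); [apply Rinv_0_lt_compat; lra|].
        rewrite Rmult_assoc, Rinv_r, Rmult_1_r by lra. exact H2. }
      nra. }
    rewrite HaN. ring. }
  assert (Ha0 : forall k, a k = 0%C).
  { intros k. pose proof (Ha (S k)) as E. cbn [Csum] in E. rewrite Ha, Cplus_0_l in E.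
    apply RtoC_inj in E. now apply Cmod_eq_0. }
  intros h Hh. apply Cmod_eq_0.
  assert (Hq : 0 <= Cmod h / r < 1).
  { pose proof (Cmod_ge_0 h). split.
    - apply Rmult_le_pos; [lra | apply Rlt_le, Rinv_0_lt_compat, Hr].
    - apply Rmult_lt_reg_r with r; [exact Hr|]. unfold Rdiv. rewrite Rmult_assoc, Rinv_l; lra. }
  pose proof (is_lim_seq_geom_le M _ Hq) as HL.
  apply (is_lim_seq_le (fun _ => Cmod (f (z0 + h)%C)) _ (Cmod (f (z0 + h)%C)) 0) in HL;
    [| | apply is_lim_seq_const].
  - simpl in HL. pose proof (Cmod_ge_0 (f (z0 + h)%C)). lra.
  - intros N. specialize (H h N Hh).
    rewrite (Csum_ext _ (fun k => 0 * 0)%C) in H by (intros k _; rewrite Ha0; ring).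
    rewrite Csum_scal in H. replace (f (z0 + h) - 0 * Csum (fun _ => 0%C) N)%C with (f (z0 + h)%C) in H by ring.
    exact H.
Qed.

(** Let T be the supremum of the t such that f vanishes on the segment up to t. Zeros accumulate at
    the point of parameter T, from below or by hypothesis when T = 0, so f vanishes around it; if T
    < 1 this would extend beyond T. The conclusion holds on a whole disc so that derivatives at z1
    can be compared. *)
Lemma identity_theorem_segment (f : C -> C) (z0 z1 : C) :
  (forall t, 0 <= t <= 1 -> exists r M a, taylor_at f (z0 + t * (z1 - z0))%C r M a) ->
  (forall e, 0 < e -> exists h, 0 < Cmod h < e /\ f (z0 + h)%C = 0) ->
  exists r, 0 < r /\ forall h, Cmod h < r -> f (z1 + h)%C = 0.
Proof.
  intros HT HZ.
  set (g := fun t : R => (z0 + t * (z1 - z0))%C).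
  assert (Hg0 : g 0 = z0) by (unfold g; ring). assert (Hg1 : g 1 = z1) by (unfold g; ring).
  assert (Hloc : forall t, 0 <= t <= 1 ->
    (forall e, 0 < e -> exists h, 0 < Cmod h < e /\ f (g t + h)%C = 0) ->
    exists r, 0 < r /\ forall h, Cmod h < r -> f (g t + h)%C = 0).
  { intros t Ht He. destruct (HT t Ht) as [r [M [a Ha]]]. exists r. split; [apply Ha|].
    apply (taylor_at_zeros f (g t) r M a); assumption. }
  destruct (Req_dec (Cmod (z1 - z0)) 0) as [E|E].
  { apply Cmod_eq_0 in E. replace z1 with z0.
    - rewrite <- Hg0. apply Hloc; [lra|]. rewrite Hg0. exact HZ.
    - replace z1 with (z0 + (z1 - z0))%C by ring. rewrite E. ring. }
  assert (Hd : 0 < Cmod (z1 - z0)) by (pose proof (Cmod_ge_0 (z1 - z0)); lra).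
  assert (Hgd : forall t u, Cmod (g u - g t) = Rabs (u - t) * Cmod (z1 - z0)).
  { intros t u. rewrite <- Cmod_R, <- Cmod_mult. f_equal. unfold g. rewrite RtoC_minus. ring. }
  set (S := fun t => 0 <= t <= 1 /\ forall u, 0 <= u <= t -> f (g u) = 0).
  assert (HS0 : forall t, 0 <= t <= 1 ->
    (exists r, 0 < r /\ forall h, Cmod h < r -> f (g t + h)%C = 0) ->
    (forall u, 0 <= u < t -> f (g u) = 0) ->
    exists d, 0 < d /\ forall u, 0 <= u < t + d -> f (g u) = 0).
  { intros t Ht [r [Hr Hr']] Hu. exists (r / Cmod (z1 - z0)). split; [now apply Rdiv_lt_0_compat|].
    intros u Hu'. destruct (Rlt_dec u t) as [L|L]; [apply Hu; lra|].
    replace (g u) with (g t + (g u - g t))%C by ring. apply Hr'. rewrite Hgd, Rabs_right by lra.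
    apply Rmult_lt_reg_r with (/ Cmod (z1 - z0)); [now apply Rinv_0_lt_compat|].
    rewrite Rmult_assoc, Rinv_r by lra. unfold Rdiv in Hu'. lra. }
  assert (HSz : S 0).
  { split; [lra|]. intros u Hu. replace u with 0 by lra.
    destruct (Hloc 0 ltac:(lra)) as [r [Hr Hr']]; [rewrite Hg0; exact HZ|].
    specialize (Hr' 0%C). rewrite Cmod_0, Cplus_0_r in Hr'. now apply Hr'. }
  destruct (completeness S) as [T [HT1 HT2]].
  { exists 1. intros t [Ht _]. lra. }
  { now exists 0. }
  assert (HT0 : 0 <= T) by (apply HT1, HSz).
  assert (HT1' : T <= 1) by (apply HT2; intros t [Ht _]; lra).
  assert (Hbelow : forall u, 0 <= u < T -> f (g u) = 0).
  { intros u Hu. destruct (Classical_Prop.classic (exists t, S t /\ u < t)) as [[t [[_ Ht] Hut]]|Hn].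
    - apply Ht; lra.
    - exfalso. assert (T <= u); [|lra]. apply HT2. intros t Ht.
      destruct (Rle_dec t u) as [L|L]; [exact L|]. exfalso; apply Hn. exists t; split; [exact Ht | lra]. }
  assert (Hacc : exists r, 0 < r /\ forall h, Cmod h < r -> f (g T + h)%C = 0).
  { apply Hloc; [lra|]. destruct (Req_dec T 0) as [->|HTn]; [rewrite Hg0; exact HZ|].
    intros e He. set (d := Rmin T (e / Cmod (z1 - z0)) / 2).
    assert (Hm : 0 < Rmin T (e / Cmod (z1 - z0))).
    { apply Rmin_pos; [lra | now apply Rdiv_lt_0_compat]. }
    pose proof (Rmin_l T (e / Cmod (z1 - z0))). pose proof (Rmin_r T (e / Cmod (z1 - z0))) as H2.
    exists (g (T - d)%R - g T)%C. split.
    - rewrite Hgd. replace (T - d - T) with (- d) by ring. rewrite Rabs_Ropp, Rabs_right by (unfold d; lra).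
      split; [apply Rmult_lt_0_compat; unfold d; lra|].
      apply Rmult_lt_reg_r with (/ Cmod (z1 - z0)); [now apply Rinv_0_lt_compat|].
      rewrite Rmult_assoc, Rinv_r by lra. unfold Rdiv in H2. unfold d, Rdiv in *. lra.
    - replace (g T + (g (T - d)%R - g T))%C with (g (T - d)%R) by ring. apply Hbelow. unfold d; lra. }
  destruct (HS0 T ltac:(lra) Hacc Hbelow) as [d [Hd0 Hd1]].
  assert (ET : T = 1).
  { apply Rle_antisym; [exact HT1'|]. destruct (Rle_dec 1 T) as [L|L]; [exact L|]. exfalso.
    set (t := Rmin 1 (T + d / 2)).
    assert (S t); [|pose proof (HT1 t H); unfold t, Rmin in *; destruct (Rle_dec 1 (T + d / 2)); lra].
    unfold t, Rmin. destruct (Rle_dec 1 (T + d / 2)); (split; [lra|]; intros; apply Hd1; lra). }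
  rewrite ET, Hg1 in Hacc. exact Hacc.
Qed.

(** The quadratic error is what a Taylor remainder of order 2 provides; it makes the product and
    chain rules purely algebraic estimates. *)
Definition Cdiff (f : C -> C) (z l : C) : Prop :=
  exists r M, 0 < r /\ forall h, Cmod h < r -> Cmod (f (z + h) - f z - l * h)%C <= M * Cmod h ^ 2.

Lemma taylor_at_value f z0 r M a : taylor_at f z0 r M a -> a 0%nat = f z0.
Proof.
  intros [Hr H]. specialize (H (RtoC 0) 1%nat). rewrite Cmod_0 in H. specialize (H Hr).
  cbn [Csum Cpow] in H. rewrite Cplus_0_r in H.
  assert (E : Cmod (f z0 - (0 + a 0%nat * 1)) = 0).
  { pose proof (Cmod_ge_0 (f z0 - (0 + a 0%nat * 1))%C). unfold Rdiv in H. simpl in H. lra. }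
  apply Cmod_eq_0 in E. replace (f z0) with (f z0 - (0 + a 0%nat * 1) + a 0%nat)%C by ring. rewrite E. ring.
Qed.

Lemma taylor_at_Cdiff f z0 r M a : taylor_at f z0 r M a -> Cdiff f z0 (a 1%nat).
Proof.
  intros HT. pose proof (taylor_at_value _ _ _ _ _ HT) as E0. destruct HT as [Hr H].
  exists r, (M / r ^ 2). split; [exact Hr|]. intros h Hh.
  specialize (H h 2%nat Hh). cbn [Csum Cpow] in H. rewrite E0 in H.
  match type of H with Cmod ?e <= _ => replace (f (z0 + h) - f z0 - a 1%nat * h)%C with e by ring end.
  eapply Rle_trans; [exact H|]. apply Req_le. simpl. field. lra.
Qed.

Lemma Cdiff_is_derive f z l : Cdiff f z l -> is_derive (K := C_AbsRing) (V := C_NormedModule) f z l.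
Proof.
  intros [r [M [Hr H]]]. split; [apply (is_linear_scal_l (K := C_AbsRing) (V := C_NormedModule))|].
  intros x Hx. apply (is_filter_lim_locally_unique (K := C_AbsRing) (V := AbsRing_NormedModule C_AbsRing)) in Hx.
  subst x. intros eps.
  assert (Hp : 0 < Rmin r (eps / (Rabs M + 1))).
  { apply Rmin_pos; [exact Hr|]. apply Rdiv_lt_0_compat; [apply cond_pos | pose proof (Rabs_pos M); lra]. }
  apply (locally_le_locally_norm (K := C_AbsRing) (V := AbsRing_NormedModule C_AbsRing)).
  exists (mkposreal _ Hp).
  assert (Hgoal : forall y : C, Cmod (y - z) < Rmin r (eps / (Rabs M + 1)) ->
    Cmod ((f y - f z) - (y - z) * l)%C <= eps * Cmod (y - z)).
  { intros y Hy.
    pose proof (H (y - z)%C (Rlt_le_trans _ _ _ Hy (Rmin_l _ _))) as H1.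
    replace (z + (y - z))%C with y in H1 by ring.
    replace (f y - f z - (y - z) * l)%C with (f y - f z - l * (y - z))%C by ring.
    eapply Rle_trans; [exact H1|].
    pose proof (Rlt_le_trans _ _ _ Hy (Rmin_r _ _)) as H2.
    pose proof (Cmod_ge_0 (y - z)). pose proof (Rle_abs M). pose proof (Rabs_pos M).
    assert (H6 : Cmod (y - z) * (Rabs M + 1) < eps).
    { apply Rmult_lt_reg_r with (/ (Rabs M + 1)); [apply Rinv_0_lt_compat; lra|].
      rewrite Rmult_assoc, Rinv_r, Rmult_1_r by lra. exact H2. }
    replace (M * Cmod (y - z) ^ 2) with (M * Cmod (y - z) * Cmod (y - z)) by ring.
    apply Rmult_le_compat_r; [assumption|]. nra. }
  exact Hgoal.
Qed.

Lemma Cdiff_C_derive f z l : Cdiff f z l -> C_derive f z = l.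
Proof. intros H. apply is_C_derive_unique. exact (Cdiff_is_derive f z l H). Qed.

Lemma Cdiff_unique f z l l' : Cdiff f z l -> Cdiff f z l' -> l = l'.
Proof. intros H H'. rewrite <- (Cdiff_C_derive _ _ _ H). now apply Cdiff_C_derive. Qed.

Lemma Cdiff_ext f g z l r :
  0 < r -> (forall h, Cmod h < r -> f (z + h)%C = g (z + h)%C) -> Cdiff f z l -> Cdiff g z l.
Proof.
  intros Hr E [r' [M [Hr' H]]]. exists (Rmin r r'), M. split; [now apply Rmin_pos|].
  intros h Hh. rewrite <- E by (eapply Rlt_le_trans; [exact Hh | apply Rmin_l]).
  assert (E0 : f z = g z).
  { specialize (E 0%C). rewrite Cmod_0, Cplus_0_r in E. now apply E. }
  rewrite <- E0. apply H. eapply Rlt_le_trans; [exact Hh | apply Rmin_r].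
Qed.

Lemma is_derive_epsilon (f : R -> R) (t l : R) :
  is_derive f t l <-> forall eps, 0 < eps -> exists d, 0 < d /\
    forall h, Rabs h < d -> Rabs (f (t + h) - f t - l * h) <= eps * Rabs h.
Proof.
  split.
  - intros H eps He. apply is_derive_Reals in H. destruct (H eps He) as [d Hd].
    exists d. split; [apply cond_pos|]. intros h Hh.
    destruct (Req_dec h 0) as [->|Hn].
    { rewrite Rplus_0_r, Rmult_0_r, Rabs_R0. replace (f t - f t - 0) with 0 by ring. rewrite Rabs_R0. lra. }
    specialize (Hd h Hn Hh).
    replace (f (t + h) - f t - l * h) with (((f (t + h) - f t) / h - l) * h) by (field; exact Hn).
    rewrite Rabs_mult. apply Rmult_le_compat_r; [apply Rabs_pos | lra].
  - intros H. apply is_derive_Reals. intros eps He.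
    destruct (H (eps / 2) ltac:(lra)) as [d [Hd0 Hd]].
    exists (mkposreal d Hd0). intros h Hn Hh. specialize (Hd h Hh).
    assert (0 < Rabs h) by now apply Rabs_pos_lt.
    apply Rmult_lt_reg_r with (Rabs h); [assumption|]. rewrite <- Rabs_mult.
    replace (((f (t + h) - f t) / h - l) * h) with (f (t + h) - f t - l * h) by (field; exact Hn). nra.
Qed.

Lemma Im_le_Cmod (z : C) : Rabs (Im z) <= Cmod z.
Proof. eapply Rle_trans; [apply Rmax_r | apply (Rmax_Cmod z)]. Qed.

Lemma Cmod_le_Re_Im (z : C) : Cmod z <= Rabs (Re z) + Rabs (Im z).
Proof.
  replace z with (RtoC (Re z) + Ci * RtoC (Im z))%C at 1 by (apply C_ext; cbn; unfold Re, Im; ring).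
  eapply Rle_trans; [apply Cmod_triangle|]. rewrite Cmod_mult, Cmod_Ci, !Cmod_R. lra.
Qed.

Lemma is_Cderive_epsilon (f : R -> C) (t : R) (l : C) :
  is_Cderive f t l <-> forall eps, 0 < eps -> exists d, 0 < d /\
    forall h, Rabs h < d -> Cmod (f (t + h)%R - f t - l * h)%C <= eps * Rabs h.
Proof.
  assert (E1 : forall h, Re (f (t + h)%R - f t - l * h)%C = Re (f (t + h)) - Re (f t) - Re l * h).
  { intros h. cbn. unfold Re, Im. ring. }
  assert (E2 : forall h, Im (f (t + h)%R - f t - l * h)%C = Im (f (t + h)) - Im (f t) - Im l * h).
  { intros h. cbn. unfold Re, Im. ring. }
  split.
  - intros [H1 H2] eps He. rewrite is_derive_epsilon in H1, H2.
    destruct (H1 (eps / 2) ltac:(lra)) as [d1 [Hd1 K1]].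
    destruct (H2 (eps / 2) ltac:(lra)) as [d2 [Hd2 K2]].
    exists (Rmin d1 d2). split; [now apply Rmin_pos|]. intros h Hh.
    eapply Rle_trans; [apply Cmod_le_Re_Im|]. rewrite E1, E2.
    specialize (K1 h (Rlt_le_trans _ _ _ Hh (Rmin_l _ _))).
    specialize (K2 h (Rlt_le_trans _ _ _ Hh (Rmin_r _ _))). lra.
  - intros H. split; rewrite is_derive_epsilon; intros eps He;
      destruct (H eps He) as [d [Hd K]]; exists d; (split; [exact Hd|]); intros h Hh;
      eapply Rle_trans; [|exact (K h Hh)| |exact (K h Hh)].
    + rewrite <- E1. apply re_le_Cmod.
    + rewrite <- E2. apply Im_le_Cmod.
Qed.

(** The chain rule for an analytic function along a real path; it is what lets the mean value
    theorem control functions of a complex parameter. *)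
Lemma Cdiff_path (F : C -> C) (g : R -> C) (t : R) (l l' : C) :
  Cdiff F (g t) l -> is_Cderive g t l' -> is_Cderive (fun u => F (g u)) t (l * l')%C.
Proof.
  intros [r [M [Hr HF]]] Hg. rewrite is_Cderive_epsilon in Hg |- *. intros eps He.
  pose proof (Cmod_ge_0 l) as Hl0. pose proof (Cmod_ge_0 l') as Hl1.
  pose proof (Rabs_pos M) as HM. pose proof (Rle_abs M) as HM'.
  destruct (Hg 1 Rlt_0_1) as [d1 [Hd1 K1]].
  destruct (Hg (eps / (2 * (Cmod l + 1)))) as [d2 [Hd2 K2]].
  { apply Rdiv_lt_0_compat; lra. }
  set (c := Cmod l' + 1).
  assert (Hc : 0 < c) by (unfold c; lra).
  assert (Hd3 : 0 < r / c) by now apply Rdiv_lt_0_compat.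
  assert (Hd4 : 0 < eps / (2 * (Rabs M + 1) * c ^ 2)).
  { apply Rdiv_lt_0_compat; [lra|]. apply Rmult_lt_0_compat; [lra | now apply pow_lt]. }
  exists (Rmin (Rmin d1 d2) (Rmin (r / c) (eps / (2 * (Rabs M + 1) * c ^ 2)))). split.
  { repeat apply Rmin_pos; assumption. }
  intros h Hh.
  pose proof (Rlt_le_trans _ _ _ Hh (Rmin_l _ _)) as Ha. pose proof (Rlt_le_trans _ _ _ Hh (Rmin_r _ _)) as Hb.
  specialize (K1 h (Rlt_le_trans _ _ _ Ha (Rmin_l _ _))).
  specialize (K2 h (Rlt_le_trans _ _ _ Ha (Rmin_r _ _))).
  pose proof (Rlt_le_trans _ _ _ Hb (Rmin_l _ _)) as H3.
  pose proof (Rlt_le_trans _ _ _ Hb (Rmin_r _ _)) as H4.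
  set (k := (g (t + h)%R - g t)%C) in *.
  pose proof (Rabs_pos h) as Hh0.
  assert (Hk : Cmod k <= c * Rabs h).
  { replace k with ((k - l' * h) + l' * h)%C by ring.
    eapply Rle_trans; [apply Cmod_triangle|]. rewrite Cmod_mult, Cmod_R. unfold c. lra. }
  assert (Hk' : Cmod k < r).
  { eapply Rle_lt_trans; [exact Hk|]. apply Rmult_lt_reg_r with (/ c); [now apply Rinv_0_lt_compat|].
    rewrite (Rmult_comm c), Rmult_assoc, Rinv_r, Rmult_1_r by lra. exact H3. }
  specialize (HF k Hk'). replace (g t + k)%C with (g (t + h)%R) in HF by (unfold k; ring).
  replace (F (g (t + h)%R) - F (g t) - l * l' * h)%C
    with ((F (g (t + h)%R) - F (g t) - l * k) + l * (k - l' * h))%C by ring.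
  eapply Rle_trans; [apply Cmod_triangle|]. rewrite Cmod_mult.
  assert (P1 : Cmod l * Cmod (k - l' * h) <= eps / 2 * Rabs h).
  { apply Rle_trans with (Cmod l * (eps / (2 * (Cmod l + 1)) * Rabs h)).
    - apply Rmult_le_compat_l; assumption.
    - rewrite <- Rmult_assoc. apply Rmult_le_compat_r; [assumption|].
      apply Rmult_le_reg_r with (2 * (Cmod l + 1)); [lra|]. field_simplify; [|lra]. nra. }
  assert (P2 : M * Cmod k ^ 2 <= eps / 2 * Rabs h).
  { apply Rle_trans with (Rabs M * (c ^ 2 * Rabs h * Rabs h)).
    - pose proof (Cmod_ge_0 k).
      assert (Cmod k ^ 2 <= c ^ 2 * Rabs h * Rabs h).
      { replace (c ^ 2 * Rabs h * Rabs h) with ((c * Rabs h) ^ 2) by ring. apply pow_incr; lra. }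
      assert (0 <= Cmod k ^ 2) by (apply pow_le; assumption). nra.
    - rewrite <- Rmult_assoc. apply Rmult_le_compat_r; [assumption|].
      assert (Rabs h * (2 * (Rabs M + 1) * c ^ 2) < eps).
      { apply Rmult_lt_reg_r with (/ (2 * (Rabs M + 1) * c ^ 2)).
        - apply Rinv_0_lt_compat, Rmult_lt_0_compat; [lra | now apply pow_lt].
        - rewrite Rmult_assoc, Rinv_r, Rmult_1_r; [exact H4|].
          apply Rmult_integral_contrapositive; split; [lra | apply pow_nonzero; lra]. }
      pose proof (pow_lt c 2 Hc).
      assert (0 <= c ^ 2 * Rabs h) by (apply Rmult_le_pos; lra). nra. }
  lra.
Qed.

Lemma Cdiff_mult f g z l l' :
  Cdiff f z l -> Cdiff g z l' -> Cdiff (fun w => f w * g w)%C z (l * g z + f z * l')%C.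
Proof.
  intros [r [M [Hr H]]] [r' [M' [Hr' H']]].
  set (d := Rmin 1 (Rmin r r')).
  assert (Hd : 0 < d) by (repeat apply Rmin_pos; lra).
  pose proof (Cmod_ge_0 l) as L1. pose proof (Cmod_ge_0 l') as L2.
  pose proof (Cmod_ge_0 (f z)) as L3. pose proof (Cmod_ge_0 (g z)) as L4.
  pose proof (Rabs_pos M) as L5. pose proof (Rabs_pos M') as L6.
  exists d, (Rabs M * Cmod (g z) + Cmod (f z) * Rabs M' + (Cmod l + Rabs M) * (Cmod l' + Rabs M')).
  split; [exact Hd|]. intros h Hh. pose proof (Cmod_ge_0 h) as H0.
  assert (Hh1 : Cmod h < 1) by (eapply Rlt_le_trans; [exact Hh | apply Rmin_l]).
  assert (Hh2 : Cmod h < r).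
  { eapply Rlt_le_trans; [exact Hh|]. eapply Rle_trans; [apply Rmin_r | apply Rmin_l]. }
  assert (Hh3 : Cmod h < r').
  { eapply Rlt_le_trans; [exact Hh|]. eapply Rle_trans; [apply Rmin_r | apply Rmin_r]. }
  specialize (H h Hh2). specialize (H' h Hh3).
  set (u := (f (z + h) - f z - l * h)%C) in *. set (v := (g (z + h) - g z - l' * h)%C) in *.
  assert (Hu : Cmod u <= Rabs M * Cmod h ^ 2).
  { eapply Rle_trans; [exact H|]. apply Rmult_le_compat_r; [apply pow_le, H0 | apply Rle_abs]. }
  assert (Hv : Cmod v <= Rabs M' * Cmod h ^ 2).
  { eapply Rle_trans; [exact H'|]. apply Rmult_le_compat_r; [apply pow_le, H0 | apply Rle_abs]. }
  replace (f (z + h) * g (z + h) - f z * g z - (l * g z + f z * l') * h)%C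
    with (u * g z + f z * v + (l * h + u) * (l' * h + v))%C by (unfold u, v; ring).
  assert (Hsq : Cmod h ^ 2 <= Cmod h) by nra.
  assert (Hu' : Cmod (l * h + u) <= (Cmod l + Rabs M) * Cmod h).
  { eapply Rle_trans; [apply Cmod_triangle|]. rewrite Cmod_mult. nra. }
  assert (Hv' : Cmod (l' * h + v) <= (Cmod l' + Rabs M') * Cmod h).
  { eapply Rle_trans; [apply Cmod_triangle|]. rewrite Cmod_mult. nra. }
  eapply Rle_trans; [apply Cmod_triangle|]. rewrite Cmod_mult.
  assert (Hp : Cmod (l * h + u) * Cmod (l' * h + v) <= (Cmod l + Rabs M) * Cmod h * ((Cmod l' + Rabs M') * Cmod h)).
  { apply Rmult_le_compat; auto using Cmod_ge_0. }
  assert (Hq : Cmod (u * g z + f z * v) <= Rabs M * Cmod h ^ 2 * Cmod (g z) + Cmod (f z) * (Rabs M' * Cmod h ^ 2)).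
  { eapply Rle_trans; [apply Cmod_triangle|]. rewrite !Cmod_mult.
    apply Rplus_le_compat; [apply Rmult_le_compat_r | apply Rmult_le_compat_l]; assumption. }
  lra.
Qed.

Lemma Cdiff_reflect f s l : Cdiff (fun w => f (1 - w)%C) s l -> Cdiff f (1 - s)%C (- l)%C.
Proof.
  intros [r [M [Hr H]]]. exists r, M. split; [exact Hr|]. intros h Hh.
  specialize (H (- h)%C). rewrite Cmod_opp in H. specialize (H Hh).
  replace (1 - (s + - h))%C with (1 - s + h)%C in H by ring.
  replace (f (1 - s + h) - f (1 - s) - - l * h)%C with (f (1 - s + h) - f (1 - s) - l * - h)%C by ring.
  exact H.
Qed.

(** [taylor_at_Cexp] provides some derivative [a 1]; its value is read off by comparison with the
    derivative in the real direction. *)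
Lemma Cdiff_Cexp (K c z : C) : Cdiff (fun w => K * Cexp (w * c))%C z (c * (K * Cexp (z * c)))%C.
Proof.
  destruct (taylor_at_Cexp K c z) as [M [a Ha]].
  pose proof (taylor_at_Cdiff _ _ _ _ _ Ha) as HD.
  assert (Hp : is_Cderive (fun u : R => K * Cexp ((z + u) * c))%C 0 (c * (K * Cexp (z * c)))%C).
  { eapply is_Cderive_ext; [| | apply (is_Cderive_scal K), is_Cderive_Cexp, is_Cderive_mult;
      [apply (is_Cderive_plus (fun _ => z) (fun u => RtoC u));
        [apply is_Cderive_const | apply (is_Cderive_RtoC (fun u => u)); exact (is_derive_id 0)]
      | apply is_Cderive_const]].
    - reflexivity.
    - cbv beta. replace (z + 0)%C with z by ring. change (one : R_AbsRing) with 1. ring. }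
  assert (Hq : is_Cderive (fun u : R => (K * Cexp ((z + u) * c)))%C 0 (a 1%nat * 1)%C).
  { apply (Cdiff_path (fun w => K * Cexp (w * c))%C (fun u : R => z + u)%C 0 (a 1%nat) 1).
    - replace (z + 0)%C with z by ring. exact HD.
    - eapply is_Cderive_ext; [| | apply (is_Cderive_plus (fun _ => z) (fun u => RtoC u));
        [apply is_Cderive_const | apply (is_Cderive_RtoC (fun u => u)); exact (is_derive_id 0)]].
      + reflexivity.
      + change (one : R_AbsRing) with 1. ring. }
  replace (c * (K * Cexp (z * c)))%C with (a 1%nat); [exact HD|].
  destruct Hp as [P1 P2]. destruct Hq as [Q1 Q2].
  apply is_derive_unique in P1, P2, Q1, Q2. rewrite Cmult_1_r in Q1, Q2.
  apply C_ext; congruence.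
Qed.

(** * Mellin transforms *)

Definition is_positive (x : R) : Prop := 0 < x.

Notation Cint := (CInt (at_right 0) (Rbar_locally p_infty)).

Lemma interval_positive : interval_between is_positive (at_right 0) (Rbar_locally p_infty).
Proof.
  unfold is_positive. constructor.
  - apply at_right_proper_filter.
  - apply Rbar_locally_filter.
  - intros; lra.
  - apply (Filter_prod _ _ _ (fun a => 0 < a < 1) (fun b => 1 < b)).
    + exists (mkposreal 1 Rlt_0_1). intros y Hy H0. apply Rabs_def2 in Hy.
      unfold minus, plus, opp in Hy; simpl in Hy. lra.
    + exists 1. intros; assumption.
    + intros x y Hx Hy. simpl. lra.
Qed.

Lemma filter_at_right_0 : ProperFilter (at_right 0).
Proof. apply at_right_proper_filter. Qed.
Lemma filter_p_infty : ProperFilter (Rbar_locally p_infty).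
Proof. apply Rbar_locally_filter. Qed.
#[local] Hint Resolve filter_at_right_0 filter_p_infty : core.

Lemma continuous_ln (x : R) : 0 < x -> continuous ln x.
Proof.
  intros Hx. apply (ex_derive_continuous (V := R_NormedModule)). exists (/ x).
  apply is_derive_Reals. now apply derivable_pt_lim_ln.
Qed.

Lemma Ccont_ln (x : R) : 0 < x -> Ccont (fun t => RtoC (ln t)) x.
Proof. intros Hx. now apply Ccont_RtoC, continuous_ln. Qed.

Lemma Ccont_id (x : R) : Ccont (fun t => RtoC t) x.
Proof. apply Ccont_RtoC. apply continuous_id. Qed.

Lemma is_Cderive_ln (x : R) : 0 < x -> is_Cderive (fun t => RtoC (ln t)) x (RtoC (/ x)).
Proof. intros Hx. apply is_Cderive_RtoC, is_derive_Reals. now apply derivable_pt_lim_ln. Qed.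

Lemma is_Cderive_id (x : R) : is_Cderive (fun t => RtoC t) x 1.
Proof. apply (is_Cderive_RtoC (fun t => t)). exact (is_derive_id x). Qed.

(* Comparable to [x ^ (d - 1)] at 0 and to [x ^ (- d - 1)] at infinity, with
   primitive [atan (x ^ d) / d]. *)
Definition weight (d x : R) : R := exp (d * ln x) / x / (1 + exp (d * ln x) ^ 2).

Lemma weight_primitive (d x : R) : 0 < d -> 0 < x ->
  is_derive (fun x => atan (exp (d * ln x)) / d) x (weight d x).
Proof.
  intros Hd Hx. unfold weight. auto_derive; [lra|].
  field. pose proof (exp_pos (d * ln x)). repeat split; nra.
Qed.

Lemma continuous_weight (d x : R) : 0 < x -> continuous (weight d) x.
Proof.
  intros Hx. apply (ex_derive_continuous (V := R_NormedModule) (weight d)).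
  unfold weight. auto_derive. pose proof (exp_pos (d * ln x)).
  repeat split; trivial; nra.
Qed.

Lemma filterlim_exp_ln_0 (d : R) : 0 < d ->
  filterlim (fun x => exp (d * ln x)) (at_right 0) (locally 0).
Proof.
  intros Hd Q [eps He]. unfold filtermap.
  exists (mkposreal (exp (ln eps / d)) (exp_pos _)). intros y Hy H0.
  apply He. apply Rabs_def2 in Hy. unfold minus, plus, opp in Hy; simpl in Hy.
  unfold ball; simpl; unfold AbsRing_ball, abs, minus, plus, opp; simpl.
  rewrite Ropp_0, Rplus_0_r, Rabs_right by (apply Rle_ge, Rlt_le, exp_pos).
  rewrite <- (exp_ln eps) by apply cond_pos. apply exp_increasing.
  assert (H1 : ln y < ln eps / d).
  { rewrite <- (ln_exp (ln eps / d)). apply ln_increasing; lra. }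
  apply Rmult_lt_compat_l with (r := d) in H1; [|exact Hd].
  replace (d * (ln eps / d)) with (ln eps) in H1 by (field; lra). exact H1.
Qed.

Lemma filterlim_weight_primitive_0 (d : R) : 0 < d ->
  filterlim (fun x => atan (exp (d * ln x)) / d) (at_right 0) (locally 0).
Proof.
  intros Hd.
  assert (H : continuous (fun y => atan y / d) 0).
  { apply (ex_derive_continuous (V := R_NormedModule)). auto_derive; trivial. }
  unfold continuous in H. rewrite atan_0 in H. unfold Rdiv in H at 2. rewrite Rmult_0_l in H.
  exact (filterlim_comp _ _ _ _ (fun y => atan y / d) _ _ _ (filterlim_exp_ln_0 d Hd) H).
Qed.

Lemma filterlim_exp_ln_infty (d : R) : 0 < d ->
  filterlim (fun x => exp (d * ln x)) (Rbar_locally p_infty) (Rbar_locally p_infty).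
Proof.
  intros Hd Q [M HM]. unfold filtermap.
  exists (exp (ln (Rabs M + 1) / d)). intros x Hx. apply HM.
  pose proof (Rle_abs M). pose proof (Rabs_pos M).
  apply Rlt_le_trans with (Rabs M + 1); [lra|].
  rewrite <- (exp_ln (Rabs M + 1)) by lra. apply exp_le_compat.
  pose proof (exp_pos (ln (Rabs M + 1) / d)).
  assert (H2 : ln (Rabs M + 1) / d < ln x).
  { rewrite <- (ln_exp (ln (Rabs M + 1) / d)). apply ln_increasing; assumption. }
  apply Rmult_lt_compat_l with (r := d) in H2; [|exact Hd].
  replace (d * (ln (Rabs M + 1) / d)) with (ln (Rabs M + 1)) in H2 by (field; lra). lra.
Qed.

Lemma filterlim_weight_primitive_infty (d : R) : 0 < d ->
  filterlim (fun x => atan (exp (d * ln x)) / d) (Rbar_locally p_infty) (locally (PI / 2 / d)).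
Proof.
  intros Hd.
  assert (H : filterlim (fun y => atan y / d) (Rbar_locally p_infty) (locally (PI / 2 / d))).
  { eapply (filterlim_ext_loc (fun y => PI / 2 / d - atan (/ y) / d)).
    - exists 0. intros y Hy. rewrite atan_inv by exact Hy. unfold Rdiv. ring.
    - assert (H : continuous (fun z => PI / 2 / d - atan z / d) 0).
      { apply (ex_derive_continuous (V := R_NormedModule)). auto_derive; trivial. }
      unfold continuous in H. rewrite atan_0 in H.
      replace (PI / 2 / d - 0 / d) with (PI / 2 / d) in H by (unfold Rdiv; ring).
      refine (filterlim_comp _ _ _ Rinv (fun z => PI / 2 / d - atan z / d) _ _ _ _ H).
      apply (filterlim_Rbar_inv p_infty); discriminate. }
  exact (filterlim_comp _ _ _ _ (fun y => atan y / d) _ _ _ (filterlim_exp_ln_infty d Hd) H).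
Qed.

Lemma Cint_weight (f : R -> C) (K d : R) :
  0 < d -> (forall x, 0 < x -> Ccont f x) -> (forall x, 0 < x -> Cmod (f x) <= K * weight d x) ->
  exists l, Cint f l /\ Cmod l <= K * (PI / 2 / d).
Proof.
  intros Hd Hf Hb.
  destruct (CInt_dominated is_positive (at_right 0) (Rbar_locally p_infty) f (fun x => K * weight d x)
    (fun x => K * (atan (exp (d * ln x)) / d)) (K * 0) (K * (PI / 2 / d))) as [l [H1 H2]].
  - exact interval_positive.
  - exact Hf.
  - intros x Hx. apply (continuous_mult (K := R_AbsRing) (fun _ => K)); [apply continuous_const|].
    now apply continuous_weight.
  - intros x Hx. apply (is_derive_scal (fun x => atan (exp (d * ln x)) / d)). now apply weight_primitive.
  - exact Hb.
  - exact (filterlim_comp _ _ _ _ _ _ _ _ (filterlim_weight_primitive_0 d Hd) (filterlim_scal_r K 0)).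
  - exact (filterlim_comp _ _ _ _ _ _ _ _ (filterlim_weight_primitive_infty d Hd) (filterlim_scal_r K (PI / 2 / d))).
  - exists l. split; [exact H1 | lra].
Qed.

(** From 1 + t <= e^t at t = ln (y / (k + 1)). It bounds y^k by an explicit constant times e^y. *)
Lemma ln_le_linear (k y : R) : 0 <= k -> 0 < y -> k * ln y <= y + k * ln (k + 1).
Proof.
  intros Hk Hy. pose proof (exp_ineq1_le (ln (y / (k + 1)))) as H.
  rewrite exp_ln in H by (apply Rdiv_lt_0_compat; lra).
  rewrite ln_div in H by lra.
  assert (k * ln y <= k * (y / (k + 1) + ln (k + 1))) by (apply Rmult_le_compat_l; lra).
  assert (k * (y / (k + 1)) <= y).
  { apply Rmult_le_reg_r with (k + 1); [lra|]. field_simplify; [|lra]. nra. }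
  lra.
Qed.

(** With d = (1 - sigma) / 2 the left side behaves like x^(d - 1) near 0. For x > 1 the powers
    combine to x^(3 d - 1), and e^(- c x) has to bring this down to x^(- d - 1), which explains k =
    4 d. The factor e^(d |ln x|) is the room needed to expand x^(-s) in s; the 2 in the constant
    comes from 1 + x^(2 d) being at most twice the larger summand. *)
Lemma power_exp_le_weight (sigma c : R) : sigma < 1 -> 0 < c ->
  exists K, forall x, 0 < x ->
    exp (- sigma * ln x) * exp ((1 - sigma) / 2 * Rabs (ln x)) * exp (- c * x)
      <= K * weight ((1 - sigma) / 2) x.
Proof.
  intros Hs Hc. set (d := (1 - sigma) / 2). set (k := 4 * d).
  assert (Hd : 0 < d) by (unfold d; lra). assert (Hk : 0 < k) by (unfold k; lra).
  set (C0 := exp (k * ln (k + 1) + k * Rabs (ln c))).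
  assert (HC0 : 1 <= C0).
  { unfold C0. apply Rle_trans with (exp 0); [rewrite exp_0; lra|]. apply exp_le_compat.
    assert (0 <= ln (k + 1)) by (rewrite <- ln_1; apply ln_le; lra).
    pose proof (Rabs_pos (ln c)). apply Rplus_le_le_0_compat; apply Rmult_le_pos; lra. }
  exists (2 * C0). intros x Hx. unfold weight.
  rewrite <- !exp_plus.
  assert (Ex : exp (d * ln x) / x = exp ((d - 1) * ln x)).
  { replace ((d - 1) * ln x) with (d * ln x + - ln x) by ring.
    rewrite exp_plus, exp_Ropp, exp_ln by exact Hx. reflexivity. }
  rewrite Ex. replace (exp (d * ln x) ^ 2) with (exp (2 * d * ln x)) by
    (simpl; rewrite Rmult_1_r, <- exp_plus; f_equal; ring).
  pose proof (exp_pos ((d - 1) * ln x)) as E1. pose proof (exp_pos (2 * d * ln x)) as E2.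
  destruct (Rle_dec (ln x) 0) as [L|L].
  - rewrite (Rabs_left1 (ln x)) by exact L.
    assert (exp (2 * d * ln x) <= 1) by (rewrite <- exp_0; apply exp_le_compat; nra).
    apply Rle_trans with (exp ((d - 1) * ln x)).
    + apply exp_le_compat. unfold d in *. nra.
    + apply Rmult_le_reg_r with (1 + exp (2 * d * ln x)); [lra|].
      replace (2 * C0 * (exp ((d - 1) * ln x) / (1 + exp (2 * d * ln x))) * (1 + exp (2 * d * ln x)))
        with (2 * C0 * exp ((d - 1) * ln x)) by (field; lra).
      rewrite Rmult_comm. apply Rmult_le_compat_r; lra.
  - rewrite (Rabs_right (ln x)) by lra.
    assert (1 <= exp (2 * d * ln x)) by (rewrite <- exp_0; apply exp_le_compat; nra).
    assert (H3 : exp (- sigma * ln x + d * ln x + - c * x) <= C0 * exp ((- d - 1) * ln x)).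
    { unfold C0. rewrite <- exp_plus. apply exp_le_compat.
      pose proof (ln_le_linear k (c * x) (Rlt_le _ _ Hk) ltac:(nra)) as H3.
      rewrite ln_mult in H3 by lra.
      pose proof (Rle_abs (ln c)) as HA. pose proof (Rle_abs (- ln c)) as HB. rewrite Rabs_Ropp in HB.
      assert (- k * ln c <= k * Rabs (ln c)) by nra.
      assert (Es : - sigma = 2 * d - 1) by (unfold d; lra). rewrite Es.
      replace (2 * d - 1) with (k - d - 1 - d) by (unfold k; ring). lra. }
    eapply Rle_trans; [exact H3|].
    assert (E4 : exp ((d - 1) * ln x) = exp ((- d - 1) * ln x) * exp (2 * d * ln x)).
    { rewrite <- exp_plus. f_equal. ring. }
    rewrite E4. pose proof (exp_pos ((- d - 1) * ln x)).
    rewrite Rmult_assoc, (Rmult_comm 2), Rmult_assoc. apply Rmult_le_compat_l; [lra|].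
    apply Rmult_le_reg_r with (1 + exp (2 * d * ln x)); [lra|].
    match goal with |- _ <= ?e => replace e
      with (2 * (exp ((- d - 1) * ln x) * exp (2 * d * ln x))) by (field; lra) end.
    assert (0 <= exp ((- d - 1) * ln x) * (exp (2 * d * ln x) - 1)) by (apply Rmult_le_pos; lra).
    lra.
Qed.

Lemma Re_mult_RtoC (z : C) (x : R) : Re (z * x)%C = Re z * x.
Proof. cbn. unfold Re, Im. ring. Qed.

(** The exponent s (u - ln x) makes the kernel e^(s u) x^(-s), and each derivative in s brings down
    u - ln x. The radius (1 - Re s) / 4 is half the exponent that [power_exp_le_weight] leaves
    free. *)
Lemma mellin_taylor (phi : R -> C) (B c : R) (u s0 : C) :
  0 < c -> Re s0 < 1 -> (forall x, 0 < x -> Ccont phi x) ->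
  (forall x, 0 < x -> Cmod (phi x) <= B * exp (- c * x)) ->
  exists M a,
    Cint (fun x => phi x * Cexp (s0 * (u - ln x)) * (u - ln x))%C (a 1%nat) /\
    (forall h, Cmod h < (1 - Re s0) / 4 ->
       (exists l, Cint (fun x => phi x * Cexp ((s0 + h) * (u - ln x)))%C l) /\
       forall l N, Cint (fun x => phi x * Cexp ((s0 + h) * (u - ln x)))%C l ->
         Cmod (l - Csum (fun k => a k * h ^ k)%C N) <= M * (Cmod h / ((1 - Re s0) / 4)) ^ N).
Proof.
  intros Hc Hs Hphi Hb.
  set (sigma := Re s0) in *. set (d := (1 - sigma) / 2). set (r := (1 - sigma) / 4).
  assert (Hd : 0 < d) by (unfold d; lra). assert (Hr : 0 < r) by (unfold r; lra).
  destruct (power_exp_le_weight sigma c Hs Hc) as [K HK]. fold d in HK.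
  set (L := exp (Re (s0 * u)%C) * exp (2 * r * Cmod u)).
  assert (HL : 0 < L) by (apply Rmult_lt_0_compat; apply exp_pos).
  assert (HB : 0 <= B).
  { specialize (Hb 1 Rlt_0_1). pose proof (Cmod_ge_0 (phi 1)). pose proof (exp_pos (- c * 1)). nra. }
  assert (Hcl : forall x, 0 < x -> Ccont (fun x => u - RtoC (ln x))%C x).
  { intros x Hx. apply Ccont_minus; [apply Ccont_const | now apply Ccont_ln]. }
  destruct (taylor_at_exp_integral is_positive (at_right 0) (Rbar_locally p_infty) phi
    (fun x => u - RtoC (ln x))%C s0 r (fun x => B * L * K * weight d x)
    (fun x => B * L * K * (atan (exp (d * ln x)) / d)) (B * L * K * 0) (B * L * K * (PI / 2 / d)))
    as [a [Ha1 Ha2]].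
  - exact interval_positive.
  - exact Hr.
  - exact Hphi.
  - exact Hcl.
  - intros x Hx. apply (continuous_mult (K := R_AbsRing) (fun _ => B * L * K)); [apply continuous_const|].
    now apply continuous_weight.
  - intros x Hx. apply (is_derive_scal (fun x => atan (exp (d * ln x)) / d)). now apply weight_primitive.
  - intros x Hx. rewrite Cmod_Cexp.
    assert (E : Re (s0 * (u - ln x))%C = Re (s0 * u)%C + - sigma * ln x).
    { unfold sigma. cbn. unfold Re, Im. ring. }
    rewrite E, exp_plus.
    assert (Hm : Cmod (u - ln x) <= Cmod u + Rabs (ln x)).
    { unfold Cminus. eapply Rle_trans; [apply Cmod_triangle|]. rewrite Cmod_opp, Cmod_R. lra. }
    assert (He : exp (2 * r * Cmod (u - ln x)) <= exp (2 * r * Cmod u) * exp (d * Rabs (ln x))).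
    { rewrite <- exp_plus. apply exp_le_compat. replace d with (2 * r) by (unfold d, r; field). nra. }
    specialize (HK x Hx). specialize (Hb x Hx).
    apply Rle_trans with ((B * exp (- c * x)) * (exp (Re (s0 * u)%C) * exp (- sigma * ln x))
       * (exp (2 * r * Cmod u) * exp (d * Rabs (ln x)))).
    + apply Rmult_le_compat; [| apply Rlt_le, exp_pos | | exact He].
      * apply Rmult_le_pos; [apply Cmod_ge_0|]. apply Rmult_le_pos; apply Rlt_le, exp_pos.
      * apply Rmult_le_compat_r; [|exact Hb]. apply Rmult_le_pos; apply Rlt_le, exp_pos.
    + replace (B * L * K * weight d x) with (B * L * (K * weight d x)) by ring.
      eapply Rle_trans; [|apply Rmult_le_compat_l; [apply Rmult_le_pos; lra | exact HK]].
      apply Req_le. unfold L. ring.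
  - exact (filterlim_comp _ _ _ _ _ _ _ _ (filterlim_weight_primitive_0 d Hd) (filterlim_scal_r (B * L * K) 0)).
  - exact (filterlim_comp _ _ _ _ _ _ _ _ (filterlim_weight_primitive_infty d Hd) (filterlim_scal_r (B * L * K) (PI / 2 / d))).
  - eexists; exists a. split; [|exact Ha2].
    eapply (CInt_ext is_positive); [exact interval_positive | | exact (Ha1 1%nat)].
    intros x Hx. cbv beta. cbn [Cpow]. change (INR (fact 1)) with 1. rewrite Rinv_1. ring.
Qed.

(* [x ^ (- s) * e ^ (- p x)] for [x > 0]. *)
Definition power_exp (s p : C) (x : R) : C := Cexp (- (s * RtoC (ln x)) - p * RtoC x).

Definition laplace_power (s p : C) : C :=
  RInt_gen (V := C_R_CompleteNormedModule) (power_exp s p) (at_right 0) (Rbar_locally p_infty).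

Lemma Ccont_power_exp (s p : C) (x : R) : 0 < x -> Ccont (power_exp s p) x.
Proof.
  intros Hx. apply Ccont_Cexp, Ccont_minus.
  - apply (Ccont_ext (fun t => - s * RtoC (ln t))%C); [intros; ring|].
    apply Ccont_mult; [apply Ccont_const | now apply Ccont_ln].
  - apply Ccont_mult; [apply Ccont_const | apply Ccont_id].
Qed.

Lemma Cmod_power_exp (s p : C) (x : R) :
  Cmod (power_exp s p x) = exp (- Re s * ln x + - Re p * x).
Proof.
  unfold power_exp. rewrite Cmod_Cexp. f_equal. cbn. unfold Re, Im. ring.
Qed.

Lemma power_exp_shift (s p : C) (x : R) : 0 < x -> power_exp (s - 1) p x = (x * power_exp s p x)%C.
Proof.
  intros Hx. unfold power_exp.
  replace (- ((s - 1) * ln x) - p * x)%C with (RtoC (ln x) + (- (s * ln x) - p * x))%C by ring.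
  rewrite Cexp_plus, Cexp_RtoC, exp_ln by exact Hx. reflexivity.
Qed.

(** The expansion in p has lambda = - x. With r = Re p / 4 the weight e^(2 r x) still leaves the
    decay e^(- (Re p / 2) x). The linear coefficient carries an extra - x, which lowers s by one. *)
Lemma laplace_power_taylor (s p : C) : Re s < 1 -> 0 < Re p ->
  Cint (power_exp s p) (laplace_power s p) /\
  exists r M a, taylor_at (laplace_power s) p r M a /\ a 1%nat = (- laplace_power (s - 1) p)%C.
Proof.
  intros Hs Hp.
  set (sigma := Re s) in *. set (d := (1 - sigma) / 2). set (r := Re p / 4).
  assert (Hd : 0 < d) by (unfold d; lra). assert (Hr : 0 < r) by (unfold r; lra).
  destruct (power_exp_le_weight sigma (Re p / 2) Hs ltac:(lra)) as [K HK]. fold d in HK.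
  destruct (taylor_at_exp_integral is_positive (at_right 0) (Rbar_locally p_infty)
    (fun x => Cexp (- s * RtoC (ln x)))%C
    (fun x => - RtoC x)%C p r (fun x => K * weight d x)
    (fun x => K * (atan (exp (d * ln x)) / d)) (K * 0) (K * (PI / 2 / d)))
    as [a [Ha1 Ha2]].
  - exact interval_positive.
  - exact Hr.
  - intros x Hx. apply Ccont_Cexp, Ccont_mult; [apply Ccont_const | now apply Ccont_ln].
  - intros x Hx. apply (Ccont_ext (fun t => - (1) * RtoC t)%C); [intros; ring|].
    apply Ccont_mult; [apply Ccont_const | apply Ccont_id].
  - intros x Hx. apply (continuous_mult (K := R_AbsRing) (fun _ => K)); [apply continuous_const|].
    now apply continuous_weight.
  - intros x Hx. apply (is_derive_scal (fun x => atan (exp (d * ln x)) / d)). now apply weight_primitive.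
  - intros x Hx. rewrite !Cmod_Cexp, Cmod_opp, Cmod_R, (Rabs_right x) by (unfold is_positive in Hx; lra).
    eapply Rle_trans; [|apply HK, Hx].
    replace (Re (- s * ln x)%C) with (- sigma * ln x) by (unfold sigma; cbn; unfold Re, Im; ring).
    replace (Re (p * - RtoC x)%C) with (- Re p * x) by (cbn; unfold Re, Im; ring).
    rewrite Rmult_assoc, <- exp_plus.
    replace (- Re p * x + 2 * r * x) with (- (Re p / 2) * x) by (unfold r; field).
    apply Rmult_le_compat_r; [apply Rlt_le, exp_pos|].
    rewrite <- (Rmult_1_r (exp (- sigma * ln x))) at 1.
    apply Rmult_le_compat_l; [apply Rlt_le, exp_pos|].
    rewrite <- exp_0. apply exp_le_compat. apply Rmult_le_pos; [lra | apply Rabs_pos].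
  - exact (filterlim_comp _ _ _ _ _ _ _ _ (filterlim_weight_primitive_0 d Hd) (filterlim_scal_r K 0)).
  - exact (filterlim_comp _ _ _ _ _ _ _ _ (filterlim_weight_primitive_infty d Hd) (filterlim_scal_r K (PI / 2 / d))).
  - assert (HE : forall q x, (Cexp (- s * ln x) * Cexp (q * - RtoC x) = power_exp s q x)%C).
    { intros q x. rewrite <- Cexp_plus. unfold power_exp. f_equal. ring. }
    assert (HI : forall h, Cmod h < r -> Cint (power_exp s (p + h)) (laplace_power s (p + h))).
    { intros h Hh. destruct (Ha2 h Hh) as [[l Hl] _].
      assert (Hl' : Cint (power_exp s (p + h)) l).
      { eapply (CInt_ext is_positive); [exact interval_positive | | exact Hl]. intros; apply HE. }
      unfold laplace_power. rewrite (CInt_RInt_gen _ _ _ _ filter_at_right_0 filter_p_infty Hl'). exact Hl'. }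
    split.
    { replace p with (p + 0)%C by ring. apply HI. now rewrite Cmod_0. }
    exists r, (K * (PI / 2 / d) - K * 0), a. split.
    + split; [exact Hr|]. intros h N Hh. destruct (Ha2 h Hh) as [_ H]. apply H.
      eapply (CInt_ext is_positive); [exact interval_positive | | exact (HI h Hh)].
      intros; symmetry; apply HE.
    + assert (Hl : Cint (power_exp (s - 1) p) (- (1) * a 1%nat)%C).
      { eapply (CInt_ext is_positive); [exact interval_positive | |
          exact (CInt_scal _ _ (- (1))%C _ _ _ _ (Ha1 1%nat))].
        intros x Hx. cbv beta. rewrite power_exp_shift by exact Hx. rewrite <- HE.
        cbn [Cpow]. change (INR (fact 1)) with 1. rewrite Rinv_1. ring. }
      unfold laplace_power at 1. rewrite (CInt_RInt_gen _ _ _ _ filter_at_right_0 filter_p_infty Hl). ring.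
Qed.

Lemma Cint_laplace_power (s p : C) : Re s < 1 -> 0 < Re p -> Cint (power_exp s p) (laplace_power s p).
Proof. intros Hs Hp. now apply laplace_power_taylor. Qed.

Lemma is_Cderive_power_exp (s p : C) (x : R) : 0 < x ->
  is_Cderive (power_exp (s - 1) p) x ((1 - s) * power_exp s p x - p * power_exp (s - 1) p x)%C.
Proof.
  intros Hx.
  assert (H : is_Cderive (fun t => - (s - 1) * RtoC (ln t) + - p * RtoC t)%C x
                ((- (s - 1)) * RtoC (/ x) + - p * 1)%C).
  { apply is_Cderive_plus; apply is_Cderive_scal; [now apply is_Cderive_ln | apply is_Cderive_id]. }
  eapply is_Cderive_ext; [| | exact (is_Cderive_Cexp _ _ _ H)].
  - intros t. unfold power_exp. f_equal. ring.
  - cbv beta. replace (Cexp (- (s - 1) * ln x + - p * x)) with (power_exp (s - 1) p x)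
      by (unfold power_exp; f_equal; ring).
    rewrite power_exp_shift by exact Hx.
    assert (E : (RtoC (/ x) * RtoC x = 1)%C) by (rewrite <- RtoC_mult, Rinv_l; [reflexivity | lra]).
    transitivity ((1 - s) * (RtoC (/ x) * RtoC x) * power_exp s p x - p * (x * power_exp s p x))%C; [ring|].
    rewrite E. ring.
Qed.

Lemma power_exp_limit_0 (s p : C) : Re s < 0 -> 0 < Re p ->
  filterlim (fun x => Cmod (power_exp s p x - 0)) (at_right 0) (locally 0).
Proof.
  intros Hs Hp.
  apply (filterlim_le_le (F := at_right 0) (fun _ => 0) _ (fun x => exp (- Re s * ln x)) 0);
    [| apply filterlim_const | apply filterlim_exp_ln_0; lra].
  exists (mkposreal 1 Rlt_0_1). intros x _ Hx. split; [apply Cmod_ge_0|].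
  replace (power_exp s p x - 0)%C with (power_exp s p x) by ring.
  rewrite Cmod_power_exp. apply exp_le_compat. nra.
Qed.

Lemma power_exp_limit_infty (s p : C) : Re s < 0 -> 0 < Re p ->
  filterlim (fun x => Cmod (power_exp s p x - 0)) (Rbar_locally p_infty) (locally 0).
Proof.
  (* With this k the function x^k e^(- c x) is bounded, so the modulus is at most a constant times 1
     / x. *)
  intros Hs Hp. set (k := 1 - Re s). set (c := Re p) in *.
  apply (filterlim_le_le (F := Rbar_locally p_infty) (fun _ => 0) _
    (fun x => exp (k * ln (k + 1) - k * ln c) * / x) 0);
    [| apply filterlim_const |].
  - exists 0. intros x Hx. split; [apply Cmod_ge_0|].
    replace (power_exp s p x - 0)%C with (power_exp s p x) by ring.
    rewrite Cmod_power_exp, <- (exp_ln (/ x)) by now apply Rinv_0_lt_compat.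
    rewrite <- exp_plus. apply exp_le_compat. rewrite ln_Rinv by exact Hx. fold c.
    pose proof (ln_le_linear k (c * x) ltac:(unfold k; lra) ltac:(nra)) as H.
    rewrite ln_mult in H by lra. unfold k in *. lra.
  - replace 0 with (exp (k * ln (k + 1) - k * ln c) * 0) by ring.
    refine (filterlim_comp _ _ _ Rinv (fun y => exp (k * ln (k + 1) - k * ln c) * y) _ _ _ _
      (filterlim_scal_r (exp (k * ln (k + 1) - k * ln c)) 0)).
    apply (filterlim_Rbar_inv p_infty); discriminate.
Qed.

(** The integral of the derivative of x^(1 - s) e^(- p x), whose boundary values vanish at both
    ends. At p = 1 it is the functional equation of Gamma; as a relation in p it is the differential
    equation behind [laplace_power_rotation]. *)
Lemma laplace_power_recurrence (s p : C) : Re s < 1 -> 0 < Re p ->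
  ((1 - s) * laplace_power s p = p * laplace_power (s - 1) p)%C.
Proof.
  intros Hs Hp.
  assert (Hs' : Re (s - 1)%C < 0) by (cbn; unfold Re in *; lra).
  assert (H0 : Cint (fun x => (1 - s) * power_exp s p x - p * power_exp (s - 1) p x)%C (0 - 0)%C).
  { apply (CInt_antiderivative is_positive _ _ (power_exp (s - 1) p)).
    - exact interval_positive.
    - intros x Hx. now apply is_Cderive_power_exp.
    - intros x Hx. apply Ccont_minus; apply Ccont_mult; try apply Ccont_const; now apply Ccont_power_exp.
    - now apply power_exp_limit_0.
    - now apply power_exp_limit_infty. }
  assert (H1 : Cint (fun x => (1 - s) * power_exp s p x - p * power_exp (s - 1) p x)%C
     ((1 - s) * laplace_power s p - p * laplace_power (s - 1) p)%C).
  { apply CInt_minus; auto; try apply filter_filter; apply CInt_scal; try apply filter_filter;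
      apply Cint_laplace_power; auto; lra. }
  pose proof (CInt_unique _ _ _ _ _ filter_at_right_0 filter_p_infty H0 H1) as E.
  replace ((1 - s) * laplace_power s p)%C
    with (((1 - s) * laplace_power s p - p * laplace_power (s - 1) p) + p * laplace_power (s - 1) p)%C by ring.
  rewrite <- E. ring.
Qed.

(** Along p = e^(t w) the product of p^(1 - s) and the Laplace transform at p has derivative zero by
    the recurrence, so it takes the same value at t = 0 and t = 1. The condition on Im w keeps the
    whole path in Re p > 0. *)
Lemma laplace_power_rotation (s w : C) : Re s < 1 -> Rabs (Im w) < PI / 2 ->
  laplace_power s (Cexp w) = (laplace_power s 1 * Cexp (w * (s - 1)))%C.
Proof.
  intros Hs Hw.
  set (f := fun t : R => (Cexp (t * (w * (1 - s))) * laplace_power s (Cexp (t * w)))%C).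
  assert (Hre : forall t, 0 <= t <= 1 -> 0 < Re (Cexp (t * w))).
  { intros t Ht. unfold Cexp. cbn [Re fst]. apply Rmult_lt_0_compat; [apply exp_pos|].
    replace (Im (t * w)%C) with (t * Im w) by (cbn; unfold Re, Im; ring).
    apply Rabs_def2 in Hw. apply cos_gt_0; nra. }
  assert (Hlin : forall (c : C) t, is_Cderive (fun u => RtoC u * c)%C t c).
  { intros c t. eapply is_Cderive_ext; [| | exact (is_Cderive_scal c _ _ _ (is_Cderive_id t))];
      intros; cbv beta; ring. }
  assert (Hd : forall t, 0 <= t <= 1 -> is_Cderive f t 0).
  { intros t Ht. destruct (laplace_power_taylor s (Cexp (t * w)) Hs (Hre t Ht)) as [_ [r [M [a [Ha Ea]]]]].
    apply taylor_at_Cdiff in Ha. rewrite Ea in Ha.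
    pose proof (Cdiff_path _ (fun u => Cexp (u * w)) t _ _ Ha (is_Cderive_Cexp _ _ _ (Hlin w t))) as H1.
    pose proof (is_Cderive_Cexp _ _ _ (Hlin (w * (1 - s))%C t)) as H2.
    eapply is_Cderive_ext; [| | exact (is_Cderive_mult _ _ _ _ _ H2 H1)]; [reflexivity|].
    cbv beta. pose proof (laplace_power_recurrence s (Cexp (t * w)) Hs (Hre t Ht)) as E.
    transitivity (w * Cexp (t * (w * (1 - s))) * ((1 - s) * laplace_power s (Cexp (t * w))
      - Cexp (t * w) * laplace_power (s - 1) (Cexp (t * w))))%C; [ring|]. rewrite E. ring. }
  assert (E : f 1 = f 0).
  { assert (Hm : Cmod (f 1 - f 0) <= 0 - 0).
    { apply (mean_value_bound f (fun _ => 0%C) (fun _ => 0) (fun _ => 0)); [lra | exact Hd | |].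
      - intros t _. exact (is_derive_const 0 t).
      - intros; rewrite Cmod_0; lra. }
    assert (E : Cmod (f 1 - f 0) = 0) by (pose proof (Cmod_ge_0 (f 1 - f 0)); lra).
    apply Cmod_eq_0 in E. replace (f 1) with ((f 1 - f 0) + f 0)%C by ring. rewrite E. ring. }
  unfold f in E. rewrite !Cmult_1_l, !Cmult_0_l, Cexp_0, Cmult_1_l in E.
  rewrite <- E. replace (w * (s - 1))%C with (- (w * (1 - s)))%C by ring. rewrite Cexp_opp.
  field. apply Cexp_neq_0.
Qed.

Lemma Clog_RtoC (x : R) : 0 < x -> Clog x = RtoC (ln x).
Proof.
  intros Hx. unfold Clog, Carg. rewrite Cmod_R, Rabs_right by lra. cbn [Re Im RtoC fst snd].
  destruct (Rle_dec 0 0) as [_|n]; [|lra].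
  replace (x / x) with 1 by (field; lra). now rewrite acos_1.
Qed.

Lemma CGamma_laplace_power (s : C) : Re s < 1 -> CGamma (1 - s) = laplace_power s 1.
Proof.
  intros Hs. unfold CGamma. apply CInt_RInt_gen; auto.
  eapply (CInt_ext is_positive); [exact interval_positive | |
    apply (Cint_laplace_power s 1 Hs); cbn; lra].
  intros x Hx. unfold Cpower, power_exp. rewrite Clog_RtoC, <- Cexp_plus by exact Hx.
  f_equal. ring.
Qed.

(** * The Gamma function has no zero *)

Notation Rint_pos f l := (is_RInt_gen (V := R_NormedModule) f (at_right 0) (Rbar_locally p_infty) l).

Lemma Rint_pos_plus f g lf lg : Rint_pos f lf -> Rint_pos g lg -> Rint_pos (fun x => f x + g x) (lf + lg).
Proof. intros H H'. exact (is_RInt_gen_plus (V := R_NormedModule) f g lf lg H H'). Qed.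

Lemma Rint_pos_scal k f l : Rint_pos f l -> Rint_pos (fun x => k * f x) (k * l).
Proof. intros H. exact (is_RInt_gen_scal (V := R_NormedModule) f k l H). Qed.

Lemma Cmod_Cint_le (f : R -> C) (g : R -> R) (l : C) (m : R) :
  Cint f l -> Rint_pos g m -> (forall x, 0 < x -> Cmod (f x) <= g x) -> Cmod l <= m.
Proof.
  intros Hf Hg Hle. rewrite Cmod_norm.
  apply (RInt_gen_norm (V := C_R_CompleteNormedModule) (Fa := at_right 0) (Fb := Rbar_locally p_infty) f g).
  - eapply filter_imp; [| exact (ib_prod _ _ _ interval_positive)]. now intros ab [? _].
  - eapply filter_imp; [| exact (ib_prod _ _ _ interval_positive)]. intros ab [_ [H1 H2]] x Hx.
    eapply Rle_trans; [apply Req_le; symmetry; apply Cmod_norm|]. apply Hle. unfold is_positive in H1. lra.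
  - exact Hf.
  - exact Hg.
Qed.

Lemma Rint_pos_le f g lf lg : Rint_pos f lf -> Rint_pos g lg -> (forall x, 0 < x -> 0 <= f x <= g x) -> lf <= lg.
Proof.
  intros Hf Hg Hle.
  eapply Rle_trans; [apply Rle_abs|].
  apply (RInt_gen_norm (V := R_CompleteNormedModule) (Fa := at_right 0) (Fb := Rbar_locally p_infty) f g).
  - eapply filter_imp; [| exact (ib_prod _ _ _ interval_positive)]. now intros ab [? _].
  - eapply filter_imp; [| exact (ib_prod _ _ _ interval_positive)]. intros ab [_ [H1 H2]] x Hx.
    unfold is_positive in H1. specialize (Hle x ltac:(lra)).
    eapply Rle_trans; [|apply Hle]. apply Req_le. unfold norm; simpl. apply Rabs_right. lra.
  - exact Hf.
  - exact Hg.
Qed.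

Definition gamma_integrand (X x : R) : R := exp ((X - 1) * ln x - x).
Definition real_gamma (X : R) : R := Re (CGamma X).

Lemma gamma_integrand_succ (X x : R) : 0 < x -> gamma_integrand (X + 1) x = x * gamma_integrand X x.
Proof.
  intros Hx. unfold gamma_integrand. rewrite <- (exp_ln x) at 3 by exact Hx. rewrite <- exp_plus. f_equal. ring.
Qed.

Lemma Cint_CGamma (z : C) : 0 < Re z -> Cint (power_exp (1 - z) 1) (CGamma z).
Proof.
  intros Hz. assert (Hs : Re (1 - z)%C < 1) by (cbn; unfold Re in *; lra).
  replace (CGamma z) with (CGamma (1 - (1 - z))) by (f_equal; ring).
  rewrite CGamma_laplace_power by exact Hs. apply Cint_laplace_power; [exact Hs | cbn; lra].
Qed.

Lemma Rint_gamma (X : R) : 0 < X -> Rint_pos (gamma_integrand X) (real_gamma X).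
Proof.
  intros HX. pose proof (CInt_Re _ _ _ _ _ _ (Cint_CGamma X HX)) as H.
  refine (is_RInt_gen_ext (V := R_NormedModule) _ _ _ _ H).
  eapply filter_imp; [| exact (ib_prod _ _ _ interval_positive)].
  intros ab [_ [Pa Pb]] x Hx. unfold power_exp, gamma_integrand.
  replace (- ((1 - X) * ln x) - 1 * x)%C with (RtoC ((X - 1) * ln x - x)).
  - rewrite Cexp_RtoC. reflexivity.
  - apply C_ext; cbn; unfold Re, Im; cbn; ring.
Qed.

Lemma CGamma_succ (z : C) : 0 < Re z -> CGamma (z + 1) = (z * CGamma z)%C.
Proof.
  intros Hz. assert (Hs : Re (1 - z)%C < 1) by (cbn; unfold Re in *; lra).
  replace (CGamma z) with (CGamma (1 - (1 - z))) by (f_equal; ring).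
  replace (CGamma (z + 1)) with (CGamma (1 - (1 - z - 1))) by (f_equal; ring).
  rewrite !CGamma_laplace_power by (cbn in *; unfold Re in *; lra).
  pose proof (laplace_power_recurrence (1 - z) 1 Hs ltac:(cbn; lra)) as E.
  rewrite Cmult_1_l in E. rewrite <- E. ring.
Qed.

Lemma real_gamma_succ (X : R) : 0 < X -> real_gamma (X + 1) = X * real_gamma X.
Proof.
  intros HX. unfold real_gamma. rewrite RtoC_plus, CGamma_succ by exact HX.
  cbn. unfold Re, Im. cbn. ring.
Qed.

Lemma real_gamma_1 : real_gamma 1 = 1.
Proof.
  assert (H : CInt (at_right 0) (Rbar_locally p_infty) (power_exp (1 - 1) 1) (0 - - (1))%C).
  { apply (CInt_antiderivative is_positive _ _ (fun x => - (1) * RtoC (exp (- x)))%C).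
    - exact interval_positive.
    - intros x Hx.
      assert (He : is_derive (fun x => exp (- x)) x (- exp (- x))) by (auto_derive; [trivial | ring]).
      eapply is_Cderive_ext; [reflexivity | |
        exact (is_Cderive_scal (- (1))%C _ _ _ (is_Cderive_RtoC (fun x => exp (- x)) x _ He))].
      unfold power_exp. replace (- ((1 - 1) * ln x) - 1 * x)%C with (RtoC (- x)) by (rewrite RtoC_opp; ring).
        rewrite Cexp_RtoC, RtoC_opp. ring.
    - intros x Hx. now apply Ccont_power_exp.
    - apply (filterlim_ext (fun x => Rabs (1 - exp (- x)))).
      + intros x. rewrite <- Cmod_R, RtoC_minus. f_equal. ring.
      + assert (Hc : continuous (fun x => Rabs (1 - exp (- x))) 0).
        { apply (continuous_comp (fun x => 1 - exp (- x)) Rabs).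
          - apply (ex_derive_continuous (V := R_NormedModule)). auto_derive; trivial.
          - apply continuous_Rabs. }
        unfold continuous in Hc. rewrite Ropp_0, exp_0, Rminus_diag, Rabs_R0 in Hc.
        eapply filterlim_filter_le_1; [|exact Hc]. apply filter_le_within.
    - apply (filterlim_ext_loc (fun x => exp (- x))).
      + exists 0. intros x _. replace (- (1) * exp (- x) - 0)%C with (- RtoC (exp (- x)))%C by ring.
        rewrite Cmod_opp, Cmod_R, Rabs_right; [reflexivity | apply Rle_ge, Rlt_le, exp_pos].
      + refine (filterlim_comp _ _ _ Ropp exp _ (Rbar_locally m_infty) _ _ is_lim_exp_m).
        apply (filterlim_Rbar_opp p_infty). }
  unfold real_gamma.
  rewrite (CInt_unique _ _ _ _ _ filter_at_right_0 filter_p_infty (Cint_CGamma 1 ltac:(cbn; lra)) H).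
  cbn. ring.
Qed.

Lemma real_gamma_INR_pos (n : nat) : 0 < real_gamma (INR n + 1).
Proof.
  induction n as [|n IH].
  - simpl. rewrite Rplus_0_l, real_gamma_1. lra.
  - pose proof (pos_INR n). rewrite S_INR, real_gamma_succ by lra. apply Rmult_lt_0_compat; lra.
Qed.

(** With n the integer part of X, x^n is at most x^(X - 1) for x <= 1 and at most x^X for x >= 1.
    Integrating gives Gamma(n + 1) <= (1 + X) Gamma(X), and the left side is positive by
    induction. *)
Lemma real_gamma_pos (X : R) : 0 < X -> 0 < real_gamma X.
Proof.
  intros HX. destruct (nfloor_ex X ltac:(lra)) as [n [Hn1 Hn2]].
  pose proof (pos_INR n).
  assert (H1 : real_gamma (INR n + 1) <= real_gamma X + real_gamma (X + 1)).
  { apply (Rint_pos_le (gamma_integrand (INR n + 1)) (fun x => gamma_integrand X x + gamma_integrand (X + 1) x)).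
    - apply Rint_gamma. lra.
    - apply Rint_pos_plus; apply Rint_gamma; lra.
    - intros x Hx. split; [apply Rlt_le, exp_pos|]. unfold gamma_integrand.
      destruct (Rle_dec (ln x) 0) as [L|L].
      + apply Rle_trans with (exp ((X - 1) * ln x - x)).
        * apply exp_le_compat. nra.
        * pose proof (exp_pos ((X + 1 - 1) * ln x - x)). lra.
      + apply Rle_trans with (exp ((X + 1 - 1) * ln x - x)).
        * apply exp_le_compat. nra.
        * pose proof (exp_pos ((X - 1) * ln x - x)). lra. }
  rewrite (real_gamma_succ X HX) in H1.
  pose proof (real_gamma_INR_pos n). nra.
Qed.

Lemma Cexp_Ci_Lipschitz (a b : R) : Cmod (Cexp (Ci * a) - Cexp (Ci * b)) <= Rabs (a - b).
Proof.
  assert (H : forall a b, a <= b -> Cmod (Cexp (Ci * b) - Cexp (Ci * a)) <= b - a).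
  { clear. intros a b Hab.
    apply (mean_value_bound (fun t => Cexp (Ci * t)) (fun t => Ci * Cexp (Ci * t))%C (fun t => t) (fun _ => 1) a b Hab).
    - intros t _. eapply is_Cderive_ext; [| | exact (is_Cderive_Cexp _ _ _ (is_Cderive_scal Ci _ _ _ (is_Cderive_id t)))].
      + reflexivity.
      + cbv beta; ring.
    - intros t _. exact (is_derive_id t).
    - intros t _. rewrite Cmod_mult, Cmod_Ci, Cmod_Cexp.
      replace (Re (Ci * t)%C) with 0 by (cbn; ring). rewrite exp_0. lra. }
  destruct (Rle_dec a b) as [L|L].
  - rewrite <- Cmod_opp. replace (- (Cexp (Ci * a) - Cexp (Ci * b)))%C with (Cexp (Ci * b) - Cexp (Ci * a))%C by ring.
    rewrite Rabs_left1 by lra. specialize (H a b L). lra.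
  - rewrite Rabs_right by lra. apply H. lra.
Qed.

(** Combines |ln u| <= |u - 1| (1 + 1/u) with |u - 1| <= a (u - 1)^2 + 1 / (4 a). The result
    involves only u^2, u, 1 and 1/u, whose integrals against the Gamma density are explicit. *)
Lemma Rabs_ln_bound (a u : R) : 0 < a -> 0 < u ->
  Rabs (ln u) <= a * (u ^ 2 - u - 1 + / u) + (1 + / u) / (4 * a).
Proof.
  intros Ha Hu. pose proof (Rinv_0_lt_compat u Hu) as Hv.
  assert (H1 : ln u <= u - 1).
  { pose proof (exp_ineq1_le (ln u)). rewrite exp_ln in H by exact Hu. lra. }
  assert (H2 : - ln u <= / u - 1).
  { pose proof (exp_ineq1_le (- ln u)). rewrite exp_Ropp, exp_ln in H by exact Hu. lra. }
  assert (Huv : u * / u = 1) by (apply Rinv_r; lra).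
  set (v := / u) in *.
  assert (H3 : Rabs (ln u) <= Rabs (u - 1) * (1 + v)).
  { apply Rabs_le. pose proof (Rle_abs (u - 1)) as K1. pose proof (Rle_abs (- (u - 1))) as K2.
    rewrite Rabs_Ropp in K2. pose proof (Rabs_pos (u - 1)).
    assert (Rabs (u - 1) <= Rabs (u - 1) * (1 + v)) by nra.
    assert (1 - u <= Rabs (u - 1)) by lra.
    assert (v - 1 <= Rabs (u - 1) * (1 + v)).
    { replace (v - 1) with ((1 - u) * v) by lra. nra. }
    split; lra. }
  assert (H4 : Rabs (u - 1) <= a * (u - 1) ^ 2 + / (4 * a)).
  { assert (0 <= (2 * a * Rabs (u - 1) - 1) ^ 2) by apply pow2_ge_0.
    assert (E : Rabs (u - 1) ^ 2 = (u - 1) ^ 2) by apply pow2_abs.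
    apply Rmult_le_reg_r with (4 * a); [lra|].
    rewrite Rmult_plus_distr_r, Rinv_l by lra. nra. }
  eapply Rle_trans; [exact H3|].
  apply Rle_trans with ((a * (u - 1) ^ 2 + / (4 * a)) * (1 + v)).
  - apply Rmult_le_compat_r; [lra | exact H4].
  - apply Req_le. replace ((u - 1) ^ 2) with (u ^ 2 - 2 * u + 1) by ring.
    unfold Rdiv. transitivity (a * (u ^ 2 - 2 * u + 1 + (u * (u * v) - 2 * (u * v) + v)) + (1 + v) * / (4 * a)); [ring|].
    rewrite Huv. ring.
Qed.

(* Under the density [t ^ (X - 1) exp (- t)] the variable [t / X] concentrates
   at 1, so that [CGamma (X + i y)] is close to [X ^ (i y) * real_gamma X]. *)
Lemma CGamma_neq_0_large (X y : R) :
  3 <= X -> 8 * Rabs y * (Rabs y + 1) < X - 1 -> CGamma (X, y) <> 0%C.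
Proof.
  intros HX Hy E0.
  pose proof (Rabs_pos y) as Hy0.
  set (a := Rabs y + 1). assert (Ha : 0 < a) by (unfold a; lra).
  set (g := real_gamma X). assert (Hg : 0 < g) by (apply real_gamma_pos; lra).
  assert (Eg1 : real_gamma (X + 1) = X * g) by (apply real_gamma_succ; lra).
  assert (Eg2 : real_gamma (X + 1 + 1) = (X + 1) * (X * g)) by (rewrite real_gamma_succ, Eg1; lra).
  assert (Eg3 : real_gamma (X - 1) = g / (X - 1)).
  { assert (g = (X - 1) * real_gamma (X - 1)).
    { unfold g. replace X with (X - 1 + 1) at 1 by ring. apply real_gamma_succ. lra. }
    rewrite H. field. lra. }
  assert (HI1 : Cint (fun x => power_exp (1 - (X, y)) 1 x - Cexp (Ci * (y * ln X)%R) * power_exp (1 - X) 1 x)%C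
     (CGamma (X, y) - Cexp (Ci * (y * ln X)%R) * CGamma X)%C).
  { apply CInt_minus; try apply filter_filter; [apply Cint_CGamma; cbn; lra|].
    apply CInt_scal; try apply filter_filter. apply Cint_CGamma. cbn; lra. }
  (* This is [Rabs_ln_bound] at u = x / X, term by term: the powers u^2, u, 1, 1/u shift the
     argument of Gamma by 2, 1, 0 and -1. *)
  assert (HI2 : Rint_pos (fun x => Rabs y * ((a * / X ^ 2) * gamma_integrand (X + 1 + 1) x
      + ((- a * / X) * gamma_integrand (X + 1) x + ((- a + / (4 * a)) * gamma_integrand X x
      + (X * (a + / (4 * a))) * gamma_integrand (X - 1) x))))
    (Rabs y * ((a * / X ^ 2) * real_gamma (X + 1 + 1)
      + ((- a * / X) * real_gamma (X + 1) + ((- a + / (4 * a)) * g + (X * (a + / (4 * a))) * real_gamma (X - 1)))))).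
  { assert (HR : forall k Y, 0 < Y -> Rint_pos (fun x => k * gamma_integrand Y x) (k * real_gamma Y)).
    { intros k Y HY. apply Rint_pos_scal. now apply Rint_gamma. }
    apply (Rint_pos_scal (Rabs y)).
    refine (Rint_pos_plus _ _ _ _ (HR _ _ _) (Rint_pos_plus _ _ _ _ (HR _ _ _)
      (Rint_pos_plus _ _ _ _ (HR _ _ _) (HR _ _ _)))); lra. }
  pose proof (Cmod_Cint_le _ _ _ _ HI1 HI2) as HL.
  assert (Hpt : forall x, 0 < x ->
    Cmod (power_exp (1 - (X, y)) 1 x - Cexp (Ci * (y * ln X)%R) * power_exp (1 - X) 1 x) <=
    Rabs y * ((a * / X ^ 2) * gamma_integrand (X + 1 + 1) x
      + ((- a * / X) * gamma_integrand (X + 1) x + ((- a + / (4 * a)) * gamma_integrand X x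
      + (X * (a + / (4 * a))) * gamma_integrand (X - 1) x)))).
  { intros x Hx.
    assert (EX : power_exp (1 - X) 1 x = RtoC (gamma_integrand X x)).
    { unfold power_exp, gamma_integrand. rewrite <- Cexp_RtoC. f_equal.
      apply C_ext; cbn; unfold Re, Im; cbn; ring. }
    assert (EY : power_exp (1 - (X, y)) 1 x = (Cexp (Ci * (y * ln x)%R) * RtoC (gamma_integrand X x))%C).
    { unfold power_exp, gamma_integrand. rewrite <- Cexp_RtoC, <- Cexp_plus. f_equal.
      apply C_ext; cbn; unfold Re, Im; cbn; ring. }
    rewrite EX, EY, !gamma_integrand_succ by exact Hx.
    assert (Em : gamma_integrand (X - 1) x = / x * gamma_integrand X x).
    { replace X with (X - 1 + 1) at 2 by ring. rewrite gamma_integrand_succ by exact Hx. field. lra. }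
    rewrite Em. set (w := gamma_integrand X x). assert (Hw : 0 < w) by apply exp_pos.
    replace (Cexp (Ci * (y * ln x)%R) * w - Cexp (Ci * (y * ln X)%R) * w)%C
      with ((Cexp (Ci * (y * ln x)%R) - Cexp (Ci * (y * ln X)%R)) * w)%C by ring.
    rewrite Cmod_mult, Cmod_R, (Rabs_right w) by lra.
    eapply Rle_trans; [apply Rmult_le_compat_r; [lra | apply Cexp_Ci_Lipschitz]|].
    replace (y * ln x - y * ln X) with (y * ln (x / X)) by (rewrite ln_div by lra; ring).
    rewrite Rabs_mult, Rmult_assoc. apply Rmult_le_compat_l; [exact Hy0|].
    pose proof (Rabs_ln_bound a (x / X) Ha ltac:(apply Rdiv_lt_0_compat; lra)) as HB.
    eapply Rle_trans; [apply Rmult_le_compat_r; [lra | exact HB]|].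
    apply Req_le. field. repeat split; lra. }
  specialize (HL Hpt). rewrite E0, Eg1, Eg2, Eg3 in HL.
  assert (EG : CGamma X = RtoC (real_gamma X)).
  { apply (CInt_unique _ _ _ _ _ filter_at_right_0 filter_p_infty (Cint_CGamma X ltac:(cbn; lra))).
    assert (Him : Im (CGamma X) = 0).
    { pose proof (CInt_scal (at_right 0) (Rbar_locally p_infty) (- Ci)%C _ _ _ _
        (Cint_CGamma X ltac:(cbn; lra))) as H.
      apply CInt_Re in H; try apply filter_filter.
      assert (H0 : Rint_pos (fun x => 0 * gamma_integrand X x) (0 * g)) by (apply Rint_pos_scal, Rint_gamma; lra).
      assert (H' : Rint_pos (fun x => 0 * gamma_integrand X x) (Re (- Ci * CGamma X)%C)).
      { refine (is_RInt_gen_ext (V := R_NormedModule) _ _ _ _ H).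
        eapply filter_imp; [| exact (ib_prod _ _ _ interval_positive)].
        intros ab [_ [Pa Pb]] x Hx. unfold power_exp.
        replace (- ((1 - X) * ln x) - 1 * x)%C with (RtoC ((X - 1) * ln x - x))
          by (apply C_ext; cbn; unfold Re, Im; cbn; ring).
        rewrite Cexp_RtoC. cbn. unfold Re, Im. cbn. ring. }
      pose proof (is_RInt_gen_unique (V := R_CompleteNormedModule) _ _ H0) as K1.
      pose proof (is_RInt_gen_unique (V := R_CompleteNormedModule) _ _ H') as K2.
      assert (K : Re (- Ci * CGamma X)%C = 0) by (rewrite <- K2, K1; ring).
      cbn in K. unfold Re, Im in *. cbn in *. lra. }
    replace (RtoC (real_gamma X)) with (CGamma X); [apply Cint_CGamma; cbn; lra|].
    apply C_ext; [reflexivity | exact Him]. }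
  rewrite EG in HL. fold g in HL.
  replace (0 - Cexp (Ci * (y * ln X)%R) * g)%C with (- (Cexp (Ci * (y * ln X)%R) * g))%C in HL by ring.
  rewrite Cmod_opp, Cmod_mult, Cmod_Cexp, Cmod_R, (Rabs_right g) in HL by lra.
  replace (Re (Ci * (y * ln X)%R)%C) with 0 in HL by (cbn; ring). rewrite exp_0, Rmult_1_l in HL.
  match type of HL with _ <= ?e => replace e
    with (g * (Rabs y * (a * (/ X + / (X - 1)) + (2 + / (X - 1)) * / (4 * a)))) in HL by (field; lra) end.
  (* The hypothesis on X puts the first summand below 2 / 8, and a = |y| + 1 keeps the second at
     most 3 / 4. *)
  assert (Hlt : Rabs y * (a * (/ X + / (X - 1)) + (2 + / (X - 1)) * / (4 * a)) < 1); [|nra].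
  assert (I1 : / X <= / (X - 1)) by (apply Rinv_le_contravar; lra).
  assert (I2 : / (X - 1) <= 1) by (rewrite <- Rinv_1; apply Rinv_le_contravar; lra).
  assert (I3 : 0 < / (X - 1)) by (apply Rinv_0_lt_compat; lra).
  assert (I4 : Rabs y * / (4 * a) <= / 4).
  { apply Rmult_le_reg_r with (4 * a); [lra|]. rewrite Rmult_assoc, Rinv_l by lra. unfold a. lra. }
  assert (I5 : Rabs y * a * / (X - 1) < / 8).
  { apply Rmult_lt_reg_r with (X - 1); [lra|]. rewrite Rmult_assoc, Rinv_l by lra. unfold a. lra. }
  assert (I6 : 0 <= Rabs y * / (4 * a)) by (apply Rmult_le_pos; [lra | apply Rlt_le, Rinv_0_lt_compat; lra]).
  assert (0 <= Rabs y * a) by (apply Rmult_le_pos; lra).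
  nra.
Qed.

(** By the functional equation a zero at z is also a zero at every z + n, and [CGamma_neq_0_large]
    excludes this once the real part is large compared with the fixed imaginary part. *)
Lemma CGamma_neq_0 (z : C) : 0 < Re z -> CGamma z <> 0%C.
Proof.
  intros Hz E.
  assert (Hn : forall n, CGamma (z + RtoC (INR n)) = 0%C).
  { induction n as [|n IH].
    - simpl. rewrite Cplus_0_r. exact E.
    - rewrite S_INR, RtoC_plus, Cplus_assoc, CGamma_succ, IH; [ring|].
      pose proof (pos_INR n). cbn. unfold Re in *. lra. }
  set (B := Rmax 3 (8 * Rabs (Im z) * (Rabs (Im z) + 1) + 2)).
  destruct (INR_unbounded B) as [n Hn'].
  pose proof (Rmax_l 3 (8 * Rabs (Im z) * (Rabs (Im z) + 1) + 2)).
  pose proof (Rmax_r 3 (8 * Rabs (Im z) * (Rabs (Im z) + 1) + 2)). fold B in H, H0.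
  apply (CGamma_neq_0_large (Re z + INR n) (Im z)); [lra | lra |].
  rewrite <- (Hn n). f_equal. apply C_ext; cbn; unfold Re, Im; ring.
Qed.

(** * Fourier coefficients on the unit interval *)

Definition in_unit (x : R) : Prop := 0 < x < 1.

Notation Uint := (CInt (at_right 0) (at_left 1)).

Lemma interval_unit : interval_between in_unit (at_right 0) (at_left 1).
Proof.
  unfold in_unit. constructor.
  - apply at_right_proper_filter.
  - apply at_left_proper_filter.
  - intros; lra.
  - assert (H2 : 0 < / 2) by lra.
    apply (Filter_prod _ _ _ (fun a => 0 < a < / 2) (fun b => / 2 < b < 1)).
    + exists (mkposreal _ H2). intros y Hy H0. apply Rabs_def2 in Hy.
      unfold minus, plus, opp in Hy; simpl in Hy. lra.
    + exists (mkposreal _ H2). intros y Hy H0. apply Rabs_def2 in Hy.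
      unfold minus, plus, opp in Hy; simpl in Hy. lra.
    + intros x y Hx Hy. simpl. lra.
Qed.

Lemma filter_at_left_1 : ProperFilter (at_left 1).
Proof. apply at_left_proper_filter. Qed.
#[local] Hint Resolve filter_at_left_1 : core.

Lemma Ccont_epsilon (f : R -> C) (x : R) :
  (forall eps, 0 < eps -> exists d, 0 < d /\ forall y, Rabs (y - x) < d -> Cmod (f y - f x) < eps) ->
  Ccont f x.
Proof.
  intros H. split; intros Q [eps He]; destruct (H eps (cond_pos eps)) as [d [Hd K]];
    exists (mkposreal d Hd); intros y Hy; apply He;
    (eapply Rle_lt_trans; [|exact (K y Hy)]).
  - exact (re_le_Cmod (f y - f x)%C).
  - exact (Im_le_Cmod (f y - f x)%C).
Qed.

Lemma Ccont_epsilon_inv (f : R -> C) (x : R) : Ccont f x ->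
  forall eps, 0 < eps -> exists d, 0 < d /\ forall y, Rabs (y - x) < d -> Cmod (f y - f x) < eps.
Proof.
  intros [H1 H2] eps He.
  assert (He2 : 0 < eps / 2) by lra.
  destruct (H1 (fun y => Rabs (y - Re (f x)) < eps / 2)) as [d1 K1].
  { exists (mkposreal _ He2). intros y Hy. exact Hy. }
  destruct (H2 (fun y => Rabs (y - Im (f x)) < eps / 2)) as [d2 K2].
  { exists (mkposreal _ He2). intros y Hy. exact Hy. }
  exists (Rmin d1 d2). split; [apply Rmin_pos; apply cond_pos|].
  intros y Hy. eapply Rle_lt_trans; [apply Cmod_le_Re_Im|].
  specialize (K1 y (Rlt_le_trans _ _ _ Hy (Rmin_l _ _))).
  specialize (K2 y (Rlt_le_trans _ _ _ Hy (Rmin_r _ _))).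
  cbv beta in K1, K2.
  change (Re (f y - f x)%C) with (Re (f y) - Re (f x)).
  change (Im (f y - f x)%C) with (Im (f y) - Im (f x)). lra.
Qed.

(** Singular at both endpoints yet integrable for d > 0, with total mass 2 / d. For d < 1 it is at
    least 1, so that it also absorbs constants. *)
Definition unit_weight (d x : R) : R := exp ((d - 1) * ln x) + exp ((d - 1) * ln (1 - x)).

Lemma unit_weight_primitive (d x : R) : 0 < d -> 0 < x < 1 ->
  is_derive (fun x => (exp (d * ln x) - exp (d * ln (1 - x))) / d) x (unit_weight d x).
Proof.
  intros Hd Hx. unfold unit_weight. auto_derive; [lra|].
  replace ((d - 1) * ln x) with (d * ln x + - ln x) by ring.
  replace ((d - 1) * ln (1 - x)) with (d * ln (1 - x) + - ln (1 - x)) by ring.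
  rewrite !exp_plus, !exp_Ropp, !exp_ln by lra. unfold Rminus. field. lra.
Qed.

Lemma continuous_unit_weight (d x : R) : 0 < x < 1 -> continuous (unit_weight d) x.
Proof.
  intros Hx. apply (ex_derive_continuous (V := R_NormedModule) (unit_weight d)).
  unfold unit_weight. auto_derive. lra.
Qed.

Lemma unit_weight_ge_1 (d x : R) : d < 1 -> 0 < x < 1 -> 1 <= unit_weight d x.
Proof.
  intros Hd Hx. unfold unit_weight.
  assert (ln x < 0) by (rewrite <- ln_1; apply ln_increasing; lra).
  assert (1 <= exp ((d - 1) * ln x)).
  { apply Rle_trans with (exp 0); [rewrite exp_0; lra | apply exp_le_compat; nra]. }
  pose proof (exp_pos ((d - 1) * ln (1 - x))). lra.
Qed.

Lemma filterlim_reflect : filterlim (fun x => 1 - x) (at_left 1) (at_right 0).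
Proof.
  intros Q [eps He]. exists eps. intros y Hy Hlt. apply He; [|lra].
  change (Rabs (y - 1) < eps) in Hy. change (Rabs (1 - y - 0) < eps).
  rewrite Rabs_minus_sym in Hy. now replace (1 - y - 0) with (1 - y) by ring.
Qed.

Lemma unit_weight_primitive_limits (d : R) : 0 < d ->
  filterlim (fun x => (exp (d * ln x) - exp (d * ln (1 - x))) / d) (at_right 0) (locally (- / d)) /\
  filterlim (fun x => (exp (d * ln x) - exp (d * ln (1 - x))) / d) (at_left 1) (locally (/ d)).
Proof.
  intros Hd.
  assert (Hc : forall x, -1 < x < 1 -> continuous (fun y => exp (d * ln (1 - y))) x).
  { intros x Hx. apply (ex_derive_continuous (V := R_NormedModule)). auto_derive. lra. }
  assert (Hlin : forall (F : (R -> Prop) -> Prop) (u v : R -> R) a b, Filter F ->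
    filterlim u F (locally a) -> filterlim v F (locally b) ->
    filterlim (fun x => (u x - v x) / d) F (locally ((a - b) / d))).
  { intros F u v a b HF Hu Hv.
    apply (filterlim_ext (fun x => / d * (u x + - v x))); [intros; unfold Rdiv; ring|].
    replace ((a - b) / d) with (/ d * (a + - b)) by (unfold Rdiv; ring).
    refine (filterlim_comp _ _ _ (fun x => u x + - v x) (fun y => / d * y) _ _ _ _ (filterlim_scal_r (/ d) (a + - b))).
    eapply filterlim_comp_2 with (f := u) (g := fun x => - v x) (h := Rplus).
    - exact Hu.
    - exact (filterlim_comp _ _ _ v Ropp _ _ _ Hv (filterlim_opp (V := R_NormedModule) b)).
    - exact (filterlim_plus (V := R_NormedModule) a (- b)). }
  split.
  - replace (- / d) with ((0 - 1) / d) by (field; lra).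
    apply Hlin; [apply filter_filter | now apply filterlim_exp_ln_0 |].
    eapply filterlim_filter_le_1; [apply filter_le_within|].
    pose proof (Hc 0 ltac:(lra)) as H. unfold continuous in H.
    replace (exp (d * ln (1 - 0))) with 1 in H; [exact H|].
    rewrite Rminus_0_r, ln_1, Rmult_0_r, exp_0. reflexivity.
  - replace (/ d) with ((1 - 0) / d) by (field; lra).
    apply Hlin; [apply filter_filter | |].
    + eapply filterlim_filter_le_1; [apply filter_le_within|].
      assert (H : continuous (fun y => exp (d * ln y)) 1).
      { apply (ex_derive_continuous (V := R_NormedModule)). auto_derive. lra. }
      unfold continuous in H. rewrite ln_1, Rmult_0_r, exp_0 in H. exact H.
    + exact (filterlim_comp _ _ _ (fun x => 1 - x) (fun y => exp (d * ln y)) _ _ _ filterlim_reflect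
        (filterlim_exp_ln_0 d Hd)).
Qed.

Lemma Uint_weight (f : R -> C) (K d : R) :
  0 < d -> (forall x, in_unit x -> Ccont f x) -> (forall x, in_unit x -> Cmod (f x) <= K * unit_weight d x) ->
  exists l, Uint f l /\ Cmod l <= K * (2 / d).
Proof.
  intros Hd Hf Hb. destruct (unit_weight_primitive_limits d Hd) as [L0 L1].
  destruct (CInt_dominated in_unit (at_right 0) (at_left 1) f (fun x => K * unit_weight d x)
    (fun x => K * ((exp (d * ln x) - exp (d * ln (1 - x))) / d)) (K * (- / d)) (K * (/ d))) as [l [H1 H2]].
  - exact interval_unit.
  - exact Hf.
  - intros x Hx. apply (continuous_mult (K := R_AbsRing) (fun _ => K)); [apply continuous_const|].
    now apply continuous_unit_weight.
  - intros x Hx. apply (is_derive_scal (fun x => (exp (d * ln x) - exp (d * ln (1 - x))) / d)).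
    now apply unit_weight_primitive.
  - exact Hb.
  - exact (filterlim_comp _ _ _ _ _ _ _ _ L0 (filterlim_scal_r K (- / d))).
  - exact (filterlim_comp _ _ _ _ _ _ _ _ L1 (filterlim_scal_r K (/ d))).
  - exists l. split; [exact H1|]. unfold Rdiv. lra.
Qed.

Lemma Uint_weight_bound (f : R -> C) (K d : R) (l : C) :
  0 < d -> (forall x, in_unit x -> Ccont f x) -> (forall x, in_unit x -> Cmod (f x) <= K * unit_weight d x) ->
  Uint f l -> Cmod l <= K * (2 / d).
Proof.
  intros Hd Hf Hb Hl. destruct (Uint_weight f K d Hd Hf Hb) as [l' [H1 H2]].
  now rewrite (CInt_unique _ _ _ _ _ filter_at_right_0 filter_at_left_1 Hl H1).
Qed.

Lemma Uint_antiderivative (F f : R -> C) :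
  (forall x, is_Cderive F x (f x)) -> (forall x, Ccont f x) -> Uint f (F 1 - F 0)%C.
Proof.
  intros HD Hf.
  assert (Hlim : forall x, continuous (fun y => Cmod (F y - F x)) x).
  { intros x. apply (Ccont_Cmod (fun y => F y - F x)%C).
    apply Ccont_minus; [eapply is_Cderive_Ccont, HD | apply Ccont_const]. }
  assert (Hlim' : forall x, filterlim (fun y => Cmod (F y - F x)) (locally x) (locally 0)).
  { intros x. pose proof (Hlim x) as H. unfold continuous in H.
    replace (F x - F x)%C with (RtoC 0) in H by ring. rewrite Cmod_0 in H. exact H. }
  assert (Hw : forall (D : R -> Prop) x, filterlim (fun y => Cmod (F y - F x)) (within D (locally x)) (locally 0)).
  { intros D x. refine (filterlim_filter_le_1 _ _ (Hlim' x)). apply filter_le_within. }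
  apply (CInt_antiderivative in_unit _ _ F); auto; [exact interval_unit | exact (Hw _ 0) | exact (Hw _ 1)].
Qed.

(** * Characters and symmetric trigonometric sums *)

Definition character (n : Z) (x : R) : C := Cexp (2 * PI * Ci * IZR n * x).

Lemma Cmod_character (n : Z) (x : R) : Cmod (character n x) = 1.
Proof.
  unfold character. rewrite Cmod_Cexp. replace (Re _) with 0; [apply exp_0|].
  cbn. unfold Re, Im. cbn. ring.
Qed.

Lemma character_plus (n m : Z) (x : R) : character (n + m) x = (character n x * character m x)%C.
Proof.
  unfold character. rewrite <- Cexp_plus. f_equal. rewrite plus_IZR, RtoC_plus. ring.
Qed.

Lemma character_0 (x : R) : character 0 x = 1%C.
Proof. unfold character. rewrite <- Cexp_0. f_equal. ring. Qed.

Lemma Cexp_2PI_INR (n : nat) : Cexp (2 * PI * Ci * INR n) = 1%C.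
Proof.
  induction n as [|n IH].
  - simpl. rewrite <- Cexp_0. f_equal. ring.
  - rewrite S_INR, RtoC_plus, Cmult_plus_distr_l, Cexp_plus, IH.
    replace (2 * PI * Ci * 1)%C with (0, 2 * PI)
      by (apply C_ext; cbn; unfold Re, Im; cbn; ring).
    unfold Cexp. cbn [Re Im fst snd]. rewrite exp_0, cos_2PI, sin_2PI.
    apply C_ext; cbn; unfold Re, Im; cbn; ring.
Qed.

Lemma character_INR (n : Z) (k : nat) : character n (INR k) = 1%C.
Proof.
  unfold character. destruct (Z_le_gt_dec 0 n) as [H|H].
  - rewrite <- (Z2Nat.id n H), <- INR_IZR_INZ.
    replace (2 * PI * Ci * INR (Z.to_nat n) * INR k)%C with (2 * PI * Ci * RtoC (INR (Z.to_nat n * k)))%C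
      by (rewrite mult_INR, RtoC_mult; ring).
    apply Cexp_2PI_INR.
  - replace n with (- Z.of_nat (Z.to_nat (- n)))%Z by lia. rewrite opp_IZR, <- INR_IZR_INZ, RtoC_opp.
    replace (2 * PI * Ci * - INR (Z.to_nat (- n)) * INR k)%C
      with (- (2 * PI * Ci * RtoC (INR (Z.to_nat (- n) * k))))%C
      by (rewrite mult_INR, RtoC_mult; ring).
    rewrite Cexp_opp, Cexp_2PI_INR. field.
Qed.

Lemma is_Cderive_character (n : Z) (x : R) :
  is_Cderive (character n) x (2 * PI * Ci * IZR n * character n x)%C.
Proof.
  exact (is_Cderive_ext _ _ _ _ _ (fun _ => eq_refl) (f_equal2 Cmult (Cmult_1_r _) eq_refl)
    (is_Cderive_Cexp _ _ _ (is_Cderive_scal (2 * PI * Ci * IZR n)%C _ _ _ (is_Cderive_id x)))).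
Qed.

Lemma Ccont_character (n : Z) (x : R) : Ccont (character n) x.
Proof. eapply is_Cderive_Ccont, is_Cderive_character. Qed.

Lemma two_PI_Ci_IZR_neq_0 (n : Z) : n <> 0%Z -> (2 * PI * Ci * IZR n)%C <> 0%C.
Proof.
  intros Hn E. apply (f_equal Im) in E. cbn in E. unfold Im, Re in E. cbn in E.
  assert (IZR n <> 0) by (now apply not_0_IZR). pose proof PI_RGT_0.
  assert (PI * IZR n = 0) by lra. apply Rmult_integral in H1. lra.
Qed.

Lemma Uint_character (n : Z) : Uint (character n) (if Z.eqb n 0 then 1 else 0)%C.
Proof.
  destruct (Z.eqb_spec n 0) as [->|Hn].
  - replace (RtoC 1) with (RtoC 1 - RtoC 0)%C by ring.
    eapply (CInt_ext in_unit); [exact interval_unit | |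
      apply (Uint_antiderivative (fun x => RtoC x) (fun _ => 1%C))].
    + intros x _. now rewrite character_0.
    + intros; apply is_Cderive_id.
    + intros; apply Ccont_const.
  - set (q := (2 * PI * Ci * IZR n)%C).
    assert (Hq : q <> 0%C) by now apply two_PI_Ci_IZR_neq_0.
    replace (RtoC 0) with (/ q * character n 1 - / q * character n 0)%C.
    2:{ rewrite (character_INR n 1 : character n 1 = 1%C), (character_INR n 0 : character n 0 = 1%C). ring. }
    apply (Uint_antiderivative (fun x => / q * character n x)%C); [|apply Ccont_character].
    intros x. eapply is_Cderive_ext; [reflexivity | |
      apply (is_Cderive_scal (/ q)%C), is_Cderive_character].
    fold q. field. exact Hq.
Qed.

Definition symmetric_sum (u : Z -> C) (N : nat) : C :=
  Csum (fun k => u (Z.of_nat (S k)) + u (- Z.of_nat (S k))%Z)%C N.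

Lemma Ccont_symmetric_sum (u : Z -> R -> C) (x : R) (N : nat) :
  (forall n, Ccont (u n) x) -> Ccont (fun x => symmetric_sum (fun n => u n x) N) x.
Proof.
  intros H. unfold symmetric_sum. induction N as [|N IH]; cbn [Csum]; [apply Ccont_const|].
  apply Ccont_plus; [exact IH|]. now apply Ccont_plus.
Qed.

Lemma symmetric_sum_delta (c : Z -> C) (m : Z) (N : nat) : c 0%Z = 0%C ->
  symmetric_sum (fun n => c n * if Z.eqb n m then 1 else 0)%C N
    = if Nat.leb (Z.abs_nat m) N then c m else 0%C.
Proof.
  intros Hc0. unfold symmetric_sum. induction N as [|N IH]; cbn [Csum].
  - destruct (Nat.leb_spec (Z.abs_nat m) 0) as [L|L]; [|reflexivity].
    replace m with 0%Z by lia. now rewrite Hc0.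
  - rewrite IH.
    destruct (Nat.leb_spec (Z.abs_nat m) N) as [L|L];
    destruct (Nat.leb_spec (Z.abs_nat m) (S N)) as [L'|L']; try lia;
    destruct (Z.eqb_spec (Z.of_nat (S N)) m) as [E1|E1];
    destruct (Z.eqb_spec (- Z.of_nat (S N)) m) as [E2|E2]; try lia; subst; ring.
Qed.

Lemma Uint_trigonometric (c : Z -> C) (m : Z) (N : nat) : c 0%Z = 0%C -> (Z.abs_nat m <= N)%nat ->
  Uint (fun x => symmetric_sum (fun n => c n * character n x) N * character (- m) x)%C (c m).
Proof.
  intros Hc0 HN.
  assert (Hterm : forall n, Uint (fun x => c n * character n x * character (- m) x)%C
            (c n * if Z.eqb n m then 1 else 0)%C).
  { intros n. replace (Z.eqb n m) with (Z.eqb (n + - m) 0).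
    - eapply (CInt_ext in_unit); [exact interval_unit | |
        exact (CInt_scal _ _ (c n) _ _ _ _ (Uint_character (n + - m)))].
      intros x _. cbv beta. rewrite character_plus. ring.
    - destruct (Z.eqb_spec n m), (Z.eqb_spec (n + - m) 0); auto; lia. }
  replace (c m) with (symmetric_sum (fun n => c n * if Z.eqb n m then 1 else 0)%C N).
  2:{ rewrite symmetric_sum_delta by exact Hc0. apply Nat.leb_le in HN. now rewrite HN. }
  clear HN. unfold symmetric_sum. induction N as [|N IH]; cbn [Csum].
  - replace (RtoC 0) with (0 * if Z.eqb 0 0 then 1 else 0)%C by (cbn; ring).
    eapply (CInt_ext in_unit); [exact interval_unit | |
      exact (CInt_scal _ _ 0%C _ _ _ _ (Uint_character 0))].
    intros x _. cbv beta. ring.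
  - eapply (CInt_ext in_unit); [exact interval_unit | |
      exact (CInt_plus _ _ _ _ _ _ _ _ IH (CInt_plus _ _ _ _ _ _ _ _ (Hterm (Z.of_nat (S N)))
        (Hterm (- Z.of_nat (S N))%Z)))].
    intros x _. cbv beta. ring.
Qed.

(** The weight is bounded near x, so the approximation is locally uniform there and continuity
    passes to the limit. W bounds the weight on such a neighbourhood. *)
Lemma uniform_approx_Ccont (f : R -> C) (S : nat -> R -> C) (d : R) (rho : nat -> R) :
  (forall N x, in_unit x -> Ccont (S N) x) -> is_lim_seq rho 0 ->
  (forall N x, in_unit x -> (1 <= N)%nat -> Cmod (f x - S N x) <= rho N * unit_weight d x) ->
  forall x, in_unit x -> Ccont f x.
Proof.
  intros HS Hrho Hle x Hx. apply Ccont_epsilon. intros eps He.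
  pose proof (continuous_unit_weight d x Hx) as Hw.
  set (W := unit_weight d x + 1).
  assert (HW : 0 < W).
  { unfold W, unit_weight. pose proof (exp_pos ((d - 1) * ln x)). pose proof (exp_pos ((d - 1) * ln (1 - x))). lra. }
  destruct (Hw (fun y => Rabs (y - unit_weight d x) < 1)) as [d1 Hd1].
  { exists (mkposreal 1 Rlt_0_1). intros y Hy. exact Hy. }
  apply is_lim_seq_spec in Hrho.
  assert (He4 : 0 < eps / (4 * W)) by (apply Rdiv_lt_0_compat; lra).
  destruct (Hrho (mkposreal _ He4)) as [N0 HN0].
  set (N := Nat.max 1 N0). specialize (HN0 N (Nat.le_max_r _ _)). simpl in HN0.
  rewrite Rminus_0_r in HN0.
  destruct (Ccont_epsilon_inv _ _ (HS N x Hx) (eps / 4) ltac:(lra)) as [d2 [Hd2 K2]].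
  unfold in_unit in Hx.
  assert (Hd3 : 0 < Rmin x (1 - x)) by (apply Rmin_pos; lra).
  exists (Rmin d1 (Rmin d2 (Rmin x (1 - x)))). split.
  { apply Rmin_pos; [apply cond_pos|]. now apply Rmin_pos. }
  intros y Hy.
  assert (H1 : Rabs (y - x) < d1) by (eapply Rlt_le_trans; [exact Hy | apply Rmin_l]).
  assert (H2 : Rabs (y - x) < d2).
  { eapply Rlt_le_trans; [exact Hy|]. eapply Rle_trans; [apply Rmin_r | apply Rmin_l]. }
  assert (H3 : Rabs (y - x) < Rmin x (1 - x)).
  { eapply Rlt_le_trans; [exact Hy|]. eapply Rle_trans; [apply Rmin_r | apply Rmin_r]. }
  pose proof (Rmin_l x (1 - x)). pose proof (Rmin_r x (1 - x)).
  apply Rabs_def2 in H3.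
  assert (Hy1 : in_unit y) by (unfold in_unit; lra).
  specialize (Hd1 y H1). cbv beta in Hd1. apply Rabs_def2 in Hd1.
  pose proof (Hle N y Hy1 (Nat.le_max_l _ _)) as A1.
  pose proof (Hle N x Hx (Nat.le_max_l _ _)) as A2.
  specialize (K2 y H2).
  assert (Hr : rho N < eps / (4 * W)) by (eapply Rle_lt_trans; [apply Rle_abs | exact HN0]).
  assert (HrW : eps / (4 * W) * W = eps / 4) by (field; lra).
  assert (Hb : forall w, 0 < w <= W -> rho N * w <= eps / 4).
  { intros w Hw'. rewrite <- HrW. destruct (Rle_dec 0 (rho N)).
    - apply Rmult_le_compat; lra.
    - assert (rho N * w <= 0) by nra. assert (0 <= eps / (4 * W) * W) by (rewrite HrW; lra). lra. }
  assert (Hpos : forall t, 0 < unit_weight d t).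
  { intros t. unfold unit_weight. pose proof (exp_pos ((d - 1) * ln t)).
    pose proof (exp_pos ((d - 1) * ln (1 - t))). lra. }
  pose proof (Hb (unit_weight d y) ltac:(split; [apply Hpos | unfold W; lra])).
  pose proof (Hb (unit_weight d x) ltac:(split; [apply Hpos | unfold W; lra])).
  replace (f y - f x)%C with ((f y - S N y) + ((S N y - S N x) + - (f x - S N x)))%C by ring.
  eapply Rle_lt_trans; [apply Cmod_triangle|].
  pose proof (Cmod_triangle (S N y - S N x) (- (f x - S N x))) as A3. rewrite Cmod_opp in A3. lra.
Qed.

Lemma symmetric_sum_bound (c : Z -> C) (N : nat) :
  exists B, forall x, Cmod (symmetric_sum (fun n => c n * character n x)%C N) <= B.
Proof.
  unfold symmetric_sum. induction N as [|N [B IH]].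
  - exists 0. intros; cbn [Csum]. rewrite Cmod_0. lra.
  - exists (B + (Cmod (c (Z.of_nat (S N))) + Cmod (c (- Z.of_nat (S N))%Z))). intros x. cbn [Csum].
    eapply Rle_trans; [apply Cmod_triangle|]. apply Rplus_le_compat; [apply IH|].
    eapply Rle_trans; [apply Cmod_triangle|]. rewrite !Cmod_mult, !Cmod_character. lra.
Qed.

Lemma weight_bound_nonneg (f : R -> C) (K d : R) :
  (forall x, in_unit x -> Cmod (f x) <= K * unit_weight d x) -> 0 <= K.
Proof.
  intros H. specialize (H (/ 2) ltac:(unfold in_unit; lra)).
  pose proof (Cmod_ge_0 (f (/ 2))).
  assert (0 < unit_weight d (/ 2)).
  { unfold unit_weight. pose proof (exp_pos ((d - 1) * ln (/ 2))). pose proof (exp_pos ((d - 1) * ln (1 - / 2))). lra. }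
  nra.
Qed.

(** The n-th coefficient of the symmetric sum is exactly c n as soon as N >= |n|, and the
    coefficient of the error is at most rho N times the mass of the weight, which tends to 0. The
    condition c 0 = 0 reflects that the sums omit n = 0. *)
Lemma fourier_of_approx (f : R -> C) (c : Z -> C) (d : R) (rho : nat -> R) :
  0 < d < 1 -> c 0%Z = 0%C -> is_lim_seq rho 0 ->
  (forall N x, in_unit x -> (1 <= N)%nat ->
     Cmod (f x - symmetric_sum (fun n => c n * character n x)%C N) <= rho N * unit_weight d x) ->
  (forall x, in_unit x -> Ccont f x) /\
  (exists K, forall x, in_unit x -> Cmod (f x) <= K * unit_weight d x) /\
  (forall n, Uint (fun x => f x * character (- n) x)%C (c n)).
Proof.
  intros Hd Hc0 Hrho Hle.
  assert (HS : forall N x, Ccont (fun x => symmetric_sum (fun n => c n * character n x)%C N) x).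
  { intros N x. apply Ccont_symmetric_sum. intros n. apply Ccont_mult; [apply Ccont_const | apply Ccont_character]. }
  assert (Hcont : forall x, in_unit x -> Ccont f x).
  { apply (uniform_approx_Ccont f (fun N x => symmetric_sum (fun n => c n * character n x)%C N) d rho); auto. }
  split; [exact Hcont|].
  destruct (symmetric_sum_bound c 1) as [B HB].
  assert (HK : forall x, in_unit x -> Cmod (f x) <= (rho 1%nat + B) * unit_weight d x).
  { intros x Hx. specialize (Hle 1%nat x Hx (le_n _)). specialize (HB x).
    pose proof (unit_weight_ge_1 d x ltac:(lra) Hx) as H1.
    set (t := symmetric_sum (fun n => c n * character n x)%C 1) in *.
    replace (f x) with ((f x - t) + t)%C by ring. eapply Rle_trans; [apply Cmod_triangle|].
    pose proof (Cmod_ge_0 t). nra. }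
  split; [now exists (rho 1%nat + B)|].
  intros n.
  assert (Hm : forall g K, (forall x, in_unit x -> Cmod (g x) <= K * unit_weight d x) ->
     forall x, in_unit x -> Cmod (g x * character (- n) x) <= K * unit_weight d x).
  { intros g K H x Hx. rewrite Cmod_mult, Cmod_character, Rmult_1_r. auto. }
  destruct (Uint_weight (fun x => f x * character (- n) x)%C (rho 1%nat + B) d) as [l [Hl _]].
  - lra.
  - intros x Hx. apply Ccont_mult; [auto | apply Ccont_character].
  - apply Hm, HK.
  - replace (c n) with l; [exact Hl|].
    (* The index S N + |n| is at least 1, as the approximation demands, and at least |n|, so that
       the sum contains the frequency n. *)
    apply (Clim_bound_eventually (fun _ => c n) (c n) l (fun N => rho (S N + Z.abs_nat n)%nat * (2 / d))).
    + apply Clim_const.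
    + intros N. rewrite <- Cmod_opp. replace (- (c n - l))%C with (l - c n)%C by ring.
      apply (Uint_weight_bound (fun x => f x * character (- n) x
        - symmetric_sum (fun n => c n * character n x) (S N + Z.abs_nat n) * character (- n) x)%C).
      * lra.
      * intros x Hx. apply Ccont_minus; apply Ccont_mult; auto using Ccont_character.
      * intros x Hx.
        replace (f x * character (- n) x - symmetric_sum (fun n => c n * character n x) (S N + Z.abs_nat n) * character (- n) x)%C
          with ((f x - symmetric_sum (fun n => c n * character n x) (S N + Z.abs_nat n)) * character (- n) x)%C by ring.
        rewrite Cmod_mult, Cmod_character, Rmult_1_r. apply Hle; [exact Hx | lia].
      * apply CInt_minus; try apply filter_filter; [exact Hl|].
        apply Uint_trigonometric; [exact Hc0 | lia].
    + replace 0 with (0 * (2 / d)) by ring. apply (is_lim_seq_scal_r _ (2 / d) 0).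
      apply (is_lim_seq_ext (fun N => rho (N + S (Z.abs_nat n))%nat)); [intros; f_equal; lia|].
      now apply is_lim_seq_incr_n.
Qed.

(** * The Fourier series on the half-plane Re s < 1 *)

Lemma PI_bounds : 3 < PI <= 4.
Proof. pose proof PI2_3_2. pose proof PI_4. lra. Qed.

(** For 0 <= x <= 2 the bound sin x >= x - x^3 / 6 gives sin x >= x / 3, and x = PI a with PI >
    3. *)
Lemma sin_PI_ge (a : R) : 0 <= a <= / 2 -> a <= sin (PI * a).
Proof.
  intros Ha. pose proof PI_bounds as HP. set (x := PI * a).
  assert (Hx : 0 <= x <= 2) by (unfold x; nra).
  destruct (pre_sin_bound x 0 ltac:(lra) ltac:(lra)) as [H _].
  unfold sin_approx, sin_term in H. cbn -[INR] in H.
  replace (INR 6) with 6 in H by (simpl; ring). replace (INR 1) with 1 in H by reflexivity.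
  assert (Hx2 : x * x <= 4) by nra.
  assert (x * (x * x) <= x * 4) by (apply Rmult_le_compat_l; lra).
  assert (a <= x / 3) by (unfold x; nra).
  lra.
Qed.

Lemma sin_PI_ge_min (a : R) : 0 < a < 1 -> Rmin a (1 - a) <= sin (PI * a).
Proof.
  intros Ha. unfold Rmin. destruct (Rle_dec a (1 - a)).
  - apply sin_PI_ge. lra.
  - rewrite <- (sin_PI_x (PI * a)). replace (PI - PI * a) with (PI * (1 - a)) by ring.
    apply sin_PI_ge. lra.
Qed.

(** * The geometric kernel and its tails *)

Definition nome (a x : R) : C := Cexp (2 * PI * Ci * a - 2 * PI * x).

Lemma Cmod_nome (a x : R) : Cmod (nome a x) = exp (- (2 * PI * x)).
Proof.
  unfold nome. rewrite Cmod_Cexp. f_equal. cbn. unfold Re, Im. cbn. ring.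
Qed.

Lemma nome_pow (a x : R) (k : nat) :
  (nome a x ^ k)%C = (character (Z.of_nat k) a * Cexp (- (2 * PI * INR k * x)%R))%C.
Proof.
  unfold nome, character. rewrite <- Cexp_INR_mult, <- INR_IZR_INZ, <- Cexp_plus. f_equal.
  rewrite !RtoC_mult. ring.
Qed.

Lemma Cmod_one_minus_nome_sq (a x : R) :
  Cmod (1 - nome a x) ^ 2 = (1 - exp (- (2 * PI * x))) ^ 2 + 4 * exp (- (2 * PI * x)) * sin (PI * a) ^ 2.
Proof.
  rewrite Cmod2_alt. unfold nome, Cexp.
  replace (Re (2 * PI * Ci * a - 2 * PI * x)%C) with (- (2 * PI * x)) by (cbn; unfold Re, Im; cbn; ring).
  replace (Im (2 * PI * Ci * a - 2 * PI * x)%C) with (2 * (PI * a)) by (cbn; unfold Re, Im; cbn; ring).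
  cbn [Re Im fst snd Cminus Cplus Copp RtoC].
  rewrite cos_2a_sin, sin_2a. pose proof (sin2_cos2 (PI * a)) as E. unfold Rsqr in E.
  set (c := cos (PI * a)) in *. set (v := sin (PI * a)) in *. set (r := exp (- (2 * PI * x))).
  assert (E' : c * c = 1 - v * v) by lra.
  transitivity ((1 - r * (1 - 2 * v * v)) ^ 2 + 4 * r ^ 2 * v ^ 2 * (c * c)); [ring|]. rewrite E'. ring.
Qed.

Lemma Cmod_one_minus_nome (a x : R) : 0 < a < 1 -> 0 < x ->
  sin (PI * a) <= Cmod (1 - nome a x) /\ 1 - exp (- (2 * PI * x)) <= Cmod (1 - nome a x).
Proof.
  intros Ha Hx. pose proof (Cmod_one_minus_nome_sq a x) as E. pose proof PI_bounds as HP.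
  set (r := exp (- (2 * PI * x))) in *. set (v := sin (PI * a)) in *.
  pose proof (Cmod_ge_0 (1 - nome a x)) as H0. set (m := Cmod (1 - nome a x)) in *.
  assert (Hr0 : 0 < r) by apply exp_pos.
  assert (Hr1 : r < 1).
  { unfold r. rewrite <- exp_0. apply exp_increasing. nra. }
  assert (Hv0 : 0 < v) by (apply sin_gt_0; nra).
  assert (Hv1 : v <= 1) by apply SIN_bound.
  split; apply Rsqr_incr_0; try lra; unfold Rsqr; replace (m * m) with (m ^ 2) by ring; rewrite E.
  (* For r >= 1/4 the term 4 r v^2 suffices. Otherwise (1 - 4 r)(1 - v^2) >= 0 gives v^2 <= 1 - 4 r
     + 4 r v^2, which is at most (1 - r)^2 + 4 r v^2. *)
  - destruct (Rle_dec (/ 4) r).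
    + nra.
    + assert (v * v <= 1) by nra.
      assert (0 <= (1 - 4 * r) * (1 - v * v)) by (apply Rmult_le_pos; lra). nra.
  - nra.
Qed.

Lemma one_minus_nome_neq_0 (a x : R) : 0 < a < 1 -> 0 < x -> (1 - nome a x)%C <> 0%C.
Proof.
  intros Ha Hx. apply Cmod_gt_0. destruct (Cmod_one_minus_nome a x Ha Hx) as [H _].
  pose proof PI_bounds. assert (0 < sin (PI * a)) by (apply sin_gt_0; nra). lra.
Qed.

(** The sum of q^n over n > N; N = 0 is the full kernel q / (1 - q). *)
Definition geometric_tail (N : nat) (a x : R) : C := (nome a x ^ S N / (1 - nome a x))%C.

Lemma geometric_tail_split (N : nat) (a x : R) : 0 < a < 1 -> 0 < x ->
  geometric_tail 0 a x = (Csum (fun k => nome a x ^ S k) N + geometric_tail N a x)%C.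
Proof.
  intros Ha Hx. pose proof (one_minus_nome_neq_0 a x Ha Hx) as Hn. unfold geometric_tail.
  induction N as [|N IH]; cbn [Csum].
  - ring.
  - rewrite IH, (Cpow_S _ (S N)). field. exact Hn.
Qed.

Lemma Ccont_Cinv (f : R -> C) (x : R) : Ccont f x -> f x <> 0%C -> Ccont (fun t => / f t)%C x.
Proof.
  intros [H1 H2] Hn.
  assert (Hd : continuous (fun t => / (Re (f t) ^ 2 + Im (f t) ^ 2)) x).
  { apply (continuous_comp (fun t => Re (f t) ^ 2 + Im (f t) ^ 2) Rinv).
    - apply (continuous_plus (V := R_NormedModule) (fun t => Re (f t) ^ 2) (fun t => Im (f t) ^ 2)).
      + apply (continuous_comp (fun t => Re (f t)) (fun y => y ^ 2)); [exact H1|].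
        apply (ex_derive_continuous (V := R_NormedModule)). auto_derive; trivial.
      + apply (continuous_comp (fun t => Im (f t)) (fun y => y ^ 2)); [exact H2|].
        apply (ex_derive_continuous (V := R_NormedModule)). auto_derive; trivial.
    - apply continuous_Rinv. rewrite <- Cmod2_alt. apply pow_nonzero.
      apply Rgt_not_eq, Cmod_gt_0, Hn. }
  split.
  - exact (continuous_mult (K := R_AbsRing) (fun t => Re (f t)) _ x H1 Hd).
  - exact (continuous_mult (K := R_AbsRing) (fun t => - Im (f t)) _ x
      (continuous_opp (V := R_NormedModule) (fun t => Im (f t)) x H2) Hd).
Qed.

Lemma Ccont_nome (a x : R) : Ccont (nome a) x.
Proof.
  apply Ccont_Cexp, Ccont_minus; [apply Ccont_const|].
  apply Ccont_mult; [apply Ccont_const | apply Ccont_id].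
Qed.

Lemma Ccont_geometric_tail (N : nat) (a x : R) : 0 < a < 1 -> 0 < x -> Ccont (geometric_tail N a) x.
Proof.
  intros Ha Hx. apply Ccont_mult; [apply Ccont_pow, Ccont_nome|].
  apply (Ccont_Cinv (fun t => 1 - nome a t)%C); [|now apply one_minus_nome_neq_0].
  apply Ccont_minus; [apply Ccont_const | apply Ccont_nome].
Qed.

(* Interpolates between the two lower bounds of [Cmod_one_minus_nome]: the
   exponent [d - 1] keeps the bound integrable in [a], and the exponent [- 2 d]
   integrable in [x] with decay in [N]. *)
Lemma geometric_tail_bound (d : R) (N : nat) (a x : R) :
  0 < d <= / 2 -> (1 <= N)%nat -> 0 < a < 1 -> 0 < x ->
  Cmod (geometric_tail N a x) <= exp (- d * ln (INR N)) * unit_weight d a * (exp (2 * d * Rabs (ln x)) * exp (- x)).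
Proof.
  intros Hd HN Ha Hx. pose proof PI_bounds as HP.
  destruct (Cmod_one_minus_nome a x Ha Hx) as [H1 H2].
  unfold geometric_tail. rewrite Cmod_div by now apply one_minus_nome_neq_0.
  rewrite Cmod_pow, Cmod_nome.
  set (m := Cmod (1 - nome a x)) in *. set (y := 2 * PI * x) in *.
  assert (Hy : 0 < y) by (unfold y; nra).
  assert (HN1 : 1 <= INR N) by (now apply (le_INR 1)).
  set (S0 := Rmin a (1 - a)).
  assert (HS0 : 0 < S0) by (apply Rmin_pos; lra).
  assert (HS1 : S0 <= m) by (eapply Rle_trans; [now apply sin_PI_ge_min | exact H1]).
  assert (Hm : 0 < m) by lra.
  assert (HSw : exp ((d - 1) * ln S0) <= unit_weight d a).
  { unfold unit_weight, S0, Rmin.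
    pose proof (exp_pos ((d - 1) * ln a)). pose proof (exp_pos ((d - 1) * ln (1 - a))).
    destruct (Rle_dec a (1 - a)); lra. }
  assert (HlS : ln S0 <= ln m) by (apply ln_le; lra).
  assert (HlT : ln y - y <= ln m).
  { assert (HT : y / (1 + y) <= m).
    { eapply Rle_trans; [|exact H2]. rewrite exp_Ropp.
      pose proof (exp_ineq1_le y). pose proof (exp_pos y).
      assert (/ exp y <= / (1 + y)) by (apply Rinv_le_contravar; lra).
      replace (y / (1 + y)) with (1 - / (1 + y)) by (field; lra). lra. }
    apply ln_le in HT; [|apply Rdiv_lt_0_compat; lra].
    rewrite ln_div in HT by lra.
    assert (ln (1 + y) <= y).
    { rewrite <- (ln_exp y) at 2. apply ln_le; [lra | apply exp_ineq1_le]. }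
    lra. }
  assert (Hinv : / m <= exp ((d - 1) * ln S0) * exp (- d * ln y + y)).
  { rewrite <- (exp_ln m) at 1 by exact Hm. rewrite <- exp_Ropp, <- exp_plus.
    apply exp_le_compat. nra. }
  assert (Hpow : exp (- y) ^ S N = exp (- (INR N + 1) * y)).
  { rewrite <- S_INR. generalize (S N). clear. induction n as [|n IH].
    - simpl. rewrite Ropp_0, Rmult_0_l, exp_0. reflexivity.
    - cbn [pow]. rewrite IH, <- exp_plus, S_INR. f_equal. ring. }
  rewrite Hpow.
  (* After 1/m has cost e^y, the decay left is e^(- N y). One half of it pays for (N y / 2)^(- d),
     hence for the factor N^(- d); the other half still dominates e^(- x). *)
  assert (Hz : d * ln (INR N * (y / 2)) <= INR N * (y / 2)).
  { assert (0 < INR N * (y / 2)) by nra.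
    pose proof (exp_ineq1_le (ln (INR N * (y / 2)))) as H3. rewrite exp_ln in H3 by assumption. nra. }
  rewrite ln_mult in Hz by lra.
  assert (Hly2 : ln (y / 2) = ln PI + ln x).
  { rewrite <- ln_mult by lra. f_equal. unfold y. field. }
  assert (Hly : ln y = ln (2 * PI) + ln x).
  { rewrite <- ln_mult by lra. reflexivity. }
  assert (HlP : 0 < ln PI) by (rewrite <- ln_1; apply ln_increasing; lra).
  assert (HlP2 : 0 < ln (2 * PI)) by (rewrite <- ln_1; apply ln_increasing; lra).
  unfold Rdiv. eapply Rle_trans; [apply Rmult_le_compat_l; [apply Rlt_le, exp_pos | exact Hinv]|].
  apply Rle_trans with (exp (- d * ln (INR N)) * exp ((d - 1) * ln S0) * (exp (2 * d * Rabs (ln x)) * exp (- x))).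
  - rewrite <- !exp_plus. apply exp_le_compat.
    assert (Ha1 : - ln x <= Rabs (ln x)) by (rewrite <- Rabs_Ropp; apply Rle_abs).
    rewrite Hly. rewrite Hly2 in Hz.
    assert (Hxy : x <= INR N * (y / 2)).
    { unfold y. assert (x <= PI * x) by nra. assert (PI * x <= INR N * (PI * x)) by nra. nra. }
    assert (0 <= d * ln PI) by nra. assert (0 <= d * ln (2 * PI)) by nra.
    assert (- (2 * d) * ln x <= 2 * d * Rabs (ln x)) by nra.
    nra.
  - apply Rmult_le_compat_r; [apply Rmult_le_pos; apply Rlt_le, exp_pos|].
    apply Rmult_le_compat_l; [apply Rlt_le, exp_pos | exact HSw].
Qed.

(** Twice this exponent plus the (1 - sigma) / 8 spent on the logarithm stays within the (1 - sigma)
    / 2 allowed by [power_exp_le_weight]; the bound 1/2 is the condition of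
    [geometric_tail_bound]. *)
Definition tail_exponent (sigma : R) : R := Rmin ((1 - sigma) / 8) (/ 2).

Lemma tail_exponent_bounds (sigma : R) : sigma < 1 ->
  0 < tail_exponent sigma <= / 2 /\ tail_exponent sigma <= (1 - sigma) / 8.
Proof.
  intros Hs. unfold tail_exponent.
  pose proof (Rmin_l ((1 - sigma) / 8) (/ 2)). pose proof (Rmin_r ((1 - sigma) / 8) (/ 2)).
  assert (0 < Rmin ((1 - sigma) / 8) (/ 2)) by (apply Rmin_pos; lra). lra.
Qed.

(** Removing N terms of the geometric series leaves the integral of kappa against the N-th tail. A
    general kappa covers both x^(-s) and its derivative in s, and K is fixed before a and N. *)
Lemma geometric_kernel_series (kappa : R -> C) (B sigma : R) :
  sigma < 1 -> (forall x, 0 < x -> Ccont kappa x) ->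
  (forall x, 0 < x -> Cmod (kappa x) <= B * (exp (- sigma * ln x) * exp ((1 - sigma) / 8 * Rabs (ln x)))) ->
  exists K, forall (a : R) (N : nat) (A : C) (c : nat -> C), 0 < a < 1 -> (1 <= N)%nat ->
    Cint (fun x => kappa x * geometric_tail 0 a x)%C A ->
    (forall k, Cint (fun x => kappa x * Cexp (- (2 * PI * INR (S k) * x)%R))%C (c k)) ->
    Cmod (A - Csum (fun k => c k * character (Z.of_nat (S k)) a) N)%C
      <= K * exp (- tail_exponent sigma * ln (INR N)) * unit_weight (tail_exponent sigma) a.
Proof.
  intros Hs Hk HB. destruct (tail_exponent_bounds sigma Hs) as [Hd Hd8].
  set (d := tail_exponent sigma) in *.
  destruct (power_exp_le_weight sigma 1 Hs Rlt_0_1) as [K HK].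
  set (D := (1 - sigma) / 2) in *.
  assert (HD : 0 < D) by (unfold D; lra).
  assert (HB0 : 0 <= B).
  { specialize (HB 1 Rlt_0_1). pose proof (Cmod_ge_0 (kappa 1)).
    pose proof (exp_pos (- sigma * ln 1)). pose proof (exp_pos ((1 - sigma) / 8 * Rabs (ln 1))).
    assert (0 < exp (- sigma * ln 1) * exp ((1 - sigma) / 8 * Rabs (ln 1))) by now apply Rmult_lt_0_compat. nra. }
  exists (B * K * (PI / 2 / D)). intros a N A c Ha HN HA Hc.
  set (E := exp (- d * ln (INR N)) * unit_weight d a).
  assert (HE : 0 <= E).
  { apply Rmult_le_pos; [apply Rlt_le, exp_pos|].
    pose proof (unit_weight_ge_1 d a ltac:(lra) Ha). lra. }
  assert (Htail : Cint (fun x => kappa x * geometric_tail N a x)%C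
            (A - Csum (fun k => c k * character (Z.of_nat (S k)) a) N)%C).
  { assert (Hsum : Cint (fun x => kappa x * Csum (fun k => nome a x ^ S k) N)%C
             (Csum (fun k => c k * character (Z.of_nat (S k)) a) N)%C).
    { clear HN E HE. induction N as [|N IH]; cbn [Csum].
      - replace (RtoC 0) with (0 * A)%C by ring.
        eapply (CInt_ext is_positive); [exact interval_positive | | exact (CInt_scal _ _ 0%C _ _ _ _ HA)].
        intros x _. cbv beta. ring.
      - replace (c N * character (Z.of_nat (S N)) a)%C with (character (Z.of_nat (S N)) a * c N)%C by ring.
        eapply (CInt_ext is_positive); [exact interval_positive | |
          exact (CInt_plus _ _ _ _ _ _ _ _ IH (CInt_scal _ _ (character (Z.of_nat (S N)) a) _ _ _ _ (Hc N)))].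
        intros x _. cbv beta. rewrite (nome_pow a x (S N)). ring. }
    eapply (CInt_ext is_positive); [exact interval_positive | | exact (CInt_minus _ _ _ _ _ _ _ _ HA Hsum)].
    intros x Hx. cbv beta. rewrite (geometric_tail_split N a x Ha Hx). ring. }
  destruct (Cint_weight (fun x => kappa x * geometric_tail N a x)%C (B * E * K) D) as [l [Hl Hle]].
  - exact HD.
  - intros x Hx. apply Ccont_mult; [auto | now apply Ccont_geometric_tail].
  - intros x Hx. rewrite Cmod_mult.
    pose proof (geometric_tail_bound d N a x Hd HN Ha Hx) as HT. fold E in HT.
    specialize (HB x Hx). specialize (HK x Hx).
    replace (B * E * K * weight D x) with (B * E * (K * weight D x)) by ring.
    eapply Rle_trans; [|apply Rmult_le_compat_l; [now apply Rmult_le_pos | exact HK]].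
    eapply Rle_trans; [apply Rmult_le_compat; [apply Cmod_ge_0 | apply Cmod_ge_0 | exact HB | exact HT]|].
    replace (B * (exp (- sigma * ln x) * exp ((1 - sigma) / 8 * Rabs (ln x))) * (E * (exp (2 * d * Rabs (ln x)) * exp (- x))))
      with (B * E * (exp (- sigma * ln x) * (exp ((1 - sigma) / 8 * Rabs (ln x)) * exp (2 * d * Rabs (ln x))) * exp (- x))) by ring.
    apply Rmult_le_compat_l; [now apply Rmult_le_pos|].
    replace (- x) with (- (1) * x) by ring.
    apply Rmult_le_compat_r; [apply Rlt_le, exp_pos|].
    apply Rmult_le_compat_l; [apply Rlt_le, exp_pos|].
    rewrite <- exp_plus. apply exp_le_compat. unfold D. pose proof (Rabs_pos (ln x)). nra.
  - rewrite (CInt_unique _ _ _ _ _ filter_at_right_0 filter_p_infty Htail Hl).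
    eapply Rle_trans; [exact Hle|]. apply Req_le. unfold E. ring.
Qed.

(** The logarithm from differentiation costs an arbitrarily small power: t <= e^(eta t) / eta at t =
    |ln x|. One B serves both kernels. *)
Lemma mellin_kernel_bound (u s : C) : Re s < 1 ->
  exists B, forall x, 0 < x ->
    Cmod (Cexp (s * (u - ln x))) <= B * (exp (- Re s * ln x) * exp ((1 - Re s) / 8 * Rabs (ln x))) /\
    Cmod (Cexp (s * (u - ln x)) * (u - ln x)) <= B * (exp (- Re s * ln x) * exp ((1 - Re s) / 8 * Rabs (ln x))).
Proof.
  intros Hs. set (eta := (1 - Re s) / 8). assert (He : 0 < eta) by (unfold eta; lra).
  set (b := exp (Re (s * u)%C)). assert (Hb : 0 < b) by apply exp_pos.
  pose proof (Cmod_ge_0 u) as Hu. pose proof (Rinv_0_lt_compat _ He) as Hi.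
  exists (b * (1 + Cmod u + / eta)). intros x Hx.
  assert (E : Cmod (Cexp (s * (u - ln x))) = b * exp (- Re s * ln x)).
  { rewrite Cmod_Cexp. unfold b. rewrite <- exp_plus. f_equal. cbn. unfold Re, Im. ring. }
  pose proof (Rabs_pos (ln x)) as Hl. set (t := Rabs (ln x)) in *.
  assert (H1 : 1 + eta * t <= exp (eta * t)) by apply exp_ineq1_le.
  assert (H0 : 0 <= eta * t) by (apply Rmult_le_pos; lra).
  assert (Ht : t <= / eta * exp (eta * t)).
  { apply Rmult_le_reg_l with eta; [exact He|]. rewrite <- Rmult_assoc, Rinv_r, Rmult_1_l by lra. lra. }
  pose proof (exp_pos (- Re s * ln x)) as Hp.
  split.
  - rewrite E. rewrite Rmult_assoc. apply Rmult_le_compat_l; [lra|].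
    rewrite (Rmult_comm (1 + Cmod u + / eta)), Rmult_assoc.
    rewrite <- (Rmult_1_r (exp (- Re s * ln x))) at 1. apply Rmult_le_compat_l; [lra|]. nra.
  - rewrite Cmod_mult, E. rewrite !Rmult_assoc. apply Rmult_le_compat_l; [lra|].
    rewrite <- Rmult_assoc, (Rmult_comm (1 + Cmod u + / eta)), !Rmult_assoc. apply Rmult_le_compat_l; [lra|].
    assert (Hm : Cmod (u - ln x) <= Cmod u + t).
    { unfold Cminus, t. eapply Rle_trans; [apply Cmod_triangle|]. rewrite Cmod_opp, Cmod_R. lra. }
    nra.
Qed.

(** * Mellin transforms with a logarithmic shift *)

Lemma Ccont_mellin_kernel (u s : C) (x : R) : 0 < x -> Ccont (fun x => Cexp (s * (u - ln x))) x.
Proof.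
  intros Hx. apply Ccont_Cexp, Ccont_mult; [apply Ccont_const|].
  apply Ccont_minus; [apply Ccont_const | now apply Ccont_ln].
Qed.

(** The Mellin transform of phi at 1 - s, times e^(s u). The shift u will supply the argument +- pi
    / 2 of 2 pi i n, so that one derivative in s produces the whole of its logarithm. *)
Definition mellin (phi : R -> C) (u s : C) : C :=
  RInt_gen (V := C_R_CompleteNormedModule) (fun x => phi x * Cexp (s * (u - ln x)))%C
    (at_right 0) (Rbar_locally p_infty).

Definition mellin_deriv (phi : R -> C) (u s : C) : C :=
  RInt_gen (V := C_R_CompleteNormedModule) (fun x => phi x * Cexp (s * (u - ln x)) * (u - ln x))%C
    (at_right 0) (Rbar_locally p_infty).

Lemma mellin_analytic (phi : R -> C) (B c : R) (u s : C) :
  0 < c -> Re s < 1 -> (forall x, 0 < x -> Ccont phi x) ->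
  (forall x, 0 < x -> Cmod (phi x) <= B * exp (- c * x)) ->
  Cint (fun x => phi x * Cexp (s * (u - ln x)))%C (mellin phi u s) /\
  Cint (fun x => phi x * Cexp (s * (u - ln x)) * (u - ln x))%C (mellin_deriv phi u s) /\
  exists r M a, taylor_at (mellin phi u) s r M a /\ a 1%nat = mellin_deriv phi u s.
Proof.
  intros Hc Hs Hphi Hb.
  destruct (mellin_taylor phi B c u s Hc Hs Hphi Hb) as [M [a [H1 H2]]].
  assert (HI : forall h, Cmod h < (1 - Re s) / 4 ->
    Cint (fun x => phi x * Cexp ((s + h) * (u - ln x)))%C (mellin phi u (s + h))).
  { intros h Hh. destruct (H2 h Hh) as [[l Hl] _]. unfold mellin.
    now rewrite (CInt_RInt_gen _ _ _ _ filter_at_right_0 filter_p_infty Hl). }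
  assert (E : a 1%nat = mellin_deriv phi u s).
  { unfold mellin_deriv. now rewrite (CInt_RInt_gen _ _ _ _ filter_at_right_0 filter_p_infty H1). }
  split; [|split].
  - specialize (HI 0%C). rewrite Cmod_0, Cplus_0_r in HI. apply HI. lra.
  - rewrite <- E. exact H1.
  - exists ((1 - Re s) / 4), M, a. split; [|exact E]. split; [lra|].
    intros h N Hh. destruct (H2 h Hh) as [_ H]. apply H. now apply HI.
Qed.

Lemma Clog_imaginary (n : nat) :
  Clog (2 * PI * Ci * IZR (Z.of_nat (S n))) = (RtoC (ln (2 * PI * INR (S n))) + (0, (PI / 2)%R))%C /\
  Clog (2 * PI * Ci * IZR (- Z.of_nat (S n))) = (RtoC (ln (2 * PI * INR (S n))) + (0, (- (PI / 2))%R))%C.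
Proof.
  rewrite opp_IZR, <- INR_IZR_INZ.
  assert (Hn : 0 < INR (S n)) by (apply lt_0_INR; lia).
  pose proof PI_RGT_0 as HP. set (q := 2 * PI * INR (S n)).
  assert (Hq : 0 < q) by (unfold q; apply Rmult_lt_0_compat; lra).
  replace (2 * PI * Ci * INR (S n))%C with (Ci * RtoC q)%C by (unfold q; rewrite !RtoC_mult; ring).
  replace (2 * PI * Ci * (- INR (S n))%R)%C with (- (Ci * RtoC q))%C
    by (unfold q; rewrite !RtoC_mult, RtoC_opp; ring).
  assert (Hm : Cmod (Ci * RtoC q) = q) by (rewrite Cmod_mult, Cmod_Ci, Cmod_R, Rabs_right; lra).
  unfold Clog, Carg. rewrite Cmod_opp, Hm.
  replace (Re (Ci * RtoC q)%C) with 0 by (cbn; ring). replace (Im (Ci * RtoC q)%C) with q by (cbn; ring).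
  replace (Re (- (Ci * RtoC q))%C) with 0 by (cbn; ring). replace (Im (- (Ci * RtoC q))%C) with (- q) by (cbn; ring).
  unfold Rdiv at 1 2 4 5. rewrite !Rmult_0_l, acos_0.
  destruct (Rle_dec 0 q); [|lra]. destruct (Rle_dec 0 (- q)); [lra|].
  split; apply C_ext; cbn; unfold Re, Im; cbn; ring.
Qed.

Lemma mellin_exponential (c : R) (u s : C) : 0 < c -> Re s < 1 ->
  mellin (fun x => Cexp (- (c * x)%R)) u s = (Cexp (s * u) * (CGamma (1 - s) * Cexp (ln c * (s - 1))))%C.
Proof.
  intros Hc Hs. rewrite CGamma_laplace_power by exact Hs.
  (* For a real exponent ln c the rotation formula is the scaling of x by c. *)
  rewrite <- (laplace_power_rotation s (ln c) Hs).
  2:{ cbn. rewrite Rabs_R0. pose proof PI_RGT_0. lra. }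
  rewrite Cexp_RtoC, exp_ln by exact Hc.
  unfold mellin. apply CInt_RInt_gen; auto.
  eapply (CInt_ext is_positive); [exact interval_positive | |
    apply (CInt_scal _ _ (Cexp (s * u))); try apply filter_filter;
    apply (Cint_laplace_power s (RtoC c) Hs); exact Hc].
  intros x Hx. cbv beta. unfold power_exp. rewrite <- !Cexp_plus. f_equal. rewrite RtoC_mult. ring.
Qed.

Lemma exponential_bound (c x : R) : Cmod (Cexp (- (c * x)%R)) <= 1 * exp (- c * x).
Proof.
  rewrite <- RtoC_opp, Cexp_RtoC, Cmod_R, Rabs_right by (apply Rle_ge, Rlt_le, exp_pos).
  rewrite Rmult_1_l. apply Req_le. f_equal. ring.
Qed.

Lemma Ccont_exponential (c x : R) : Ccont (fun x => Cexp (- (c * x)%R)) x.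
Proof.
  apply Ccont_Cexp. apply (Ccont_ext (fun x => RtoC (- (c * x)))); [intros; apply RtoC_opp|].
  apply Ccont_RtoC. apply (ex_derive_continuous (V := R_NormedModule)). auto_derive; trivial.
Qed.

(** Gamma(1 - s) is the Mellin transform of e^(- x) with zero shift and inherits differentiability
    from it. Reflection identifies the derivative with the one that [Cdigamma] uses. *)
Lemma Cdiff_CGamma_reflected (s : C) : Re s < 1 ->
  Cdiff (fun w => CGamma (1 - w)) s (- C_derive CGamma (1 - s))%C.
Proof.
  intros Hs.
  destruct (mellin_analytic (fun x => Cexp (- (1 * x)%R)) 1 1 0 s Rlt_0_1 Hs) as [_ [_ [r [M [a [Ha _]]]]]].
  - intros x _. apply Ccont_exponential.
  - intros x _. apply exponential_bound.
  - apply taylor_at_Cdiff in Ha.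
    assert (H : Cdiff (fun w => CGamma (1 - w)) s (a 1%nat)).
    { apply (Cdiff_ext (mellin (fun x => Cexp (- (1 * x)%R)) 0) _ s _ (1 - Re s)); [lra | | exact Ha].
      intros h Hh. rewrite mellin_exponential; [|lra|].
      - rewrite ln_1, Cmult_0_r, Cmult_0_l, Cexp_0. ring.
      - pose proof (Re_le_Cmod h). rewrite Re_plus. lra. }
    pose proof (Cdiff_C_derive _ _ _ (Cdiff_reflect _ _ _ H)) as E. rewrite E.
    replace (- - a 1%nat)%C with (a 1%nat) by ring. exact H.
Qed.

(** The second identity is the derivative in s of the first. Factoring out Gamma(1 - s) turns its
    derivative into the digamma value, and this is where Gamma must not vanish. With c = 2 pi |n|
    and u = +- i pi / 2 the quantity ln c + u is log(2 pi i n); the factor e^(- u) lowers the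
    exponent from s to s - 1. *)
Lemma mellin_deriv_exponential (c : R) (u s : C) : 0 < c -> Re s < 1 ->
  (Cexp (- u) * mellin (fun x => Cexp (- (c * x)%R)) u s = CGamma (1 - s) * Cexp ((s - 1) * (ln c + u)))%C /\
  (Cexp (- u) * mellin_deriv (fun x => Cexp (- (c * x)%R)) u s
     = CGamma (1 - s) * (Cexp ((s - 1) * (ln c + u)) * ((ln c + u) - Cdigamma (1 - s))))%C.
Proof.
  intros Hc Hs.
  assert (HE : forall w, Re w < 1 -> (Cexp (- u) * mellin (fun x => Cexp (- (c * x)%R)) u w
     = CGamma (1 - w) * Cexp ((w - 1) * (ln c + u)))%C).
  { intros w Hw. rewrite mellin_exponential by assumption.
    replace ((w - 1) * (ln c + u))%C with (- u + (w * u + ln c * (w - 1)))%C by ring.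
    rewrite !Cexp_plus. ring. }
  split; [now apply HE|].
  destruct (mellin_analytic (fun x => Cexp (- (c * x)%R)) 1 c u s Hc Hs) as [_ [_ [r [M [a [Ha Ea]]]]]].
  - intros x _. apply Ccont_exponential.
  - intros x _. apply exponential_bound.
  - pose proof (taylor_at_Cdiff _ _ _ _ _ (taylor_at_scal (Cexp (- u)) _ _ _ _ _ Ha)) as H1.
    cbv beta in H1. rewrite Ea in H1.
    pose proof (Cdiff_mult _ _ _ _ _ (Cdiff_CGamma_reflected s Hs)
      (Cdiff_Cexp (Cexp (- (ln c + u))) (ln c + u)%C s)) as H2.
    assert (EP : forall w, (Cexp (- (ln c + u)) * Cexp (w * (ln c + u)) = Cexp ((w - 1) * (ln c + u)))%C).
    { intros w. rewrite <- Cexp_plus. f_equal. ring. }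
    assert (H3 : Cdiff (fun w => Cexp (- u) * mellin (fun x => Cexp (- (c * x)%R)) u w)%C s
      (- C_derive CGamma (1 - s) * Cexp ((s - 1) * (ln c + u))
       + CGamma (1 - s) * ((ln c + u) * Cexp ((s - 1) * (ln c + u))))%C).
    { rewrite <- EP. eapply (Cdiff_ext _ _ s _ (1 - Re s)); [lra | | exact H2].
      intros h Hh. cbv beta. rewrite EP. symmetry. apply HE.
      pose proof (Re_le_Cmod h). rewrite Re_plus. lra. }
    rewrite (Cdiff_unique _ _ _ _ H1 H3). unfold Cdigamma. field.
    apply CGamma_neq_0. cbn. unfold Re in *. lra.
Qed.

Definition half_pi_i (b : bool) : C := if b then (0, PI / 2) else (0, - (PI / 2)).

(* The Hurwitz zeta function on [Re s < 1], as the sum over [n >= 1] and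
   [n <= -1] of [e^(2 pi i n a) Gamma (1 - s) (2 pi i n)^(s - 1)], each
   [Gamma]-factor being written as [int x^(-s) e^(-2 pi |n| x)]. *)
Definition fourier_zeta (s : C) (a : R) : C :=
  (Cexp (- half_pi_i true) * mellin (geometric_tail 0 a) (half_pi_i true) s
   + Cexp (- half_pi_i false) * mellin (geometric_tail 0 (1 - a)) (half_pi_i false) s)%C.

Definition fourier_zeta_deriv (s : C) (a : R) : C :=
  (Cexp (- half_pi_i true) * mellin_deriv (geometric_tail 0 a) (half_pi_i true) s
   + Cexp (- half_pi_i false) * mellin_deriv (geometric_tail 0 (1 - a)) (half_pi_i false) s)%C.

(** The case n = 0 is set apart because [Clog] takes a junk value at 0. *)
Definition zeta_coef (s : C) (n : Z) : C :=
  if Z.eqb n 0 then 0%C else (CGamma (1 - s) * Cpower (2 * PI * Ci * IZR n) (s - 1))%C.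

Definition zeta_deriv_coef (s : C) (n : Z) : C :=
  if Z.eqb n 0 then 0%C else
  (CGamma (1 - s) * (Cpower (2 * PI * Ci * IZR n) (s - 1)
     * (Clog (2 * PI * Ci * IZR n) - Cdigamma (1 - s))))%C.

(** Here the constant may depend on a: the bound serves convergence and analyticity at fixed a,
    while estimates integrable in a come from [geometric_tail_bound]. *)
Lemma geometric_tail_0_bound (a : R) : 0 < a < 1 ->
  exists B, forall x, 0 < x -> Cmod (geometric_tail 0 a x) <= B * exp (- (1) * x).
Proof.
  intros Ha. exists (/ sin (PI * a)). intros x Hx. pose proof PI_bounds as HP.
  assert (Hs : 0 < sin (PI * a)) by (apply sin_gt_0; nra).
  destruct (Cmod_one_minus_nome a x Ha Hx) as [H _].
  unfold geometric_tail. rewrite Cmod_div, Cmod_pow, Cmod_nome by now apply one_minus_nome_neq_0.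
  cbn [pow]. rewrite Rmult_1_r. unfold Rdiv. rewrite Rmult_comm.
  apply Rmult_le_compat; [apply Rlt_le, Rinv_0_lt_compat; lra | apply Rlt_le, exp_pos | |].
  - apply Rinv_le_contravar; lra.
  - apply exp_le_compat. nra.
Qed.

Lemma fourier_zeta_taylor (s : C) (a : R) : Re s < 1 -> 0 < a < 1 ->
  exists r M c, taylor_at (fun w => fourier_zeta w a) s r M c /\ c 1%nat = fourier_zeta_deriv s a.
Proof.
  intros Hs Ha.
  assert (H : forall u b, 0 < b < 1 -> exists r M c, taylor_at (mellin (geometric_tail 0 b) u) s r M c /\
     c 1%nat = mellin_deriv (geometric_tail 0 b) u s).
  { intros u b Hb. destruct (geometric_tail_0_bound b Hb) as [B HB].
    destruct (mellin_analytic (geometric_tail 0 b) B 1 u s Rlt_0_1 Hs) as [_ [_ H]]; [|exact HB|exact H].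
    intros x Hx. now apply Ccont_geometric_tail. }
  destruct (H (half_pi_i true) a Ha) as [r1 [M1 [c1 [H1 E1]]]].
  destruct (H (half_pi_i false) (1 - a) ltac:(lra)) as [r2 [M2 [c2 [H2 E2]]]].
  assert (Hr : 0 < Rmin r1 r2) by (apply Rmin_pos; [apply H1 | apply H2]).
  apply (taylor_at_shrink _ _ _ (Rmin r1 r2)) in H1; [|split; [exact Hr | apply Rmin_l]].
  apply (taylor_at_shrink _ _ _ (Rmin r1 r2)) in H2; [|split; [exact Hr | apply Rmin_r]].
  pose proof (taylor_at_plus _ _ _ _ _ _ _ _
    (taylor_at_scal (Cexp (- half_pi_i true)) _ _ _ _ _ H1)
    (taylor_at_scal (Cexp (- half_pi_i false)) _ _ _ _ _ H2)) as H3.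
  do 3 eexists. split; [exact H3|]. cbv beta. rewrite E1, E2. reflexivity.
Qed.

(** Negative frequencies at a are positive frequencies at 1 - a, which is why the second half of
    [fourier_zeta] is evaluated at 1 - a. *)
Lemma character_reflect (k : nat) (a : R) :
  character (Z.of_nat k) (1 - a) = character (- Z.of_nat k) a.
Proof.
  assert (E : (character (Z.of_nat k) (1 - a) * character (Z.of_nat k) a)%C = 1%C).
  { rewrite <- (character_INR (Z.of_nat k) 1). unfold character. rewrite <- Cexp_plus. f_equal.
    simpl INR. rewrite RtoC_minus. ring. }
  assert (E' : (character (Z.of_nat k) a * character (- Z.of_nat k) a)%C = 1%C).
  { rewrite <- character_plus, Z.add_opp_diag_r. apply character_0. }
  rewrite <- (Cmult_1_r (character (Z.of_nat k) (1 - a))), <- E', Cmult_assoc, E. ring.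
Qed.

Lemma unit_weight_reflect (d a : R) : unit_weight d (1 - a) = unit_weight d a.
Proof. unfold unit_weight. replace (1 - (1 - a)) with a by ring. ring. Qed.

Lemma fourier_zeta_approx (s : C) : Re s < 1 ->
  exists K, forall (a : R) (N : nat), 0 < a < 1 -> (1 <= N)%nat ->
    Cmod (fourier_zeta s a - symmetric_sum (fun n => zeta_coef s n * character n a) N)%C
      <= K * exp (- tail_exponent (Re s) * ln (INR N)) * unit_weight (tail_exponent (Re s)) a /\
    Cmod (fourier_zeta_deriv s a - symmetric_sum (fun n => zeta_deriv_coef s n * character n a) N)%C
      <= K * exp (- tail_exponent (Re s) * ln (INR N)) * unit_weight (tail_exponent (Re s)) a.
Proof.
  intros Hs.
  (* One statement in u serves both halves: the positive frequencies with u = i pi / 2 at a, the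
     negative ones with u = - i pi / 2 at 1 - a. The weight is symmetric under this reflection. *)
  assert (Hhalf : forall u, exists K, forall a N, 0 < a < 1 -> (1 <= N)%nat ->
    Cmod (Cexp (- u) * mellin (geometric_tail 0 a) u s
      - Csum (fun k => CGamma (1 - s) * Cexp ((s - 1) * (ln (2 * PI * INR (S k)) + u))
          * character (Z.of_nat (S k)) a) N)%C
      <= K * exp (- tail_exponent (Re s) * ln (INR N)) * unit_weight (tail_exponent (Re s)) a /\
    Cmod (Cexp (- u) * mellin_deriv (geometric_tail 0 a) u s
      - Csum (fun k => CGamma (1 - s) * (Cexp ((s - 1) * (ln (2 * PI * INR (S k)) + u))
          * (ln (2 * PI * INR (S k)) + u - Cdigamma (1 - s)))
          * character (Z.of_nat (S k)) a) N)%C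
      <= K * exp (- tail_exponent (Re s) * ln (INR N)) * unit_weight (tail_exponent (Re s)) a).
  { intros u. destruct (mellin_kernel_bound u s Hs) as [B HB].
    destruct (geometric_kernel_series (fun x => Cexp (s * (u - ln x))) B (Re s) Hs) as [K1 HK1].
    { intros x Hx. now apply Ccont_mellin_kernel. }
    { intros x Hx. now apply HB. }
    destruct (geometric_kernel_series (fun x => Cexp (s * (u - ln x)) * (u - ln x))%C B (Re s) Hs) as [K2 HK2].
    { intros x Hx. apply Ccont_mult; [now apply Ccont_mellin_kernel|].
      apply Ccont_minus; [apply Ccont_const | now apply Ccont_ln]. }
    { intros x Hx. now apply HB. }
    exists (Cmod (Cexp (- u)) * Rmax K1 K2). intros a N Ha HN.
    destruct (geometric_tail_0_bound a Ha) as [B' HB'].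
    destruct (mellin_analytic (geometric_tail 0 a) B' 1 u s Rlt_0_1 Hs) as [I1 [I2 _]].
    { intros x Hx. now apply Ccont_geometric_tail. }
    { exact HB'. }
    assert (Hc : forall k, 0 < 2 * PI * INR (S k)).
    { intros k. pose proof PI_RGT_0. apply Rmult_lt_0_compat; [lra | apply lt_0_INR; lia]. }
    assert (J : forall k, Cint (fun x => Cexp (- (2 * PI * INR (S k) * x)%R) * Cexp (s * (u - ln x)))%C
                 (mellin (fun x => Cexp (- (2 * PI * INR (S k) * x)%R)) u s) /\
       Cint (fun x => Cexp (- (2 * PI * INR (S k) * x)%R) * Cexp (s * (u - ln x)) * (u - ln x))%C
                 (mellin_deriv (fun x => Cexp (- (2 * PI * INR (S k) * x)%R)) u s)).
    { intros k. destruct (mellin_analytic (fun x => Cexp (- (2 * PI * INR (S k) * x)%R)) 1 _ u s (Hc k) Hs) as [J1 [J2 _]].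
      - intros x _. apply (Ccont_exponential (2 * PI * INR (S k))).
      - intros x _. apply (exponential_bound (2 * PI * INR (S k))).
      - now split. }
    assert (HW : 0 <= exp (- tail_exponent (Re s) * ln (INR N)) * unit_weight (tail_exponent (Re s)) a).
    { apply Rmult_le_pos; [apply Rlt_le, exp_pos|].
      destruct (tail_exponent_bounds _ Hs) as [? _].
      pose proof (unit_weight_ge_1 (tail_exponent (Re s)) a ltac:(lra) Ha). lra. }
    assert (Hfin : forall X Ki, Ki <= Rmax K1 K2 ->
       Cmod X <= Ki * exp (- tail_exponent (Re s) * ln (INR N)) * unit_weight (tail_exponent (Re s)) a ->
       Cmod (Cexp (- u) * X) <= Cmod (Cexp (- u)) * Rmax K1 K2 * exp (- tail_exponent (Re s) * ln (INR N))
          * unit_weight (tail_exponent (Re s)) a).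
    { intros X Ki HKi HX. rewrite Cmod_mult, !Rmult_assoc. apply Rmult_le_compat_l; [apply Cmod_ge_0|].
      eapply Rle_trans; [exact HX|]. rewrite Rmult_assoc. apply Rmult_le_compat_r; assumption. }
    split.
    - replace (Cexp (- u) * mellin (geometric_tail 0 a) u s
        - Csum (fun k => CGamma (1 - s) * Cexp ((s - 1) * (ln (2 * PI * INR (S k)) + u))
          * character (Z.of_nat (S k)) a) N)%C
        with (Cexp (- u) * (mellin (geometric_tail 0 a) u s
          - Csum (fun k => mellin (fun x => Cexp (- (2 * PI * INR (S k) * x)%R)) u s * character (Z.of_nat (S k)) a) N))%C.
      + apply (Hfin _ K1); [apply Rmax_l|]. apply HK1; [exact Ha | exact HN | |].
        * eapply (CInt_ext is_positive); [exact interval_positive | | exact I1]. intros; cbv beta; ring.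
        * intros k. eapply (CInt_ext is_positive); [exact interval_positive | | exact (proj1 (J k))].
          intros; cbv beta; ring.
      + unfold Cminus. rewrite Cmult_plus_distr_l. f_equal.
        replace (Cexp (- u) * - Csum (fun k => mellin (fun x => Cexp (- (2 * PI * INR (S k) * x)%R)) u s * character (Z.of_nat (S k)) a) N)%C
          with (- (Cexp (- u) * Csum (fun k => mellin (fun x => Cexp (- (2 * PI * INR (S k) * x)%R)) u s * character (Z.of_nat (S k)) a) N))%C by ring.
        f_equal. rewrite <- Csum_scal. apply Csum_ext. intros k _.
        destruct (mellin_deriv_exponential _ u s (Hc k) Hs) as [E _].
        rewrite Cmult_assoc, E. reflexivity.
    - replace (Cexp (- u) * mellin_deriv (geometric_tail 0 a) u s
        - Csum (fun k => CGamma (1 - s) * (Cexp ((s - 1) * (ln (2 * PI * INR (S k)) + u))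
          * (ln (2 * PI * INR (S k)) + u - Cdigamma (1 - s)))
          * character (Z.of_nat (S k)) a) N)%C
        with (Cexp (- u) * (mellin_deriv (geometric_tail 0 a) u s
          - Csum (fun k => mellin_deriv (fun x => Cexp (- (2 * PI * INR (S k) * x)%R)) u s * character (Z.of_nat (S k)) a) N))%C.
      + apply (Hfin _ K2); [apply Rmax_r|]. apply HK2; [exact Ha | exact HN | |].
        * eapply (CInt_ext is_positive); [exact interval_positive | | exact I2]. intros; cbv beta; ring.
        * intros k. eapply (CInt_ext is_positive); [exact interval_positive | | exact (proj2 (J k))].
          intros; cbv beta; ring.
      + unfold Cminus. rewrite Cmult_plus_distr_l. f_equal.
        replace (Cexp (- u) * - Csum (fun k => mellin_deriv (fun x => Cexp (- (2 * PI * INR (S k) * x)%R)) u s * character (Z.of_nat (S k)) a) N)%C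
          with (- (Cexp (- u) * Csum (fun k => mellin_deriv (fun x => Cexp (- (2 * PI * INR (S k) * x)%R)) u s * character (Z.of_nat (S k)) a) N))%C by ring.
        f_equal. rewrite <- Csum_scal. apply Csum_ext. intros k _.
        destruct (mellin_deriv_exponential _ u s (Hc k) Hs) as [_ E].
        rewrite Cmult_assoc, E. reflexivity. }
  destruct (Hhalf (half_pi_i true)) as [K1 HK1]. destruct (Hhalf (half_pi_i false)) as [K2 HK2].
  exists (K1 + K2). intros a N Ha HN.
  destruct (HK1 a N Ha HN) as [A1 A2]. destruct (HK2 (1 - a) N ltac:(lra) HN) as [B1 B2].
  rewrite unit_weight_reflect in B1, B2.
  assert (Hsplit : forall c : Z -> C, symmetric_sum (fun n => c n * character n a)%C N =
     (Csum (fun k => c (Z.of_nat (S k)) * character (Z.of_nat (S k)) a) N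
      + Csum (fun k => c (- Z.of_nat (S k))%Z * character (Z.of_nat (S k)) (1 - a)) N)%C).
  { intros c. unfold symmetric_sum. rewrite Csum_plus. f_equal. apply Csum_ext. intros k _.
    now rewrite character_reflect. }
  assert (Hadd : forall X Y X' Y', Cmod (X - X') <= K1 * exp (- tail_exponent (Re s) * ln (INR N)) * unit_weight (tail_exponent (Re s)) a ->
    Cmod (Y - Y') <= K2 * exp (- tail_exponent (Re s) * ln (INR N)) * unit_weight (tail_exponent (Re s)) a ->
    Cmod (X + Y - (X' + Y')) <= (K1 + K2) * exp (- tail_exponent (Re s) * ln (INR N)) * unit_weight (tail_exponent (Re s)) a).
  { intros X Y X' Y' HX HY. replace (X + Y - (X' + Y'))%C with ((X - X') + (Y - Y'))%C by ring.
    eapply Rle_trans; [apply Cmod_triangle|]. lra. }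
  split; rewrite Hsplit; apply Hadd.
  - eapply Rle_trans; [|exact A1]. apply Req_le. do 2 f_equal. apply Csum_ext. intros k _.
    unfold zeta_coef, Cpower. destruct (Clog_imaginary k) as [E _]. rewrite E. reflexivity.
  - eapply Rle_trans; [|exact B1]. apply Req_le. do 2 f_equal. apply Csum_ext. intros k _.
    unfold zeta_coef, Cpower. destruct (Clog_imaginary k) as [_ E]. rewrite E. reflexivity.
  - eapply Rle_trans; [|exact A2]. apply Req_le. do 2 f_equal. apply Csum_ext. intros k _.
    unfold zeta_deriv_coef, Cpower. destruct (Clog_imaginary k) as [E _]. rewrite E. reflexivity.
  - eapply Rle_trans; [|exact B2]. apply Req_le. do 2 f_equal. apply Csum_ext. intros k _.
    unfold zeta_deriv_coef, Cpower. destruct (Clog_imaginary k) as [_ E]. rewrite E. reflexivity.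
Qed.

Lemma is_lim_seq_INR_power (d : R) : 0 < d -> is_lim_seq (fun N => exp (- d * ln (INR N))) 0.
Proof.
  intros Hd.
  apply (is_lim_seq_ext (fun N => / exp (d * ln (INR N)))).
  - intros N. rewrite <- exp_Ropp. f_equal. ring.
  - apply (filterlim_comp _ _ _ (fun N => exp (d * ln (INR N))) Rinv _ (Rbar_locally p_infty)).
    + apply (filterlim_comp _ _ _ INR (fun x => exp (d * ln x)) _ (Rbar_locally p_infty)).
      * apply is_lim_seq_INR.
      * now apply filterlim_exp_ln_infty.
    + apply (filterlim_Rbar_inv p_infty). discriminate.
Qed.

(** * Continuation by Euler-Maclaurin summation *)

Notation Pint := (CInt (at_point 0) (at_point 1)).

Lemma interval_closed : interval_between (fun x => 0 <= x <= 1) (at_point 0) (at_point 1).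
Proof.
  constructor.
  - apply at_point_filter.
  - apply at_point_filter.
  - intros; lra.
  - apply (Filter_prod _ _ _ (fun x => x = 0) (fun x => x = 1)); [reflexivity | reflexivity |].
    intros x y -> ->. simpl. lra.
Qed.

Lemma filterlim_at_point (f : R -> R) (a : R) : filterlim f (at_point a) (locally (f a)).
Proof. intros Q HQ. unfold filtermap, at_point. apply locally_singleton. exact HQ. Qed.

(* [(s - 1) s] times this is [(s - 1) y^(-s) + (y + 1)^(1 - s) - y^(1 - s)]:
   the error of the Euler-Maclaurin step on [[y, y + 1]]. *)
Definition euler_step (y : R) (s : C) : C :=
  RInt_gen (V := C_R_CompleteNormedModule)
    (fun v => RtoC (1 - v) * Cexp ((s + 1) * - RtoC (ln (y + v))))%C (at_point 0) (at_point 1).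

Lemma ln_shift_Ccont (y v : R) : 0 < y + v -> Ccont (fun v => - RtoC (ln (y + v)))%C v.
Proof.
  intros H. apply (Ccont_ext (fun v => RtoC (- ln (y + v)))); [intros; apply RtoC_opp|].
  apply Ccont_RtoC. apply (ex_derive_continuous (V := R_NormedModule)). auto_derive. lra.
Qed.

Lemma power_shift_primitive (d y v : R) : d <> 0 -> 0 < y + v ->
  is_derive (fun v => - (exp (- d * ln (y + v)) / d)) v (exp ((- d - 1) * ln (y + v))).
Proof.
  intros Hd H. auto_derive; [lra|].
  replace ((- d - 1) * ln (y + v)) with (- d * ln (y + v) + - ln (y + v)) by ring.
  rewrite exp_plus, exp_Ropp, exp_ln by exact H. field. lra.
Qed.

Lemma continuous_power_shift (d y v : R) : 0 < y + v ->
  continuous (fun v => exp ((- d - 1) * ln (y + v))) v.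
Proof.
  intros H. apply (ex_derive_continuous (V := R_NormedModule)). auto_derive. lra.
Qed.

(** The lower bound alpha on y gives |ln (y + v)| <= ln (y + v) + 2 |ln alpha|, so the weight e^((Re
    s / 2) |ln (y + v)|) costs half of the decay and a constant that does not depend on y. The bound
    T y - T (y + 1) then telescopes over y = n + alpha. *)
Lemma euler_step_taylor (alpha y : R) (s : C) : 0 < alpha <= y -> 0 < Re s ->
  let K := exp (Re s * Rabs (ln alpha)) / (Re s / 2) in
  let T := fun y => K * exp (- (Re s / 2) * ln y) in
  Pint (fun v => RtoC (1 - v) * Cexp ((s + 1) * - RtoC (ln (y + v))))%C (euler_step y s) /\
  exists a, taylor_at (euler_step y) s (Re s / 4) (T y - T (y + 1)) a.
Proof.
  intros Hy Hs K T.
  set (sigma := Re s) in *. set (d := sigma / 2) in *. assert (Hd : 0 < d) by (unfold d; lra).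
  set (C0 := exp (sigma * Rabs (ln alpha))).
  assert (HC0 : 0 < C0) by apply exp_pos.
  destruct (taylor_at_exp_integral (fun x => 0 <= x <= 1) (at_point 0) (at_point 1)
    (fun v => RtoC (1 - v)) (fun v => - RtoC (ln (y + v)))%C (s + 1) (sigma / 4)
    (fun v => C0 * exp ((- d - 1) * ln (y + v)))
    (fun v => C0 * - (exp (- d * ln (y + v)) / d))
    (C0 * - (exp (- d * ln (y + 0)) / d)) (C0 * - (exp (- d * ln (y + 1)) / d))) as [a [_ Ha2]].
  - exact interval_closed.
  - lra.
  - intros v Hv. apply Ccont_RtoC. apply (ex_derive_continuous (V := R_NormedModule)). auto_derive; trivial.
  - intros v Hv. apply ln_shift_Ccont. lra.
  - intros v Hv. apply (continuous_mult (K := R_AbsRing) (fun _ => C0)); [apply continuous_const|].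
    apply continuous_power_shift. lra.
  - intros v Hv. apply (is_derive_scal (fun v => - (exp (- d * ln (y + v)) / d))).
    apply power_shift_primitive; lra.
  - intros v Hv. rewrite Cmod_R, Cmod_Cexp, Cmod_opp, Cmod_R, (Rabs_right (1 - v)) by lra.
    replace (Re ((s + 1) * - RtoC (ln (y + v)))%C) with (- (sigma + 1) * ln (y + v))
      by (unfold sigma; cbn; unfold Re, Im; cbn; ring).
    apply Rle_trans with (1 * exp (- (sigma + 1) * ln (y + v)) * exp (2 * (sigma / 4) * Rabs (ln (y + v)))).
    + apply Rmult_le_compat_r; [apply Rlt_le, exp_pos|].
      apply Rmult_le_compat_r; [apply Rlt_le, exp_pos | lra].
    + unfold C0. rewrite Rmult_1_l, <- !exp_plus. apply exp_le_compat.
      assert (Hl : ln alpha <= ln (y + v)) by (apply ln_le; lra).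
      pose proof (Rle_abs (- ln alpha)) as H1. rewrite Rabs_Ropp in H1.
      pose proof (Rabs_pos (ln alpha)).
      assert (Rabs (ln (y + v)) <= ln (y + v) + 2 * Rabs (ln alpha)) by (apply Rabs_le; lra).
      unfold d. nra.
  - exact (filterlim_at_point (fun v => C0 * - (exp (- d * ln (y + v)) / d)) 0).
  - exact (filterlim_at_point (fun v => C0 * - (exp (- d * ln (y + v)) / d)) 1).
  - assert (HI : forall h, Cmod h < sigma / 4 ->
      Pint (fun v => RtoC (1 - v) * Cexp ((s + h + 1) * - RtoC (ln (y + v))))%C (euler_step y (s + h))).
    { intros h Hh. destruct (Ha2 h Hh) as [[l Hl] _].
      assert (Hl' : Pint (fun v => RtoC (1 - v) * Cexp ((s + h + 1) * - RtoC (ln (y + v))))%C l).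
      { eapply (CInt_ext (fun x => 0 <= x <= 1)); [exact interval_closed | | exact Hl].
        intros v _. cbv beta. do 3 f_equal. ring. }
      unfold euler_step. rewrite (CInt_RInt_gen _ _ _ _ (at_point_filter 0) (at_point_filter 1) Hl'). exact Hl'. }
    split.
    { specialize (HI 0%C). rewrite Cmod_0, Cplus_0_r in HI. apply HI. lra. }
    exists a. split; [lra|]. intros h N Hh. destruct (Ha2 h Hh) as [_ H].
    eapply Rle_trans; [apply H|].
    + eapply (CInt_ext (fun x => 0 <= x <= 1)); [exact interval_closed | | exact (HI h Hh)].
      intros v _. cbv beta. do 3 f_equal. ring.
    + apply Req_le. f_equal. unfold T, K, C0. fold d. rewrite Rplus_0_r. field. lra.
Qed.

Lemma euler_step_bound (y : R) (s : C) : 0 < y -> 0 < Re s ->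
  Cmod (euler_step y s) <= exp (- Re s * ln y) / Re s - exp (- Re s * ln (y + 1)) / Re s.
Proof.
  intros Hy Hs. destruct (euler_step_taylor y y s ltac:(lra) Hs) as [HI _]. cbv zeta in HI.
  set (sigma := Re s) in *.
  replace (exp (- sigma * ln y) / sigma - exp (- sigma * ln (y + 1)) / sigma)
    with (- (exp (- sigma * ln (y + 1)) / sigma) - - (exp (- sigma * ln (y + 0)) / sigma))
    by (rewrite Rplus_0_r; ring).
  apply (CInt_bound (fun x => 0 <= x <= 1) (at_point 0) (at_point 1)
    (fun v => RtoC (1 - v) * Cexp ((s + 1) * - RtoC (ln (y + v))))%C
    (fun v => exp ((- sigma - 1) * ln (y + v))) (fun v => - (exp (- sigma * ln (y + v)) / sigma))).
  - exact interval_closed.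
  - intros v Hv. apply Ccont_mult.
    + apply Ccont_RtoC. apply (ex_derive_continuous (V := R_NormedModule)). auto_derive; trivial.
    + apply Ccont_Cexp, Ccont_mult; [apply Ccont_const | apply ln_shift_Ccont; lra].
  - intros v Hv. apply continuous_power_shift. lra.
  - intros v Hv. apply power_shift_primitive; lra.
  - intros v Hv. rewrite Cmod_mult, Cmod_R, Cmod_Cexp, Rabs_right by lra.
    replace (Re ((s + 1) * - RtoC (ln (y + v)))%C) with ((- sigma - 1) * ln (y + v))
      by (unfold sigma; cbn; unfold Re, Im; cbn; ring).
    pose proof (exp_pos ((- sigma - 1) * ln (y + v))). nra.
  - exact (filterlim_at_point (fun v => - (exp (- sigma * ln (y + v)) / sigma)) 0).
  - exact (filterlim_at_point (fun v => - (exp (- sigma * ln (y + v)) / sigma)) 1).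
  - exact HI.
Qed.

(** Equal to [Cpower y s] for y > 0, but expressed by the real logarithm, which can be
    differentiated in y. *)
Definition real_power (y : R) (s : C) : C := Cexp (s * ln y).

Lemma is_Cderive_real_power (y v : R) (s : C) : 0 < y + v ->
  is_Cderive (fun v => real_power (y + v) s) v (s * real_power (y + v) (s - 1))%C.
Proof.
  intros H. unfold real_power.
  assert (Hl : is_Cderive (fun v => RtoC (ln (y + v))) v (RtoC (/ (y + v)))).
  { apply is_Cderive_RtoC. auto_derive; [lra | field; lra]. }
  eapply is_Cderive_ext; [reflexivity | | exact (is_Cderive_Cexp _ _ _ (is_Cderive_scal s _ _ _ Hl))].
  cbv beta. replace ((s - 1) * ln (y + v))%C with (s * ln (y + v) + RtoC (- ln (y + v)))%C
    by (rewrite RtoC_opp; ring).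
  rewrite Cexp_plus, Cexp_RtoC, exp_Ropp, exp_ln by exact H. ring.
Qed.

(** One integration by parts, with the primitive F of (s - 1) s times the integrand. Keeping both
    factors on the left avoids all denominators, so that either side is analytic for Re s > 0. *)
Lemma euler_step_value (y : R) (s : C) : 0 < y -> 0 < Re s ->
  ((s - 1) * (s * euler_step y s)
    = (s - 1) * real_power y (- s) + real_power (y + 1) (1 - s) - real_power y (1 - s))%C.
Proof.
  intros Hy Hs. destruct (euler_step_taylor y y s ltac:(lra) Hs) as [HI _]. cbv zeta in HI.
  set (F := fun v : R => (- (s - 1) * (RtoC (1 - v) * real_power (y + v) (- s)) + real_power (y + v) (1 - s))%C).
  set (f := fun v : R => ((s - 1) * s * (RtoC (1 - v) * Cexp ((s + 1) * - RtoC (ln (y + v)))))%C).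
  assert (HF : Pint f (F 1 - F 0)%C).
  { assert (HD : forall v, 0 <= v <= 1 -> is_Cderive F v (f v)).
    { intros v Hv.
      assert (H1 : is_Cderive (fun v => RtoC (1 - v)) v (RtoC (Ropp 1))).
      { apply is_Cderive_RtoC. auto_derive; [trivial | ring]. }
      pose proof (is_Cderive_real_power y v (- s) ltac:(lra)) as H2.
      pose proof (is_Cderive_real_power y v (1 - s) ltac:(lra)) as H3.
      eapply is_Cderive_ext; [reflexivity | | exact (is_Cderive_plus _ _ _ _ _
        (is_Cderive_scal (- (s - 1))%C _ _ _ (is_Cderive_mult _ _ _ _ _ H1 H2)) H3)].
      cbv beta. unfold f, real_power.
      replace ((1 - s - 1) * ln (y + v))%C with (- s * ln (y + v))%C by ring.
      replace ((s + 1) * - RtoC (ln (y + v)))%C with ((- s - 1) * ln (y + v))%C by ring.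
      rewrite RtoC_opp. ring. }
    apply (CInt_antiderivative (fun x => 0 <= x <= 1) (at_point 0) (at_point 1) F f).
    - exact interval_closed.
    - exact HD.
    - intros v Hv. apply Ccont_mult; [apply Ccont_const|]. apply Ccont_mult.
      + apply Ccont_RtoC. apply (ex_derive_continuous (V := R_NormedModule)). auto_derive; trivial.
      + apply Ccont_Cexp, Ccont_mult; [apply Ccont_const | apply ln_shift_Ccont; lra].
    - pose proof (filterlim_at_point (fun x => Cmod (F x - F 0)) 0) as H.
      cbv beta in H. replace (F 0 - F 0)%C with (RtoC 0) in H by ring. rewrite Cmod_0 in H. exact H.
    - pose proof (filterlim_at_point (fun x => Cmod (F x - F 1)) 1) as H.
      cbv beta in H. replace (F 1 - F 1)%C with (RtoC 0) in H by ring. rewrite Cmod_0 in H. exact H. }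
  pose proof (CInt_scal _ _ ((s - 1) * s)%C _ _ _ _ HI) as HI'.
  rewrite Cmult_assoc.
  rewrite (CInt_unique _ _ _ _ _ (at_point_filter 0) (at_point_filter 1) HI' HF).
  unfold F. rewrite Rplus_0_r, Rminus_diag, Rminus_0_r. ring.
Qed.

(** * Summation of the Euler-Maclaurin steps *)

Lemma is_lim_seq_power_shift (d alpha : R) : 0 < d -> 0 < alpha ->
  is_lim_seq (fun n => exp (- d * ln (INR n + alpha))) 0.
Proof.
  intros Hd Ha. apply is_lim_seq_incr_1.
  apply (is_lim_seq_le_0 _ (fun n => exp (- d * ln (INR (S n))))).
  - intros n. split; [apply Rlt_le, exp_pos|]. apply exp_le_compat.
    assert (0 < INR (S n)) by (apply lt_0_INR; lia).
    assert (ln (INR (S n)) <= ln (INR (S n) + alpha)) by (apply ln_le; lra). nra.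
  - exact (proj1 (is_lim_seq_incr_1 (fun n => exp (- d * ln (INR n))) 0) (is_lim_seq_INR_power d Hd)).
Qed.

Lemma euler_sum_exists (alpha : R) (s : C) : 0 < alpha -> 0 < Re s ->
  exists l, Clim (Csum (fun n => euler_step (INR n + alpha) s)) l /\
    forall N, Cmod (l - Csum (fun n => euler_step (INR n + alpha) s) N)
                <= exp (- Re s * ln (INR N + alpha)) / Re s.
Proof.
  intros Ha Hs.
  apply (Clim_telescope _ (fun N => exp (- Re s * ln (INR N + alpha)) / Re s)).
  - intros n. pose proof (pos_INR n).
    eapply Rle_trans; [apply euler_step_bound; lra|].
    rewrite S_INR. replace (INR n + 1 + alpha) with (INR n + alpha + 1) by ring. lra.
  - replace 0 with (0 * / Re s) by ring. apply (is_lim_seq_scal_r _ (/ Re s) 0).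
    now apply is_lim_seq_power_shift.
Qed.

(** The sum of the series as a total function, meaningful for alpha > 0 and Re s > 0. *)
Definition euler_sum (alpha : R) (s : C) : C :=
  epsilon (inhabits (RtoC 0)) (fun l : C => Clim (Csum (fun n => euler_step (INR n + alpha) s)) l).

Lemma euler_sum_spec (alpha : R) (s : C) : 0 < alpha -> 0 < Re s ->
  Clim (Csum (fun n => euler_step (INR n + alpha) s)) (euler_sum alpha s) /\
  forall N, Cmod (euler_sum alpha s - Csum (fun n => euler_step (INR n + alpha) s) N)
                <= exp (- Re s * ln (INR N + alpha)) / Re s.
Proof.
  intros Ha Hs. destruct (euler_sum_exists alpha s Ha Hs) as [l [H1 H2]].
  assert (H : Clim (Csum (fun n => euler_step (INR n + alpha) s)) (euler_sum alpha s)).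
  { unfold euler_sum. apply epsilon_spec. now exists l. }
  split; [exact H|].
  now rewrite (Clim_unique _ _ _ H H1).
Qed.

Lemma euler_sum_taylor (alpha : R) (s : C) : 0 < alpha -> 0 < Re s ->
  exists r M a, taylor_at (euler_sum alpha) s r M a.
Proof.
  intros Ha Hs.
  set (K := exp (Re s * Rabs (ln alpha)) / (Re s / 2)).
  set (T := fun n => K * exp (- (Re s / 2) * ln (INR n + alpha))).
  assert (Hex : forall n, exists a, taylor_at (euler_step (INR n + alpha)) s (Re s / 4) (T n - T (S n)) a).
  { intros n. pose proof (pos_INR n).
    destruct (euler_step_taylor alpha (INR n + alpha) s ltac:(lra) Hs) as [_ [a Ha']]. exists a.
    cbv zeta in Ha'. unfold T. rewrite S_INR.
    replace (INR n + 1 + alpha) with (INR n + alpha + 1) by ring. exact Ha'. }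
  pose (a := fun k => proj1_sig (constructive_indefinite_description _ (Hex k))).
  destruct (taylor_at_series (fun n => euler_step (INR n + alpha)) (euler_sum alpha) s (Re s / 4) T a) as [b Hb].
  - intros n. exact (proj2_sig (constructive_indefinite_description _ (Hex n))).
  - replace 0 with (K * 0) by ring. apply (is_lim_seq_scal_l _ K 0).
    apply is_lim_seq_power_shift; lra.
  - intros h Hh. apply euler_sum_spec; [exact Ha|].
    pose proof (Re_le_Cmod (- h)) as H. rewrite Cmod_opp in H. rewrite Re_plus.
    change (Re (- h)%C) with (- Re h) in H. lra.
  - now exists (Re s / 4), (T 0%nat), b.
Qed.

Lemma euler_partial_sum (alpha : R) (s : C) (N : nat) : 0 < alpha -> 0 < Re s ->
  ((s - 1) * (s * Csum (fun n => euler_step (INR n + alpha) s) N)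
   = (s - 1) * Csum (fun n => real_power (INR n + alpha) (- s)) N
     + real_power (INR N + alpha) (1 - s) - real_power alpha (1 - s))%C.
Proof.
  intros Ha Hs. induction N as [|N IH]; cbn [Csum].
  - simpl INR. rewrite Rplus_0_l. ring.
  - pose proof (pos_INR N).
    pose proof (euler_step_value (INR N + alpha) s ltac:(lra) Hs) as E.
    rewrite S_INR. replace (INR N + 1 + alpha) with (INR N + alpha + 1) by ring.
    rewrite !Cmult_plus_distr_l, IH, E. ring.
Qed.

Lemma Cmod_real_power (y : R) (s : C) : Cmod (real_power y s) = exp (Re s * ln y).
Proof. unfold real_power. rewrite Cmod_Cexp, Re_mult_RtoC. reflexivity. Qed.

(** For Re z > 1 the identity is the limit of [euler_partial_sum], where (N + alpha)^(1 - z) tends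
    to 0. It is carried to the real point s by the identity theorem. *)
Lemma hurwitz_continuation (zeta : C -> R -> C) (alpha s : R) :
  is_hurwitz_zeta zeta -> 0 < alpha -> 0 < s < 1 ->
  ((s - 1) * zeta s alpha = real_power alpha (1 - s) + (s - 1) * (s * euler_sum alpha s))%C.
Proof.
  intros Hz Ha Hs. destruct (Hz alpha Ha) as [Han Hser].
  (* The difference of the two sides; [z - 0] and the product of exponentials give it the shape that
     [taylor_at_linear] and [taylor_at_Cexp] expect. *)
  set (f := fun z : C => ((z - 1) * zeta z alpha + - (1) * ((Cexp (ln alpha) * Cexp (z * - ln alpha))
               + (z - 1) * ((z - 0) * euler_sum alpha z)))%C).
  (* The point 2 + i lies in Re z > 1 and off the real axis, so the segment from it to s misses the
     pole at 1. *)
  set (z0 := (2, 1) : C).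
  assert (HT : forall t, 0 <= t <= 1 -> exists r M a, taylor_at f (z0 + t * (s - z0))%C r M a).
  { intros t Ht. set (z := (z0 + t * (s - z0))%C).
    assert (Hre : Re z = 2 + t * (s - 2)) by (unfold z, z0; cbn; unfold Re, Im; cbn; ring).
    assert (Him : Im z = 1 - t) by (unfold z, z0; cbn; unfold Re, Im; cbn; ring).
    assert (Hzn : z <> 1%C).
    { intros E. rewrite E in Hre, Him. cbn in Hre, Him. assert (t = 1) by lra. subst t. lra. }
    destruct (taylor_at_analytic _ _ z Han Hzn) as [r1 [M1 [a1 H1]]].
    destruct (euler_sum_taylor alpha z Ha ltac:(nra)) as [r2 [M2 [a2 H2]]].
    destruct (taylor_at_Cexp (Cexp (ln alpha)) (- ln alpha) z) as [M3 [a3 H3]].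
    set (r := Rmin (Rmin r1 r2) 1).
    assert (Hr : 0 < r) by (repeat apply Rmin_pos; [apply H1 | apply H2 | lra]).
    assert (Hr1 : r <= r1) by (eapply Rle_trans; apply Rmin_l).
    assert (Hr2 : r <= r2) by (eapply Rle_trans; [apply Rmin_l | apply Rmin_r]).
    assert (Hr3 : r <= 1) by apply Rmin_r.
    apply (taylor_at_shrink _ _ _ r) in H1; [|lra].
    apply (taylor_at_shrink _ _ _ r) in H2; [|lra].
    apply (taylor_at_shrink _ _ _ r) in H3; [|lra].
    do 3 eexists.
    exact (taylor_at_plus _ _ _ _ _ _ _ _ (taylor_at_linear 1 _ _ _ _ _ H1)
      (taylor_at_scal (- (1)) _ _ _ _ _ (taylor_at_plus _ _ _ _ _ _ _ _ H3
        (taylor_at_linear 1 _ _ _ _ _ (taylor_at_linear 0 _ _ _ _ _ H2))))). }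
  assert (HZ : forall z, 1 < Re z -> f z = 0).
  { intros z Hz1. specialize (Hser z Hz1). apply is_series_Clim in Hser.
    destruct (euler_sum_spec alpha z Ha ltac:(lra)) as [HW _].
    assert (L1 : Clim (fun N => (z - 1) * (z * Csum (fun n => euler_step (INR n + alpha) z) N))%C
                   ((z - 1) * (z * euler_sum alpha z))%C) by (apply Clim_scal, Clim_scal, HW).
    assert (L2 : Clim (fun N => real_power (INR N + alpha) (1 - z)) 0).
    { unfold Clim. apply (is_lim_seq_ext (fun N => exp (- (Re z - 1) * ln (INR N + alpha)))).
      - intros N. replace (real_power (INR N + alpha) (1 - z) - 0)%C with (real_power (INR N + alpha) (1 - z)) by ring.
        rewrite Cmod_real_power. do 2 f_equal. cbn. unfold Re. ring.
      - apply is_lim_seq_power_shift; lra. }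
    assert (L3 : Clim (fun N => (z - 1) * Csum (fun n => real_power (INR n + alpha) (- z)) N
        + real_power (INR N + alpha) (1 - z) + - real_power alpha (1 - z))%C
        ((z - 1) * zeta z alpha + 0 + - real_power alpha (1 - z))%C).
    { apply Clim_plus; [apply Clim_plus; [apply Clim_scal | exact L2] | apply Clim_const].
      eapply Clim_ext; [|reflexivity|exact Hser]. intros n. apply Csum_ext. intros k _.
      unfold Cpower, real_power. pose proof (pos_INR k).
      rewrite <- RtoC_plus, Clog_RtoC by lra. reflexivity. }
    assert (E : ((z - 1) * (z * euler_sum alpha z) = (z - 1) * zeta z alpha + 0 + - real_power alpha (1 - z))%C).
    { apply (Clim_unique _ _ _ L1).
      eapply Clim_ext; [|reflexivity|exact L3]. intros N. cbv beta.
      rewrite euler_partial_sum by lra. ring. }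
    unfold f. replace (z - 0)%C with z by ring. rewrite E. rewrite <- Cexp_plus.
    unfold real_power. replace (ln alpha + z * - ln alpha)%C with ((1 - z) * ln alpha)%C by ring. ring. }
  destruct (identity_theorem_segment f z0 s HT) as [r [Hr Hf]].
  - intros e He. exists (RtoC (e / 2)). rewrite Cmod_R, Rabs_right by lra. split; [lra|].
    apply HZ. unfold z0. cbn. lra.
  - specialize (Hf 0%C). rewrite Cmod_0, Cplus_0_r in Hf. specialize (Hf Hr). unfold f in Hf.
    replace (s - 0)%C with (RtoC s) in Hf by ring. rewrite <- Cexp_plus in Hf.
    replace (ln alpha + s * - ln alpha)%C with ((1 - s) * ln alpha)%C in Hf by ring.
    fold (real_power alpha (1 - s)) in Hf.
    match type of Hf with ?e = _ => replace ((s - 1) * zeta s alpha)%C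
      with (e + (real_power alpha (1 - s) + (s - 1) * (s * euler_sum alpha s)))%C by ring end.
    rewrite Hf. ring.
Qed.

Definition euler_approx (s : R) (N : nat) (alpha : R) : C :=
  (Csum (fun n => real_power (INR n + alpha) (- s)) N - / (1 - s) * real_power (INR N + alpha) (1 - s))%C.

(** The error is s times the tail of the Euler-Maclaurin series, which is at most (N + alpha)^(-s) /
    s. Replacing N + alpha by N makes the bound independent of alpha. *)
Lemma hurwitz_euler_approx (zeta : C -> R -> C) (alpha s : R) (N : nat) :
  is_hurwitz_zeta zeta -> 0 < alpha -> 0 < s < 1 -> (1 <= N)%nat ->
  Cmod (zeta s alpha - euler_approx s N alpha) <= exp (- s * ln (INR N)).
Proof.
  intros Hz Ha Hs HN.
  pose proof (hurwitz_continuation zeta alpha s Hz Ha Hs) as E1.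
  pose proof (euler_partial_sum alpha s N Ha ltac:(cbn; lra)) as E2.
  destruct (euler_sum_spec alpha s Ha ltac:(cbn; lra)) as [_ HB]. specialize (HB N). cbn [Re fst RtoC] in HB.
  assert (Hs1 : (RtoC s - 1)%C <> 0%C).
  { rewrite <- RtoC_minus. intros E. apply RtoC_inj in E. lra. }
  assert (E : (zeta s alpha - euler_approx s N alpha
     = s * (euler_sum alpha s - Csum (fun n => euler_step (INR n + alpha) s) N))%C).
  { unfold euler_approx.
    assert (E3 : zeta s alpha = (/ (s - 1) * (real_power alpha (1 - s) + (s - 1) * (s * euler_sum alpha s)))%C).
    { rewrite <- E1. field. exact Hs1. }
    set (W := Csum (fun n => euler_step (INR n + alpha) s) N) in *.
    set (P := Csum (fun n => real_power (INR n + alpha) (- s)) N) in *.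
    assert (E4 : P = (/ (s - 1) * ((s - 1) * (s * W) - real_power (INR N + alpha) (1 - s) + real_power alpha (1 - s)))%C).
    { rewrite E2. field. exact Hs1. }
    rewrite E3, E4. field. split; [|exact Hs1].
    intros E. apply Hs1. replace (RtoC s - 1)%C with (- (1 - s))%C by ring. rewrite E. ring. }
  rewrite E, Cmod_mult, Cmod_R, Rabs_right by lra.
  apply Rle_trans with (s * (exp (- s * ln (INR N + alpha)) / s)).
  - apply Rmult_le_compat_l; [lra | exact HB].
  - replace (s * (exp (- s * ln (INR N + alpha)) / s)) with (exp (- s * ln (INR N + alpha))) by (field; lra).
    apply exp_le_compat. assert (1 <= INR N) by (now apply (le_INR 1)).
    assert (ln (INR N) <= ln (INR N + alpha)) by (apply ln_le; lra). nra.
Qed.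

(** * Fourier coefficients for 0 < s < 1 *)

(** The base point 1 stays away from 0, where f may be singular. *)
Lemma exists_antiderivative (f : R -> C) :
  (forall x, 0 < x -> Ccont f x) -> exists Q : R -> C, forall x, 0 < x -> is_Cderive Q x (f x).
Proof.
  intros Hf.
  exists (fun x => (RInt (fun t => Re (f t)) 1 x, RInt (fun t => Im (f t)) 1 x)).
  assert (H : forall g : R -> R, (forall x, 0 < x -> continuous g x) ->
    forall x, 0 < x -> is_derive (fun x => RInt g 1 x) x (g x)).
  { intros g Hg x Hx. apply (is_derive_RInt (V := R_NormedModule) g (fun x => RInt g 1 x) 1 x).
    - exists (mkposreal x Hx). intros y Hy. change (Rabs (y - x) < x) in Hy. apply Rabs_def2 in Hy.
      apply (RInt_correct (V := R_CompleteNormedModule)).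
      apply (ex_RInt_continuous (V := R_CompleteNormedModule)). intros z Hz. apply Hg.
      unfold Rmin in Hz. destruct (Rle_dec 1 y); lra.
    - now apply Hg. }
  intros x Hx. split; apply H; auto; intros y Hy; apply Hf; exact Hy.
Qed.

Lemma is_derive_power_ln (t x : R) : t <> 0 -> 0 < x ->
  is_derive (fun x => exp (t * ln x) / t) x (exp ((t - 1) * ln x)).
Proof.
  intros Ht Hx. auto_derive; [lra|].
  replace ((t - 1) * ln x) with (t * ln x + - ln x) by ring.
  rewrite exp_plus, exp_Ropp, exp_ln by exact Hx. field. lra.
Qed.

Lemma antiderivative_increment (Q f : R -> C) (K t x y : R) :
  t <> 0 -> 0 < x <= y ->
  (forall z, x <= z <= y -> is_Cderive Q z (f z)) ->
  (forall z, x <= z <= y -> Cmod (f z) <= K * exp ((t - 1) * ln z)) ->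
  Cmod (Q y - Q x) <= K * (exp (t * ln y) / t) - K * (exp (t * ln x) / t).
Proof.
  intros Ht Hxy HQ Hf.
  apply (mean_value_bound Q f (fun z => K * (exp (t * ln z) / t)) (fun z => K * exp ((t - 1) * ln z))).
  - lra.
  - exact HQ.
  - intros z Hz. apply (is_derive_scal (fun z => exp (t * ln z) / t)). apply is_derive_power_ln; lra.
  - exact Hf.
Qed.

Lemma is_lim_seq_inv_power (t : R) : 0 < t -> is_lim_seq (fun n => exp (t * ln (/ INR (S n)))) 0.
Proof.
  intros Ht. apply (is_lim_seq_ext (fun n => exp (- t * ln (INR (S n))))).
  - intros n. rewrite ln_Rinv by (apply lt_0_INR; lia). f_equal. ring.
  - exact (proj1 (is_lim_seq_incr_1 (fun n => exp (- t * ln (INR n))) 0) (is_lim_seq_INR_power t Ht)).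
Qed.

(** Since t > 0 the majorant is integrable at 0, so Q has a limit there. It is constructed along the
    points 1 / (n + 1), where the increments telescope. *)
Lemma antiderivative_limit_0 (Q f : R -> C) (t : R) :
  0 < t -> (forall x, 0 < x -> is_Cderive Q x (f x)) ->
  (forall x, 0 < x -> Cmod (f x) <= exp ((t - 1) * ln x)) ->
  exists L, forall x, 0 < x -> Cmod (Q x - L) <= exp (t * ln x) / t.
Proof.
  intros Ht HQ Hf.
  assert (Hinc : forall x y, 0 < x <= y -> Cmod (Q y - Q x) <= exp (t * ln y) / t - exp (t * ln x) / t).
  { intros x y Hxy. rewrite <- (Rmult_1_l (exp (t * ln y) / t)), <- (Rmult_1_l (exp (t * ln x) / t)).
    apply (antiderivative_increment Q f 1 t x y); [lra | exact Hxy | |].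
    - intros; apply HQ; lra.
    - intros z Hz. rewrite Rmult_1_l. apply Hf; lra. }
  set (x_ := fun n => / INR (S n)).
  assert (Hx : forall n, 0 < x_ n) by (intros; apply Rinv_0_lt_compat, lt_0_INR; lia).
  assert (HT : is_lim_seq (fun n => exp (t * ln (x_ n)) / t) 0).
  { replace 0 with (0 * / t) by ring. apply (is_lim_seq_scal_r _ (/ t) 0). now apply is_lim_seq_inv_power. }
  destruct (Clim_telescope (fun n => Q (x_ (S n)) - Q (x_ n))%C (fun n => exp (t * ln (x_ n)) / t)) as [l [Hl _]].
  - intros n. rewrite <- Cmod_opp.
    replace (- (Q (x_ (S n)) - Q (x_ n)))%C with (Q (x_ n) - Q (x_ (S n)))%C by ring.
    apply Hinc. split; [apply Hx|]. unfold x_. apply Rinv_le_contravar; [apply lt_0_INR; lia|].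
    apply le_INR; lia.
  - exact HT.
  - exists (Q (x_ 0%nat) + l)%C. intros x Hx0.
    assert (Hsum : forall n, Csum (fun n => Q (x_ (S n)) - Q (x_ n))%C n = (Q (x_ n) - Q (x_ 0%nat))%C).
    { induction n as [|n IH]; cbn [Csum]; [ring | rewrite IH; ring]. }
    apply (Clim_bound (fun n => Q x + - (Q (x_ 0%nat) + Csum (fun n => Q (x_ (S n)) - Q (x_ n)) n))%C).
    + apply (Clim_ext (fun n => (Q x - Q (x_ 0%nat)) + (- (1)) * Csum (fun n => Q (x_ (S n)) - Q (x_ n)) n)%C
               _ ((Q x - Q (x_ 0%nat)) + (- (1)) * l)%C); [intros; ring | ring |].
      apply Clim_plus; [apply Clim_const | now apply Clim_scal].
    + destruct (INR_unbounded (/ x)) as [N HN]. exists N. intros n Hn. rewrite Hsum.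
      replace (Q x + - (Q (x_ 0%nat) + (Q (x_ n) - Q (x_ 0%nat))))%C with (Q x - Q (x_ n))%C by ring.
      eapply Rle_trans; [apply (Hinc (x_ n) x)|].
      * split; [apply Hx|]. unfold x_. rewrite <- (Rinv_inv x).
        apply Rinv_le_contravar; [now apply Rinv_0_lt_compat|].
        assert (INR N <= INR (S n)) by (apply le_INR; lia). lra.
      * assert (0 < exp (t * ln (x_ n)) / t) by (apply Rdiv_lt_0_compat; [apply exp_pos | lra]). lra.
Qed.

Lemma antiderivative_limit_infty (Q f : R -> C) (K t : R) :
  0 < t -> 0 <= K -> (forall x, 0 < x -> is_Cderive Q x (f x)) ->
  (forall x, 0 < x -> Cmod (f x) <= K * exp ((- t - 1) * ln x)) ->
  exists L, forall x, 0 < x -> Cmod (Q x - L) <= K * (exp (- t * ln x) / t).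
Proof.
  intros Ht HK HQ Hf.
  assert (Hinc : forall x y, 0 < x <= y -> Cmod (Q y - Q x) <= K * (exp (- t * ln x) / t) - K * (exp (- t * ln y) / t)).
  { intros x y Hxy. pose proof (antiderivative_increment Q f K (- t) x y) as H.
    eapply Rle_trans; [apply H|].
    - lra.
    - exact Hxy.
    - intros; apply HQ; lra.
    - intros z Hz. apply Hf; lra.
    - apply Req_le. field. lra. }
  destruct (Clim_telescope (fun n => Q (INR (S n) + 1)%R - Q (INR n + 1)%R)%C
    (fun n => K * (exp (- t * ln (INR n + 1)) / t))) as [l [Hl _]].
  - intros n. pose proof (pos_INR n). apply Hinc. rewrite S_INR. lra.
  - replace 0 with (K * (0 * / t)) by ring. apply (is_lim_seq_scal_l _ K (0 * / t)).
    apply (is_lim_seq_scal_r _ (/ t) 0). apply is_lim_seq_power_shift; lra.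
  - exists (Q (INR 0 + 1)%R + l)%C. intros x Hx0.
    assert (Hsum : forall n, Csum (fun n => Q (INR (S n) + 1)%R - Q (INR n + 1)%R)%C n = (Q (INR n + 1)%R - Q (INR 0 + 1)%R)%C).
    { induction n as [|n IH]; cbn [Csum]; [ring | rewrite IH; ring]. }
    apply (Clim_bound (fun n => Q x + - (Q (INR 0 + 1)%R + Csum (fun n => Q (INR (S n) + 1)%R - Q (INR n + 1)%R) n))%C).
    + apply (Clim_ext (fun n => (Q x - Q (INR 0 + 1)%R) + (- (1)) * Csum (fun n => Q (INR (S n) + 1)%R - Q (INR n + 1)%R) n)%C
               _ ((Q x - Q (INR 0 + 1)%R) + (- (1)) * l)%C); [intros; ring | ring |].
      apply Clim_plus; [apply Clim_const | now apply Clim_scal].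
    + destruct (INR_unbounded x) as [N HN]. exists N. intros n Hn. rewrite Hsum.
      replace (Q x + - (Q (INR 0 + 1)%R + (Q (INR n + 1)%R - Q (INR 0 + 1)%R)))%C with (- (Q (INR n + 1)%R - Q x))%C by ring.
      rewrite Cmod_opp. assert (INR N <= INR n) by (apply le_INR; lia).
      eapply Rle_trans; [apply (Hinc x (INR n + 1)); lra|].
      assert (0 < exp (- t * ln (INR n + 1)) / t) by (apply Rdiv_lt_0_compat; [apply exp_pos | lra]). nra.
Qed.

(* Integration by parts gains the decay [x ^ (- s)] at infinity even when
   [Re p = 0]; [L] is then the conditionally convergent integral over [(0, oo)]. *)
Lemma power_exp_primitive (s : R) (p : C) : 0 < s < 1 -> 0 <= Re p -> p <> 0%C ->
  exists (Q : R -> C) (L : C), (forall x, 0 < x -> is_Cderive Q x (power_exp s p x)) /\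
    (forall x, 0 < x -> Cmod (Q x) <= exp ((1 - s) * ln x) / (1 - s)) /\
    (forall x, 0 < x -> Cmod (Q x - L) <= 2 * exp (- s * ln x) / Cmod p).
Proof.
  intros Hs Hp Hpn.
  assert (Hp0 : 0 < Cmod p) by now apply Cmod_gt_0.
  assert (Hb : forall x, 0 < x -> Cmod (power_exp s p x) <= exp (- s * ln x)).
  { intros x Hx. rewrite Cmod_power_exp. cbn [Re fst RtoC]. apply exp_le_compat. nra. }
  destruct (exists_antiderivative (power_exp s p)) as [Q0 HQ0].
  { intros x Hx. now apply Ccont_power_exp. }
  destruct (antiderivative_limit_0 Q0 (power_exp s p) (1 - s) ltac:(lra) HQ0) as [L0 HL0].
  { intros x Hx. replace (1 - s - 1) with (- s) by ring. now apply Hb. }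
  set (Q := fun x => (Q0 x - L0)%C).
  assert (HQ : forall x, 0 < x -> is_Cderive Q x (power_exp s p x)).
  { intros x Hx. eapply is_Cderive_ext; [| | exact (is_Cderive_plus _ _ _ _ _ (HQ0 x Hx) (is_Cderive_const (- L0)%C x))].
    - reflexivity.
    - ring. }
  (* Adding this boundary term leaves the derivative - (s / p) x^(- s - 1) e^(- p x), which is
     absolutely integrable at infinity. *)
  set (g := fun x => (Q x + / p * power_exp s p x)%C).
  set (g' := fun x => (- s / p * (RtoC (/ x) * power_exp s p x))%C).
  destruct (antiderivative_limit_infty g g' (s / Cmod p) s) as [L HL].
  - lra.
  - apply Rlt_le, Rdiv_lt_0_compat; lra.
  - intros x Hx.
    assert (Hd : is_Cderive (power_exp s p) x ((- s * RtoC (/ x) + - p * 1) * power_exp s p x)%C).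
    { assert (Hl : is_Cderive (fun t => - s * RtoC (ln t) + - p * RtoC t)%C x (- s * RtoC (/ x) + - p * 1)%C).
      { apply is_Cderive_plus; apply is_Cderive_scal; [now apply is_Cderive_ln | apply is_Cderive_id]. }
      eapply is_Cderive_ext; [| | exact (is_Cderive_Cexp _ _ _ Hl)].
      - intros t. unfold power_exp. f_equal. ring.
      - cbv beta. f_equal. unfold power_exp. f_equal. ring. }
    eapply is_Cderive_ext; [reflexivity | | exact (is_Cderive_plus _ _ _ _ _ (HQ x Hx) (is_Cderive_scal (/ p)%C _ _ _ Hd))].
    unfold g'. field. exact Hpn.
  - intros x Hx. unfold g', Cdiv. rewrite !Cmod_mult, Cmod_inv, Cmod_opp, !Cmod_R by exact Hpn.
    rewrite (Rabs_right s), (Rabs_right (/ x)) by (try apply Rle_ge, Rlt_le, Rinv_0_lt_compat; lra).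
    unfold Rdiv. apply Rmult_le_compat_l; [apply Rmult_le_pos; [lra | apply Rlt_le, Rinv_0_lt_compat; lra]|].
    replace ((- s - 1) * ln x) with (- ln x + - s * ln x) by ring.
    rewrite exp_plus, exp_Ropp, exp_ln by exact Hx.
    apply Rmult_le_compat_l; [apply Rlt_le, Rinv_0_lt_compat; lra | now apply Hb].
  - exists Q, L. split; [exact HQ|]. split; [exact HL0|].
    intros x Hx. replace (Q x - L)%C with ((g x - L) + - (/ p * power_exp s p x))%C by (unfold g; ring).
    eapply Rle_trans; [apply Cmod_triangle|]. rewrite Cmod_opp, Cmod_mult, Cmod_inv by exact Hpn.
    specialize (HL x Hx). specialize (Hb x Hx).
    replace (s / Cmod p * (exp (- s * ln x) / s)) with (/ Cmod p * exp (- s * ln x)) in HL by (field; lra).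
    assert (/ Cmod p * Cmod (power_exp s p x) <= / Cmod p * exp (- s * ln x)).
    { apply Rmult_le_compat_l; [apply Rlt_le, Rinv_0_lt_compat; lra | exact Hb]. }
    unfold Rdiv. lra.
Qed.

Lemma filterlim_bound_0 (F : (R -> Prop) -> Prop) (u v : R -> R) :
  Filter F -> F (fun x => 0 <= u x <= v x) -> filterlim v F (locally 0) -> filterlim u F (locally 0).
Proof.
  intros HF H Hv. apply (filterlim_le_le (F := F) (fun _ => 0) u v 0); [exact H | apply filterlim_const | exact Hv].
Qed.

Lemma at_right_0_positive (P : R -> Prop) : (forall x, 0 < x -> P x) -> at_right 0 P.
Proof. intros H. exists (mkposreal 1 Rlt_0_1). intros y _ Hy. now apply H. Qed.

Lemma power_exp_primitive_laplace (s : R) (p : C) (Q : R -> C) (L : C) :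
  0 < s < 1 -> 0 < Re p -> (forall x, 0 < x -> is_Cderive Q x (power_exp s p x)) ->
  (forall x, 0 < x -> Cmod (Q x) <= exp ((1 - s) * ln x) / (1 - s)) ->
  (forall x, 0 < x -> Cmod (Q x - L) <= 2 * exp (- s * ln x) / Cmod p) ->
  L = laplace_power s p.
Proof.
  intros Hs Hp HQ H0 H1.
  assert (H : Cint (power_exp s p) (L - 0)%C).
  { apply (CInt_antiderivative is_positive _ _ Q).
    - exact interval_positive.
    - exact HQ.
    - intros x Hx. now apply Ccont_power_exp.
    - apply (filterlim_bound_0 _ _ (fun x => / (1 - s) * exp ((1 - s) * ln x))); [apply filter_filter | |].
      + apply at_right_0_positive. intros x Hx. split; [apply Cmod_ge_0|].
        replace (Q x - 0)%C with (Q x) by ring. specialize (H0 x Hx). unfold Rdiv in H0. lra.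
      + replace 0 with (/ (1 - s) * 0) at 2 by ring.
        exact (filterlim_comp _ _ _ _ _ _ _ _ (filterlim_exp_ln_0 (1 - s) ltac:(lra)) (filterlim_scal_r (/ (1 - s)) 0)).
    - apply (filterlim_bound_0 _ _ (fun x => 2 / Cmod p * / exp (s * ln x))); [apply filter_filter | |].
      + exists 0. intros x Hx. split; [apply Cmod_ge_0|]. specialize (H1 x Hx).
        rewrite <- exp_Ropp. replace (- (s * ln x)) with (- s * ln x) by ring. unfold Rdiv in *. lra.
      + replace 0 with (2 / Cmod p * 0) at 1 by ring.
        refine (filterlim_comp _ _ _ (fun x => / exp (s * ln x)) (fun y => 2 / Cmod p * y) _ _ _ _ (filterlim_scal_r (2 / Cmod p) 0)).
        refine (filterlim_comp _ _ _ (fun x => exp (s * ln x)) Rinv _ _ _ (filterlim_exp_ln_infty s ltac:(lra)) _).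
        apply (filterlim_Rbar_inv p_infty). discriminate. }
  rewrite <- (CInt_unique _ _ _ _ _ filter_at_right_0 filter_p_infty H
    (Cint_laplace_power s p ltac:(cbn; lra) Hp)). ring.
Qed.

Lemma power_exp_Lipschitz (s : R) (p q : C) (x : R) : 0 < x -> 0 <= Re p -> 0 <= Re q ->
  Cmod (power_exp s p x - power_exp s q x) <= x * Cmod (p - q) * exp (- s * ln x).
Proof.
  intros Hx Hp Hq.
  set (f := fun t : R => (power_exp s (q + t * (p - q)) x)).
  replace (power_exp s p x - power_exp s q x)%C with (f 1 - f 0)%C.
  2:{ unfold f. f_equal; [|f_equal]; f_equal; ring. }
  replace (x * Cmod (p - q) * exp (- s * ln x))
    with (1 * (x * Cmod (p - q) * exp (- s * ln x)) - 0 * (x * Cmod (p - q) * exp (- s * ln x))) by ring.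
  apply (mean_value_bound f (fun t => (- x * (p - q)) * f t)%C
    (fun t => t * (x * Cmod (p - q) * exp (- s * ln x))) (fun t => x * Cmod (p - q) * exp (- s * ln x))).
  - lra.
  - intros t _.
    assert (H : is_Cderive (fun t : R => (- (s * ln x) - q * x) + (- x * (p - q)) * RtoC t)%C t (0 + (- x * (p - q)) * 1)%C).
    { apply is_Cderive_plus; [apply is_Cderive_const | apply is_Cderive_scal, is_Cderive_id]. }
    eapply is_Cderive_ext; [| | exact (is_Cderive_Cexp _ _ _ H)].
    + intros u. unfold f, power_exp. f_equal. ring.
    + cbv beta. unfold f, power_exp. rewrite Cplus_0_l, Cmult_1_r. f_equal. f_equal. ring.
  - intros t _. auto_derive; [trivial | ring].
  - intros t Ht. rewrite !Cmod_mult, Cmod_opp, Cmod_R, (Rabs_right x) by lra.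
    apply Rmult_le_compat_l; [apply Rmult_le_pos; [lra | apply Cmod_ge_0]|].
    unfold f. rewrite Cmod_power_exp. cbn [Re fst RtoC]. apply exp_le_compat.
    assert (0 <= Re (q + t * (p - q))%C).
    { replace (Re (q + t * (p - q))%C) with ((1 - t) * Re q + t * Re p) by (cbn; unfold Re, Im; cbn; ring).
      apply Rplus_le_le_0_compat; apply Rmult_le_pos; lra. }
    unfold Re in *. nra.
Qed.

(** Both primitives vanish at 0, so the Lipschitz bound in the exponent is integrated over (x, N)
    and x is sent to 0 along 1 / (n + 1). *)
Lemma power_exp_primitive_difference (s : R) (p q : C) (Q Q' : R -> C) (N : R) :
  0 < s < 1 -> 0 <= Re p -> 0 <= Re q -> 0 < N ->
  (forall x, 0 < x -> is_Cderive Q x (power_exp s p x)) ->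
  (forall x, 0 < x -> is_Cderive Q' x (power_exp s q x)) ->
  (forall x, 0 < x -> Cmod (Q x) <= exp ((1 - s) * ln x) / (1 - s)) ->
  (forall x, 0 < x -> Cmod (Q' x) <= exp ((1 - s) * ln x) / (1 - s)) ->
  Cmod (Q N - Q' N) <= N * Cmod (p - q) * (exp ((1 - s) * ln N) / (1 - s)).
Proof.
  intros Hs Hp Hq HN HQ HQ' H0 H0'.
  set (K := N * Cmod (p - q)).
  assert (HK : 0 <= K) by (apply Rmult_le_pos; [lra | apply Cmod_ge_0]).
  assert (Hinc : forall x, 0 < x <= N -> Cmod (Q N - Q' N) <=
     K * (exp ((1 - s) * ln N) / (1 - s)) + 2 * (exp ((1 - s) * ln x) / (1 - s))).
  { intros x Hx.
    pose proof (antiderivative_increment (fun z => Q z - Q' z)%C (fun z => power_exp s p z - power_exp s q z)%C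
      K (1 - s) x N ltac:(lra) Hx) as H.
    assert (HD : Cmod ((Q N - Q' N) - (Q x - Q' x)) <= K * (exp ((1 - s) * ln N) / (1 - s)) - K * (exp ((1 - s) * ln x) / (1 - s))).
    { apply H.
      - intros z Hz.
        eapply is_Cderive_ext; [| | exact (is_Cderive_plus _ _ _ _ _ (HQ z ltac:(lra))
          (is_Cderive_scal (- (1))%C _ _ _ (HQ' z ltac:(lra))))]; intros; cbv beta; ring.
      - intros z Hz. eapply Rle_trans; [apply power_exp_Lipschitz; lra|].
        replace (1 - s - 1) with (- s) by ring.
        apply Rmult_le_compat_r; [apply Rlt_le, exp_pos|].
        unfold K. apply Rmult_le_compat_r; [apply Cmod_ge_0 | lra]. }
    replace (Q N - Q' N)%C with (((Q N - Q' N) - (Q x - Q' x)) + (Q x + - Q' x))%C by ring.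
    eapply Rle_trans; [apply Cmod_triangle|].
    pose proof (Cmod_triangle (Q x) (- Q' x)) as H2. rewrite Cmod_opp in H2.
    specialize (H0 x ltac:(lra)). specialize (H0' x ltac:(lra)).
    assert (0 <= K * (exp ((1 - s) * ln x) / (1 - s))).
    { apply Rmult_le_pos; [exact HK|]. apply Rlt_le, Rdiv_lt_0_compat; [apply exp_pos | lra]. }
    lra. }
  fold K.
  assert (Hlim : is_lim_seq (fun n => K * (exp ((1 - s) * ln N) / (1 - s)) + 2 * (exp ((1 - s) * ln (/ INR (S n))) / (1 - s)))
     (K * (exp ((1 - s) * ln N) / (1 - s)) + 2 * (0 * / (1 - s)))).
  { apply is_lim_seq_plus'; [apply is_lim_seq_const|].
    apply (is_lim_seq_scal_l _ 2 (0 * / (1 - s))). apply (is_lim_seq_scal_r _ (/ (1 - s)) 0).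
    apply is_lim_seq_inv_power. lra. }
  replace (K * (exp ((1 - s) * ln N) / (1 - s)) + 2 * (0 * / (1 - s)))
    with (K * (exp ((1 - s) * ln N) / (1 - s))) in Hlim by ring.
  apply (is_lim_seq_le_loc (fun _ => Cmod (Q N - Q' N)) _ (Cmod (Q N - Q' N)) (K * (exp ((1 - s) * ln N) / (1 - s)))) in Hlim;
    [exact Hlim | | apply is_lim_seq_const].
  destruct (INR_unbounded (/ N)) as [M HM]. exists M. intros n Hn. apply Hinc.
  split; [apply Rinv_0_lt_compat, lt_0_INR; lia|].
  rewrite <- (Rinv_inv N). apply Rinv_le_contravar; [now apply Rinv_0_lt_compat|].
  assert (INR M <= INR (S n)) by (apply le_INR; lia). lra.
Qed.

(** Rotation up to the boundary |Im w| = pi / 2, by an Abel-type argument. Turning w by t Im w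
    towards the real axis gives an exponent q inside the half-plane, where [laplace_power_rotation]
    applies. Since |q| = |p|, the tails beyond N are small uniformly in t; N is chosen for them, and
    t afterwards for the rest. *)
Lemma power_exp_primitive_limit (s : R) (w : C) (Q : R -> C) (L : C) :
  0 < s < 1 -> Rabs (Im w) <= PI / 2 ->
  (forall x, 0 < x -> is_Cderive Q x (power_exp s (Cexp w) x)) ->
  (forall x, 0 < x -> Cmod (Q x) <= exp ((1 - s) * ln x) / (1 - s)) ->
  (forall x, 0 < x -> Cmod (Q x - L) <= 2 * exp (- s * ln x) / Cmod (Cexp w)) ->
  L = (CGamma (1 - s) * Cexp (w * (s - 1)))%C.
Proof.
  intros Hs Hw HQ H0 H1.
  pose proof PI_bounds as HPI.
  set (p := Cexp w) in *. assert (Hp : 0 < Cmod p) by apply Cmod_gt_0, Cexp_neq_0.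
  set (y := Im w) in *. set (G := CGamma (1 - s)). set (V := Cexp (w * (s - 1))).
  set (X := Cmod (L - G * V)).
  pose proof (Rabs_pos y) as Hy0.
  assert (Hcos : forall t, Rabs t <= PI / 2 -> 0 <= cos t).
  { intros t Ht. apply Rabs_le_between in Ht. apply cos_ge_0; lra. }
  assert (Hrep : 0 <= Re p).
  { unfold p, Cexp. cbn [Re fst]. apply Rmult_le_pos; [apply Rlt_le, exp_pos | now apply Hcos]. }
  (* The first term collects the two tails beyond N. The second, proportional to t, compares the
     primitives on (0, N) and the two rotated values. *)
  assert (Hmain : forall N t, 0 < N -> 0 < t <= 1 ->
    X <= 4 * exp (- s * ln N) / Cmod p
       + t * (N * Cmod p * Rabs y * (exp ((1 - s) * ln N) / (1 - s)) + Cmod G * (Cmod V * Rabs y))).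
  { intros N t HN Ht.
    set (wt := (w - Ci * RtoC (t * y))%C).
    assert (Him : Im wt = (1 - t) * y) by (unfold wt, y; cbn; unfold Re, Im; cbn; ring).
    assert (Hwt : Rabs (Im wt) < PI / 2).
    { rewrite Him, Rabs_mult, Rabs_right by lra. nra. }
    set (q := Cexp wt).
    assert (Hq : 0 < Re q).
    { unfold q, Cexp. cbn [Re fst]. apply Rmult_lt_0_compat; [apply exp_pos|].
      apply Rabs_def2 in Hwt. apply cos_gt_0; lra. }
    assert (Eq : q = (p * Cexp (Ci * RtoC (- (t * y))))%C).
    { unfold q, p, wt. rewrite <- Cexp_plus. f_equal. rewrite RtoC_opp. ring. }
    assert (Hunit : forall a : R, Cmod (Cexp (Ci * a)) = 1).
    { intros a. rewrite Cmod_Cexp. replace (Re (Ci * a)%C) with 0 by (cbn; ring). apply exp_0. }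
    assert (Hqm : Cmod q = Cmod p) by (rewrite Eq, Cmod_mult, Hunit; ring).
    assert (Hrot : forall a : R, Cmod (1 - Cexp (Ci * a)) <= Rabs a).
    { intros a. pose proof (Cexp_Ci_Lipschitz 0 a) as H. rewrite Cmult_0_r, Cexp_0 in H.
      eapply Rle_trans; [exact H|]. rewrite Rminus_0_l, Rabs_Ropp. lra. }
    assert (Hpq : Cmod (p - q) <= Cmod p * (t * Rabs y)).
    { rewrite Eq. replace (p - p * Cexp (Ci * RtoC (- (t * y))))%C with (p * (1 - Cexp (Ci * RtoC (- (t * y)))))%C by ring.
      rewrite Cmod_mult. apply Rmult_le_compat_l; [lra|]. eapply Rle_trans; [apply Hrot|].
      rewrite Rabs_Ropp, Rabs_mult, Rabs_right by lra. lra. }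
    destruct (power_exp_primitive s q Hs (Rlt_le _ _ Hq) (Cexp_neq_0 _)) as [Qt [Lt [A1 [A2 A3]]]].
    pose proof (power_exp_primitive_laplace s q Qt Lt Hs Hq A1 A2 A3) as ELt.
    assert (Hs1 : Re s < 1) by (cbn; lra).
    unfold q in ELt at 1. rewrite laplace_power_rotation, <- CGamma_laplace_power in ELt by assumption.
    fold G in ELt.
    assert (EV : Cexp (wt * (s - 1)) = (V * Cexp (Ci * RtoC (- (t * y) * (s - 1))))%C).
    { unfold V, wt. rewrite <- Cexp_plus. f_equal. rewrite !RtoC_mult, RtoC_opp, RtoC_minus, RtoC_mult. ring. }
    rewrite EV in ELt.
    assert (HD : Cmod (Q N - Qt N) <= N * (Cmod p * (t * Rabs y)) * (exp ((1 - s) * ln N) / (1 - s))).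
    { eapply Rle_trans; [apply (power_exp_primitive_difference s p q Q Qt N); auto; lra|].
      apply Rmult_le_compat_r; [apply Rlt_le, Rdiv_lt_0_compat; [apply exp_pos | lra]|].
      apply Rmult_le_compat_l; lra. }
    assert (HG : Cmod (Lt - G * V) <= Cmod G * (Cmod V * (t * Rabs y))).
    { rewrite ELt. replace (G * (V * Cexp (Ci * RtoC (- (t * y) * (s - 1)))) - G * V)%C
        with (- (G * (V * (1 - Cexp (Ci * RtoC (- (t * y) * (s - 1)))))))%C by ring.
      rewrite Cmod_opp, !Cmod_mult. apply Rmult_le_compat_l; [apply Cmod_ge_0|].
      apply Rmult_le_compat_l; [apply Cmod_ge_0|]. eapply Rle_trans; [apply Hrot|].
      rewrite !Rabs_mult, Rabs_Ropp, Rabs_mult, (Rabs_right t), (Rabs_left (s - 1)) by lra.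
      assert (0 <= t * Rabs y) by (apply Rmult_le_pos; lra). nra. }
    specialize (H1 N HN). specialize (A3 N HN). rewrite Hqm in A3.
    unfold X. replace (L - G * V)%C with (- (Q N - L) + ((Q N - Qt N) + ((Qt N - Lt) + (Lt - G * V))))%C by ring.
    eapply Rle_trans; [apply Cmod_triangle|]. rewrite Cmod_opp.
    pose proof (Cmod_triangle (Q N - Qt N) ((Qt N - Lt) + (Lt - G * V))) as T1.
    pose proof (Cmod_triangle (Qt N - Lt) (Lt - G * V)) as T2.
    unfold Rdiv in *. lra. }
  assert (HX : X = 0).
  { destruct (Rle_lt_or_eq_dec 0 X (Cmod_ge_0 _)) as [HX|HX]; [exfalso | now symmetry].
    pose proof (is_lim_seq_scal_l _ (4 / Cmod p) 0 (is_lim_seq_INR_power s ltac:(lra))) as HL.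
    apply is_lim_seq_spec in HL. assert (HX4 : 0 < X / 4) by lra.
    destruct (HL (mkposreal _ HX4)) as [N0 HN0].
    assert (HN1 : Rabs (4 / Cmod p * exp (- s * ln (INR (Nat.max 1 N0))) - 4 / Cmod p * 0) < X / 4)
      by exact (HN0 (Nat.max 1 N0) (Nat.le_max_r _ _)).
    clear HN0. rename HN1 into HN0.
    set (N := INR (Nat.max 1 N0)) in *. rewrite Rmult_0_r, Rminus_0_r in HN0.
    assert (HN : 0 < N) by (apply lt_0_INR; lia).
    set (A := N * Cmod p * Rabs y * (exp ((1 - s) * ln N) / (1 - s)) + Cmod G * (Cmod V * Rabs y)).
    assert (HA : 0 <= A).
    { assert (0 < exp ((1 - s) * ln N) / (1 - s)) by (apply Rdiv_lt_0_compat; [apply exp_pos | lra]).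
      apply Rplus_le_le_0_compat; [apply Rmult_le_pos; [|lra]|]; repeat apply Rmult_le_pos; try apply Cmod_ge_0; lra. }
    set (t := Rmin 1 (X / (4 * (A + 1)))).
    assert (Ht : 0 < t) by (apply Rmin_pos; [lra | apply Rdiv_lt_0_compat; lra]).
    assert (Ht1 : t <= 1) by apply Rmin_l.
    assert (HtA : t * A <= X / 4).
    { apply Rle_trans with (X / (4 * (A + 1)) * (A + 1)).
      - apply Rmult_le_compat; [lra | lra | apply Rmin_r | lra].
      - apply Req_le. field. lra. }
    specialize (Hmain N t HN ltac:(lra)). fold A in Hmain.
    pose proof (Rle_abs (4 / Cmod p * exp (- s * ln N))). unfold Rdiv in *. lra. }
  apply Cmod_eq_0 in HX. replace L with ((L - G * V) + G * V)%C by ring. rewrite HX. ring.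
Qed.

Lemma Cexp_Clog_imaginary (n : Z) : n <> 0%Z ->
  Cexp (Clog (2 * PI * Ci * IZR n)) = (2 * PI * Ci * IZR n)%C /\
  Rabs (Im (Clog (2 * PI * Ci * IZR n))) <= PI / 2.
Proof.
  intros Hn. pose proof PI_RGT_0 as HP.
  destruct (Z_lt_le_dec 0 n) as [L|L].
  - destruct (Clog_imaginary (Z.to_nat (n - 1))) as [E _].
    replace (Z.of_nat (S (Z.to_nat (n - 1)))) with n in E by lia. rewrite E.
    replace (INR (S (Z.to_nat (n - 1)))) with (IZR n) by (rewrite INR_IZR_INZ; f_equal; lia).
    assert (Hn' : 0 < IZR n) by (now apply IZR_lt). split.
    + rewrite Cexp_plus, Cexp_RtoC, exp_ln by (apply Rmult_lt_0_compat; lra).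
      unfold Cexp. cbn [Re Im fst snd]. rewrite exp_0, cos_PI2, sin_PI2.
      apply C_ext; cbn; unfold Re, Im; cbn; ring.
    + cbn. rewrite Rplus_0_l, Rabs_right; lra.
  - destruct (Clog_imaginary (Z.to_nat (- n - 1))) as [_ E].
    replace (- Z.of_nat (S (Z.to_nat (- n - 1))))%Z with n in E by lia. rewrite E.
    replace (INR (S (Z.to_nat (- n - 1)))) with (- IZR n) by (rewrite INR_IZR_INZ, <- opp_IZR; f_equal; lia).
    assert (Hn' : IZR n < 0) by (apply IZR_lt; lia). split.
    + rewrite Cexp_plus, Cexp_RtoC, exp_ln by (apply Rmult_lt_0_compat; lra).
      unfold Cexp. cbn [Re Im fst snd]. rewrite exp_0, cos_neg, sin_neg, cos_PI2, sin_PI2.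
      apply C_ext; cbn; unfold Re, Im; cbn; ring.
    + cbn. rewrite Rplus_0_l, Rabs_Ropp, Rabs_right; lra.
Qed.

(** For m = 0 the primitive grows like x^(1 - s) / (1 - s), which is the term that the
    Euler-Maclaurin approximation subtracts. After this correction the constant term is 0, so all m
    fit one statement. *)
Lemma zeta_coef_primitive (s : R) (m : Z) : 0 < s < 1 ->
  exists (Q : R -> C) (K : R),
    (forall x, 0 < x -> is_Cderive Q x (power_exp s (2 * PI * Ci * IZR m) x)) /\
    (forall x, 0 < x -> Cmod (Q x) <= exp ((1 - s) * ln x) / (1 - s)) /\
    (forall x, 0 < x -> Cmod (Q x - RtoC (exp ((1 - s) * ln x) / (1 - s)) * (if Z.eqb m 0 then 1 else 0)
        - zeta_coef s m) <= K * exp (- s * ln x)).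
Proof.
  intros Hs. unfold zeta_coef. destruct (Z.eqb_spec m 0) as [->|Hm].
  - exists (fun x => RtoC (exp ((1 - s) * ln x) / (1 - s))), 0. split; [|split].
    + intros x Hx. eapply is_Cderive_ext; [reflexivity | |
        apply is_Cderive_RtoC, (is_derive_power_ln (1 - s) x); lra].
      rewrite <- Cexp_RtoC. unfold power_exp. f_equal.
      apply C_ext; cbn; unfold Re, Im; cbn; ring.
    + intros x Hx. rewrite Cmod_R, Rabs_right; [lra|].
      apply Rle_ge, Rlt_le, Rdiv_lt_0_compat; [apply exp_pos | lra].
    + intros x Hx. match goal with |- Cmod ?e <= _ => replace e with (RtoC 0) by ring end.
      rewrite Cmod_0. lra.
  - destruct (Cexp_Clog_imaginary m Hm) as [E1 E2].
    set (w := Clog (2 * PI * Ci * IZR m)) in *.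
    destruct (power_exp_primitive s (Cexp w) Hs) as [Q [L [A1 [A2 A3]]]].
    + rewrite E1. cbn. unfold Re, Im. cbn. lra.
    + apply Cexp_neq_0.
    + pose proof (power_exp_primitive_limit s w Q L Hs E2 A1 A2 A3) as EL.
      exists Q, (2 / Cmod (Cexp w)). split; [|split].
      * intros x Hx. rewrite <- E1. now apply A1.
      * exact A2.
      * intros x Hx. unfold Cpower. fold w. replace ((s - 1) * w)%C with (w * (s - 1))%C by ring.
        rewrite <- EL. replace (Q x - RtoC (exp ((1 - s) * ln x) / (1 - s)) * 0 - L)%C with (Q x - L)%C by ring.
        specialize (A3 x Hx). unfold Rdiv in *. lra.
Qed.

(** * Fourier coefficients of the Euler-Maclaurin approximants *)

Lemma is_Cderive_shift (Q : R -> C) (c x : R) (l : C) :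
  is_Cderive Q (c + x) l -> is_Cderive (fun x => Q (c + x)) x l.
Proof.
  intros H. rewrite is_Cderive_epsilon in H |- *. intros eps He. destruct (H eps He) as [d [Hd K]].
  exists d. split; [exact Hd|]. intros h Hh. specialize (K h Hh).
  now rewrite Rplus_assoc in K.
Qed.

Lemma filterlim_within_Ccont (F : R -> C) (D : R -> Prop) (x : R) : Ccont F x ->
  filterlim (fun y => Cmod (F y - F x)) (within D (locally x)) (locally 0).
Proof.
  intros HF.
  assert (H : continuous (fun y => Cmod (F y - F x)) x).
  { apply (Ccont_Cmod (fun y => F y - F x)%C). apply Ccont_minus; [exact HF | apply Ccont_const]. }
  unfold continuous in H. replace (F x - F x)%C with (RtoC 0) in H by ring. rewrite Cmod_0 in H.
  refine (filterlim_filter_le_1 _ _ H). apply filter_le_within.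
Qed.

Lemma Ccont_real_power (y x : R) (s : C) : 0 < y + x -> Ccont (fun x => real_power (y + x) s) x.
Proof. intros H. eapply is_Cderive_Ccont, is_Cderive_real_power, H. Qed.

Lemma character_shift (m : Z) (n : nat) (x : R) : character m (INR n + x) = character m x.
Proof.
  rewrite <- (Cmult_1_l (character m x)), <- (character_INR m n). unfold character.
  rewrite <- Cexp_plus. f_equal. rewrite RtoC_plus. ring.
Qed.

Lemma real_power_character (s : R) (m : Z) (x : R) :
  (real_power x (- s) * character (- m) x)%C = power_exp s (2 * PI * Ci * IZR m) x.
Proof.
  unfold real_power, character, power_exp. rewrite <- Cexp_plus. f_equal. rewrite opp_IZR, RtoC_opp. ring.
Qed.

(** Unfolding: the translates n + (0, 1) with n < N tile (0, N) and the character has period 1, so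
    the sum of the integrals is the integral of x^(-s) e^(-2 pi i m x) over (0, N), that is, Q at
    N. *)
Lemma Uint_real_power_sum (s : R) (m : Z) (Q : R -> C) (N : nat) :
  0 < s < 1 -> (1 <= N)%nat ->
  (forall x, 0 < x -> is_Cderive Q x (power_exp s (2 * PI * Ci * IZR m) x)) ->
  (forall x, 0 < x -> Cmod (Q x) <= exp ((1 - s) * ln x) / (1 - s)) ->
  Uint (fun x => Csum (fun n => real_power (INR n + x) (- s)) N * character (- m) x)%C (Q (INR N)).
Proof.
  intros Hs HN HQ H0.
  assert (Hterm : forall n (l : C), filterlim (fun x => Cmod (Q (INR n + x)%R - l)) (at_right 0) (locally 0) ->
    Uint (fun x => real_power (INR n + x) (- s) * character (- m) x)%C (Q (INR n + 1)%R - l)%C).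
  { intros n l Hl. pose proof (pos_INR n) as Hn.
    assert (HD : forall x, 0 < x -> is_Cderive (fun x => Q (INR n + x)) x
                   (real_power (INR n + x)%R (- s) * character (- m) x)%C).
    { intros x Hx. rewrite <- (character_shift (- m) n x), real_power_character.
      apply is_Cderive_shift, HQ. lra. }
    apply (CInt_antiderivative in_unit _ _ (fun x => Q (INR n + x))).
    - exact interval_unit.
    - intros x Hx. apply HD. unfold in_unit in Hx; lra.
    - intros x Hx. unfold in_unit in Hx. apply Ccont_mult; [apply Ccont_real_power; lra | apply Ccont_character].
    - exact Hl.
    - apply (filterlim_within_Ccont (fun x => Q (INR n + x))). eapply is_Cderive_Ccont, HD. lra. }
  assert (Hind : forall k, Uint (fun x => Csum (fun n => real_power (INR n + x) (- s)) (S k) * character (- m) x)%C (Q (INR (S k)))).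
  { induction k as [|k IH].
    (* In the first cell x^(-s) is singular at 0; the boundary value 0 comes from the bound on Q. *)
    - replace (Q (INR 1)) with (Q (INR 0 + 1)%R - 0)%C by (simpl; rewrite Rplus_0_l; ring).
      eapply (CInt_ext in_unit); [exact interval_unit | | apply (Hterm 0%nat 0%C)].
      + intros x _. cbn [Csum]. ring.
      + apply (filterlim_bound_0 _ _ (fun x => / (1 - s) * exp ((1 - s) * ln x))); [apply filter_filter | |].
        * apply at_right_0_positive. intros x Hx. split; [apply Cmod_ge_0|].
          simpl INR. rewrite Rplus_0_l. replace (Q x - 0)%C with (Q x) by ring. specialize (H0 x Hx). unfold Rdiv in H0. lra.
        * replace 0 with (/ (1 - s) * 0) at 2 by ring.
          exact (filterlim_comp _ _ _ _ _ _ _ _ (filterlim_exp_ln_0 (1 - s) ltac:(lra)) (filterlim_scal_r (/ (1 - s)) 0)).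
    - assert (Hk : 0 < INR (S k)) by (apply lt_0_INR; lia).
      replace (Q (INR (S (S k)))) with (Q (INR (S k)) + (Q (INR (S k) + 1)%R - Q (INR (S k))))%C
        by (rewrite (S_INR (S k)); ring).
      assert (Hl : filterlim (fun x => Cmod (Q (INR (S k) + x)%R - Q (INR (S k)))) (at_right 0) (locally 0)).
      { apply (filterlim_ext (fun x => Cmod (Q (INR (S k) + x)%R - Q (INR (S k) + 0)%R))).
        { intros x. now rewrite Rplus_0_r. }
        apply (filterlim_within_Ccont (fun x => Q (INR (S k) + x))).
        eapply is_Cderive_Ccont, is_Cderive_shift, HQ. lra. }
      eapply (CInt_ext in_unit); [exact interval_unit | |
        exact (CInt_plus _ _ _ _ _ _ _ _ IH (Hterm (S k) (Q (INR (S k))) Hl))].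
      intros x _. cbn [Csum]. ring. }
  destruct N as [|N]; [lia | apply Hind].
Qed.

Lemma real_power_increment (s N x : R) : 0 < s < 1 -> 0 < N -> 0 <= x <= 1 ->
  Cmod (real_power (N + x) (1 - s) - real_power N (1 - s)) <= (1 - s) * exp (- s * ln N).
Proof.
  intros Hs HN Hx.
  set (K := (1 - s) * exp (- s * ln N)).
  assert (HK : 0 < K) by (apply Rmult_lt_0_compat; [lra | apply exp_pos]).
  assert (H : Cmod (real_power (N + x) (1 - s) - real_power (N + 0) (1 - s)) <= K * x - K * 0).
  { apply (mean_value_bound (fun v => real_power (N + v) (1 - s))
      (fun v => (1 - s) * real_power (N + v) (1 - s - 1))%C (fun v => K * v) (fun _ => K)); [lra | | |].
    - intros v Hv. apply is_Cderive_real_power. lra.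
    - intros v _. auto_derive; [trivial | ring].
    - intros v Hv. rewrite Cmod_mult, <- RtoC_minus, Cmod_R, Rabs_right, Cmod_real_power by lra.
      unfold K. apply Rmult_le_compat_l; [lra|]. apply exp_le_compat.
      replace (Re (RtoC (1 - s) - 1)%C) with (- s) by (cbn; ring).
      assert (ln N <= ln (N + v)) by (apply ln_le; lra). nra. }
  rewrite Rplus_0_r in H. nra.
Qed.

Lemma euler_approx_Ccont (s : R) (N : nat) (x : R) : 0 < x -> Ccont (euler_approx s N) x.
Proof.
  intros Hx. apply Ccont_minus.
  - induction N as [|N IH]; cbn [Csum]; [apply Ccont_const|].
    pose proof (pos_INR N). apply Ccont_plus; [exact IH | apply Ccont_real_power; lra].
  - pose proof (pos_INR N). apply Ccont_mult; [apply Ccont_const | apply Ccont_real_power; lra].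
Qed.

(** The subtracted function (N + x)^(1 - s) / (1 - s) differs from its value at x = 0 by at most
    N^(-s). The constant contributes only for m = 0, where it cancels the growth of Q. In K + 4, the
    4 is the mass 2 / d of [unit_weight] at d = 1/2. *)
Lemma euler_approx_coef (s : R) (m : Z) : 0 < s < 1 ->
  exists K, forall N, (1 <= N)%nat -> exists c,
    Uint (fun x => euler_approx s N x * character (- m) x)%C c /\
    Cmod (c - zeta_coef s m) <= K * exp (- s * ln (INR N)).
Proof.
  intros Hs. destruct (zeta_coef_primitive s m Hs) as [Q [K [A1 [A2 A3]]]].
  exists (K + 4). intros N HN.
  assert (HNp : 0 < INR N) by (apply lt_0_INR; lia).
  pose proof (Uint_real_power_sum s m Q N Hs HN A1 A2) as I1.
  assert (Hn0 : (1 - RtoC s)%C <> 0%C).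
  { rewrite <- RtoC_minus. intros E. apply RtoC_inj in E. lra. }
  assert (Hinv : (/ (1 - RtoC s))%C = RtoC (/ (1 - s))) by (rewrite RtoC_inv, RtoC_minus by lra; reflexivity).
  set (f2 := fun x => (/ (1 - s) * (real_power (INR N + x) (1 - s) - real_power (INR N) (1 - s)) * character (- m) x)%C).
  assert (Hf2 : forall x, in_unit x -> Cmod (f2 x) <= exp (- s * ln (INR N)) * unit_weight (/ 2) x).
  { intros x Hx. unfold f2. rewrite !Cmod_mult, Cmod_character, Hinv, Cmod_R, Rabs_right, Rmult_1_r
      by (apply Rle_ge, Rlt_le, Rinv_0_lt_compat; lra).
    pose proof (real_power_increment s (INR N) x Hs HNp ltac:(unfold in_unit in Hx; lra)) as H.
    pose proof (unit_weight_ge_1 (/ 2) x ltac:(lra) Hx) as Hw. pose proof (exp_pos (- s * ln (INR N))) as He.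
    apply Rle_trans with (exp (- s * ln (INR N))); [|nra].
    apply Rmult_le_reg_l with (1 - s); [lra|]. rewrite <- Rmult_assoc, Rinv_r, Rmult_1_l by lra. exact H. }
  destruct (Uint_weight f2 (exp (- s * ln (INR N))) (/ 2)) as [e [He1 He2]].
  - lra.
  - intros x Hx. unfold in_unit in Hx. apply Ccont_mult; [|apply Ccont_character].
    apply Ccont_mult; [apply Ccont_const|]. apply Ccont_minus; [apply Ccont_real_power; lra | apply Ccont_const].
  - exact Hf2.
  - pose proof (CInt_scal _ _ (/ (1 - s) * real_power (INR N) (1 - s))%C _ _ _ _ (Uint_character (- m))) as I3.
    exists (Q (INR N) - (e + / (1 - s) * real_power (INR N) (1 - s) * (if Z.eqb (- m) 0 then 1 else 0)))%C.
    split.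
    + eapply (CInt_ext in_unit); [exact interval_unit | |
        exact (CInt_minus _ _ _ _ _ _ _ _ I1 (CInt_plus _ _ _ _ _ _ _ _ He1 I3))].
      intros x _. unfold f2, euler_approx. ring.
    + specialize (A3 (INR N) HNp).
      replace (Z.eqb (- m) 0) with (Z.eqb m 0) by (destruct (Z.eqb_spec m 0), (Z.eqb_spec (- m) 0); auto; lia).
      assert (ER : (/ (1 - s) * real_power (INR N) (1 - s))%C = RtoC (exp ((1 - s) * ln (INR N)) / (1 - s))).
      { rewrite Hinv. unfold real_power. rewrite <- RtoC_minus, <- RtoC_mult, Cexp_RtoC, <- RtoC_mult. f_equal.
        unfold Rdiv. ring. }
      rewrite ER.
      match goal with |- Cmod ?a <= _ => replace a with
        ((Q (INR N) - RtoC (exp ((1 - s) * ln (INR N)) / (1 - s)) * (if Z.eqb m 0 then 1 else 0) - zeta_coef s m) + - e)%C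
        by ring end.
      eapply Rle_trans; [apply Cmod_triangle|]. rewrite Cmod_opp.
      replace (2 / / 2) with 4 in He2 by field. lra.
Qed.

Lemma unit_weight_mono (d d' x : R) : d' <= d -> 0 < x < 1 -> unit_weight d x <= unit_weight d' x.
Proof.
  intros Hd Hx. unfold unit_weight.
  assert (forall y, 0 < y < 1 -> ln y <= 0).
  { intros y Hy. rewrite <- ln_1. apply ln_le; lra. }
  pose proof (H x Hx). pose proof (H (1 - x) ltac:(lra)).
  apply Rplus_le_compat; apply exp_le_compat; nra.
Qed.

(** As in [fourier_of_approx], except that the coefficients of the approximants only converge to the
    limiting ones. The exponent 1 - s of the weight matches the singularity x^(-s) of the term n =
    0. *)
Lemma hurwitz_fourier_real (zeta : C -> R -> C) (s : R) : is_hurwitz_zeta zeta -> 0 < s < 1 ->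
  (forall x, in_unit x -> Ccont (zeta s) x) /\
  (exists K, forall x, in_unit x -> Cmod (zeta s x) <= K * unit_weight (1 - s) x) /\
  (forall m, Uint (fun x => zeta s x * character (- m) x)%C (zeta_coef s m)).
Proof.
  intros Hz Hs.
  assert (Happ : forall N x, in_unit x -> (1 <= N)%nat ->
    Cmod (zeta s x - euler_approx s N x) <= exp (- s * ln (INR N)) * unit_weight (1 - s) x).
  { intros N x Hx HN. eapply Rle_trans; [apply hurwitz_euler_approx; auto; apply Hx|].
    pose proof (unit_weight_ge_1 (1 - s) x ltac:(lra) Hx). pose proof (exp_pos (- s * ln (INR N))). nra. }
  assert (Hcont : forall x, in_unit x -> Ccont (zeta s) x).
  { apply (uniform_approx_Ccont (zeta s) (euler_approx s) (1 - s) (fun N => exp (- s * ln (INR N)))).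
    - intros N x Hx. apply euler_approx_Ccont, Hx.
    - now apply is_lim_seq_INR_power.
    - exact Happ. }
  assert (HK : exists K, forall x, in_unit x -> Cmod (zeta s x) <= K * unit_weight (1 - s) x).
  { exists (exp (- s * ln (INR 1)) + 1 + 2 / (1 - s)). intros x Hx.
    pose proof (Happ 1%nat x Hx (le_n _)) as H1.
    pose proof (unit_weight_ge_1 (1 - s) x ltac:(lra) Hx) as Hw.
    assert (H2 : Cmod (euler_approx s 1 x) <= (1 + 2 / (1 - s)) * unit_weight (1 - s) x).
    { unfold euler_approx. cbn [Csum]. unfold in_unit in Hx.
      unfold Cminus. eapply Rle_trans; [apply Cmod_triangle|]. rewrite Cmod_opp, Cmod_mult, Cplus_0_l.
      assert (Hinv : (/ (1 + - RtoC s))%C = RtoC (/ (1 - s))) by (rewrite RtoC_inv, RtoC_minus by lra; reflexivity).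
      rewrite Hinv, Cmod_R, Rabs_right by (apply Rle_ge, Rlt_le, Rinv_0_lt_compat; lra).
      rewrite !Cmod_real_power. simpl INR. rewrite Rplus_0_l.
      replace (Re (- RtoC s)%C) with (1 - s - 1) by (cbn; ring).
      replace (Re (1 + - RtoC s)%C) with (1 - s) by (cbn; ring).
      assert (B1 : exp ((1 - s - 1) * ln x) <= unit_weight (1 - s) x).
      { unfold unit_weight. pose proof (exp_pos ((1 - s - 1) * ln (1 - x))). lra. }
      assert (B2 : exp ((1 - s) * ln (1 + x)) <= 2).
      { rewrite <- (exp_ln 2) by lra. apply exp_le_compat.
        assert (0 <= ln (1 + x)) by (rewrite <- ln_1; apply ln_le; lra).
        assert (ln (1 + x) <= ln 2) by (apply ln_le; lra). nra. }
      assert (0 < / (1 - s)) by (apply Rinv_0_lt_compat; lra).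
      assert (/ (1 - s) * exp ((1 - s) * ln (1 + x)) <= / (1 - s) * 2) by (apply Rmult_le_compat_l; lra).
      unfold Rdiv. assert (2 * / (1 - s) <= 2 * / (1 - s) * unit_weight (1 - s) x) by nra. lra. }
    replace (zeta s x) with ((zeta s x - euler_approx s 1 x) + euler_approx s 1 x)%C by ring.
    eapply Rle_trans; [apply Cmod_triangle|]. lra. }
  split; [exact Hcont|]. split; [exact HK|]. intros m. destruct HK as [K HK].
  destruct (euler_approx_coef s m Hs) as [K' HK'].
  destruct (Uint_weight (fun x => zeta s x * character (- m) x)%C K (1 - s)) as [l [Hl _]].
  - lra.
  - intros x Hx. apply Ccont_mult; [auto | apply Ccont_character].
  - intros x Hx. rewrite Cmod_mult, Cmod_character, Rmult_1_r. auto.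
  - replace (zeta_coef s m) with l; [exact Hl|].
    apply (Clim_bound_eventually (fun _ => zeta_coef s m) (zeta_coef s m) l
      (fun N => (2 / (1 - s) + K') * exp (- s * ln (INR (S N))))).
    + apply Clim_const.
    + intros N. destruct (HK' (S N) ltac:(lia)) as [c [Hc1 Hc2]].
      assert (Hlc : Cmod (l - c) <= exp (- s * ln (INR (S N))) * (2 / (1 - s))).
      { apply (Uint_weight_bound (fun x => zeta s x * character (- m) x - euler_approx s (S N) x * character (- m) x)%C).
        - lra.
        - intros x Hx. apply Ccont_minus; apply Ccont_mult; auto using Ccont_character.
          apply euler_approx_Ccont, Hx.
        - intros x Hx.
          replace (zeta s x * character (- m) x - euler_approx s (S N) x * character (- m) x)%C
            with ((zeta s x - euler_approx s (S N) x) * character (- m) x)%C by ring.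
          rewrite Cmod_mult, Cmod_character, Rmult_1_r. apply Happ; [exact Hx | lia].
        - apply CInt_minus; try apply filter_filter; assumption. }
      replace (zeta_coef s m - l)%C with (- ((l - c) + (c - zeta_coef s m)))%C by ring. rewrite Cmod_opp.
      eapply Rle_trans; [apply Cmod_triangle|]. lra.
    + replace 0 with ((2 / (1 - s) + K') * 0) by ring. apply (is_lim_seq_scal_l _ (2 / (1 - s) + K') 0).
      exact (proj1 (is_lim_seq_incr_1 (fun n => exp (- s * ln (INR n))) 0) (is_lim_seq_INR_power s ltac:(lra))).
Qed.

(** * Uniqueness of Fourier coefficients *)

Notation Rint_unit f l := (is_RInt_gen (V := R_NormedModule) f (at_right 0) (at_left 1) l).

Lemma Rint_unit_nonneg (f : R -> R) (l : R) :
  Rint_unit f l -> (forall x, in_unit x -> 0 <= f x) -> 0 <= l.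
Proof.
  intros Hf Hle.
  assert (H0 : Rint_unit (fun x => 0 * f x) (0 * l)).
  { exact (is_RInt_gen_scal (V := R_NormedModule) f 0 l Hf). }
  eapply Rle_trans; [apply Rabs_pos|].
  apply (RInt_gen_norm (V := R_CompleteNormedModule) (Fa := at_right 0) (Fb := at_left 1) (fun x => 0 * f x) f (0 * l) l).
  - eapply filter_imp; [| exact (ib_prod _ _ _ interval_unit)]. now intros ab [? _].
  - eapply filter_imp; [| exact (ib_prod _ _ _ interval_unit)]. intros ab [_ [H1 H2]] x Hx.
    unfold norm; simpl. rewrite Rmult_0_l. unfold abs; simpl. rewrite Rabs_R0. apply Hle.
    unfold in_unit in *. lra.
  - exact H0.
  - exact Hf.
Qed.

Lemma Rint_unit_continuous (f : R -> R) : (forall x, continuous f x) -> Rint_unit f (RInt f 0 1).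
Proof.
  intros Hf.
  assert (HD : forall x, is_derive (fun x => RInt f 0 x) x (f x)).
  { intros x. apply (is_derive_RInt (V := R_NormedModule) f (fun x => RInt f 0 x) 0 x); [|apply Hf].
    exists (mkposreal 1 Rlt_0_1). intros y _. apply (RInt_correct (V := R_CompleteNormedModule)).
    apply (ex_RInt_continuous (V := R_CompleteNormedModule)). intros; apply Hf. }
  assert (HC : forall x (D : R -> Prop), filterlim (fun x => RInt f 0 x) (within D (locally x)) (locally (RInt f 0 x))).
  { intros x D. assert (Hc : continuous (fun x => RInt f 0 x) x).
    { apply (ex_derive_continuous (V := R_NormedModule) (fun x => RInt f 0 x) x). now exists (f x). }
    refine (filterlim_filter_le_1 _ _ Hc). apply filter_le_within. }
  assert (E : minus (G := R_AbelianGroup) (RInt f 0 1) (RInt f 0 0) = RInt f 0 1).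
  { rewrite RInt_point. exact (Rminus_0_r (RInt f 0 1)). }
  rewrite <- E.
  apply (is_RInt_gen_antiderivative (V := R_CompleteNormedModule) in_unit _ _ (fun x => RInt f 0 x) f).
  - exact interval_unit.
  - intros; apply HD.
  - intros; apply Hf.
  - apply HC.
  - apply HC.
Qed.

(** For c = cos (2 pi r) with 0 < r <= 1/4 it exceeds 1 exactly where x is within r of a modulo
    1. *)
Definition bump (c a x : R) : R := (1 + cos (2 * PI * (x - a))) / (1 + c).

Lemma bump_character (c a x : R) : 1 + c <> 0 ->
  RtoC (bump c a x) = (RtoC (/ (1 + c)) * (1 + RtoC (/ 2) *
     (character (- 1) a * character 1 x + character 1 a * character (- 1) x)))%C.
Proof.
  intros Hc.
  assert (E : forall t, (RtoC (cos t)) = (RtoC (/ 2) * (Cexp (Ci * t) + Cexp (- (Ci * t))))%C).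
  { intros t. unfold Cexp. replace (Re (Ci * t)%C) with 0 by (cbn; ring).
    replace (Im (Ci * t)%C) with t by (cbn; ring).
    replace (Re (- (Ci * t))%C) with 0 by (cbn; ring). replace (Im (- (Ci * t))%C) with (- t) by (cbn; ring).
    rewrite exp_0, cos_neg, sin_neg. apply C_ext; cbn; unfold Re, Im; cbn; field. }
  unfold bump, Rdiv. rewrite Rmult_comm, RtoC_mult, RtoC_plus, E. do 4 f_equal.
  - unfold character. rewrite <- Cexp_plus. f_equal. rewrite !RtoC_mult, RtoC_minus. ring.
  - unfold character. rewrite <- Cexp_plus. f_equal. rewrite !RtoC_mult, RtoC_minus. ring.
Qed.

(** A factor [bump] only shifts frequencies by -1, 0 and 1, so orthogonality to all characters
    survives multiplication by it. This is why the induction keeps m general. *)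
Lemma Uint_bump_pow (D : R -> C) (c a : R) (k : nat) : 1 + c <> 0 ->
  (forall m, Uint (fun x => D x * character m x)%C 0) ->
  forall m, Uint (fun x => D x * RtoC (bump c a x) ^ k * character m x)%C 0.
Proof.
  intros Hc HD. induction k as [|k IH]; intros m.
  - eapply (CInt_ext in_unit); [exact interval_unit | | exact (HD m)]. intros x _. simpl. ring.
  - set (q := RtoC (/ (1 + c))). set (h := RtoC (/ 2)).
    replace (RtoC 0) with (q * 0 + ((q * h * character (- 1) a) * 0 + (q * h * character 1 a) * 0))%C by ring.
    eapply (CInt_ext in_unit); [exact interval_unit | |
      exact (CInt_plus _ _ _ _ _ _ _ _ (CInt_scal _ _ q _ _ _ _ (IH m))
        (CInt_plus _ _ _ _ _ _ _ _ (CInt_scal _ _ (q * h * character (- 1) a)%C _ _ _ _ (IH (m + 1)%Z))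
           (CInt_scal _ _ (q * h * character 1 a)%C _ _ _ _ (IH (m + - 1)%Z))))].
    intros x _. cbv beta. rewrite !character_plus, Cpow_S.
    rewrite (bump_character c a x Hc) at 4. fold q h. ring.
Qed.

(* Powers of a trigonometric polynomial that exceeds 1 exactly near [a]
   would make the zero integral [int D T^k] grow without bound. *)
Lemma fourier_uniqueness (D : R -> C) (K d : R) : 0 < d ->
  (forall x, in_unit x -> Ccont D x) -> (forall x, in_unit x -> Cmod (D x) <= K * unit_weight d x) ->
  (forall m, Uint (fun x => D x * character m x)%C 0) ->
  forall a, in_unit a -> D a = 0%C.
Proof.
  intros Hd HC HB HD a Ha. apply Cmod_eq_0.
  destruct (Rle_lt_or_eq_dec 0 (Cmod (D a)) (Cmod_ge_0 _)) as [Hpos|E]; [exfalso | now symmetry].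
  pose proof PI_bounds as HPI.
  (* The factor makes the value at a the positive real number eta, so that real parts suffice from
     here on. *)
  set (D' := fun x => (Cconj (D a) * D x)%C). set (eta := Cmod (D a) ^ 2).
  assert (Heta : 0 < eta) by now apply pow_lt.
  assert (HC' : forall x, in_unit x -> Ccont D' x) by (intros; apply Ccont_mult; [apply Ccont_const | auto]).
  destruct (Ccont_epsilon_inv _ _ (HC' a Ha) (eta / 2) ltac:(lra)) as [d1 [Hd1 Hnear]].
  unfold in_unit in Ha.
  (* Below d1 the real part of D' stays above eta / 2; at most 1/4 gives c >= 0; at most a and 1 - a
     keeps |x - a| <= 1 - r on (0, 1), so the next period of the bump is not met. *)
  set (r := Rmin (Rmin (d1 / 2) (/ 4)) (Rmin a (1 - a))).
  assert (Hr : 0 < r) by (repeat apply Rmin_pos; lra).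
  assert (Hr1 : r < d1).
  { eapply Rle_lt_trans; [apply Rmin_l|]. eapply Rle_lt_trans; [apply Rmin_l | lra]. }
  assert (Hr2 : r <= / 4) by (eapply Rle_trans; [apply Rmin_l | apply Rmin_r]).
  assert (Hr3 : r <= a) by (eapply Rle_trans; [apply Rmin_r | apply Rmin_l]).
  assert (Hr4 : r <= 1 - a) by (eapply Rle_trans; [apply Rmin_r | apply Rmin_r]).
  set (c := cos (2 * PI * r)).
  assert (Hc : 0 <= c) by (apply cos_ge_0; nra).
  set (T := bump c a).
  assert (HT0 : forall x, 0 <= T x).
  { intros x. unfold T, bump. pose proof (COS_bound (2 * PI * (x - a))).
    apply Rmult_le_pos; [lra | apply Rlt_le, Rinv_0_lt_compat; lra]. }
  assert (Hcabs : forall x, cos (2 * PI * (x - a)) = cos (2 * PI * Rabs (x - a))).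
  { intros x. unfold Rabs. destruct (Rcase_abs (x - a)); [|reflexivity].
    rewrite <- cos_neg. f_equal. ring. }
  assert (HTin : forall x, Rabs (x - a) < r -> 1 < T x).
  { intros x Hx. unfold T, bump. rewrite Hcabs. pose proof (Rabs_pos (x - a)).
    assert (c < cos (2 * PI * Rabs (x - a))) by (apply cos_decreasing_1; nra).
    apply Rmult_lt_reg_r with (1 + c); [lra|]. unfold Rdiv. rewrite Rmult_assoc, Rinv_l; lra. }
  assert (HTout : forall x, in_unit x -> r <= Rabs (x - a) -> T x <= 1).
  { intros x Hx Hxr. unfold T, bump. rewrite Hcabs.
    assert (Hx1 : Rabs (x - a) <= 1 - r) by (unfold in_unit in Hx; apply Rabs_le; lra).
    set (t := Rabs (x - a)) in *.
    assert (cos (2 * PI * t) <= c).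
    { destruct (Rle_dec t (/ 2)) as [L|L].
      - apply cos_decr_1; nra.
      - replace (cos (2 * PI * t)) with (cos (2 * PI * (1 - t))).
        + apply cos_decr_1; nra.
        + replace (2 * PI * (1 - t)) with (- (2 * PI * t) + 2 * INR 1 * PI) by (simpl; ring).
          rewrite cos_period. apply cos_neg. }
    apply Rmult_le_reg_r with (1 + c); [lra|]. unfold Rdiv. rewrite Rmult_assoc, Rinv_l; lra. }
  set (psi := fun x => Rmax (T x - 1) 0).
  assert (HTc : forall x, continuous T x).
  { intros x. apply (ex_derive_continuous (V := R_NormedModule) T). unfold T, bump. auto_derive. lra. }
  assert (Hpsic : forall x, continuous psi x).
  { intros x. apply (continuous_ext (fun x => / 2 * ((T x - 1) + Rabs (T x - 1)))).
    - intros y. unfold psi, Rmax, Rabs. destruct (Rle_dec (T y - 1) 0), (Rcase_abs (T y - 1)); lra.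
    - apply (continuous_comp T (fun y => / 2 * ((y - 1) + Rabs (y - 1)))); [apply HTc|].
      apply (continuous_comp (fun y => y - 1) (fun z => / 2 * (z + Rabs z))).
      + apply (ex_derive_continuous (V := R_NormedModule)). auto_derive; trivial.
      + apply (continuous_mult (K := R_AbsRing) (fun _ => / 2)); [apply continuous_const|].
        apply (continuous_plus (V := R_NormedModule) (fun z => z) Rabs); [apply continuous_id | apply continuous_Rabs]. }
  assert (Hpsi0 : forall x, 0 <= psi x) by (intros; apply Rmax_r).
  assert (Hex : forall u v, ex_RInt psi u v).
  { intros. apply (ex_RInt_continuous (V := R_CompleteNormedModule)). intros; apply Hpsic. }
  set (mu := RInt psi 0 1).
  assert (Hmu : 0 < mu).
  { unfold mu.
    rewrite <- (RInt_Chasles psi 0 (a - r) 1), <- (RInt_Chasles psi (a - r) (a + r) 1) by apply Hex.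
    assert (P1 : 0 <= RInt psi 0 (a - r)) by (apply RInt_ge_0; [lra | apply Hex | auto]).
    assert (P2 : 0 < RInt psi (a - r) (a + r)).
    { apply RInt_gt_0; [lra | | intros; apply Hpsic].
      intros x Hx. assert (1 < T x) by (apply HTin, Rabs_def1; lra).
      unfold psi. rewrite Rmax_left; lra. }
    assert (P3 : 0 <= RInt psi (a + r) 1) by (apply RInt_ge_0; [lra | apply Hex | auto]).
    unfold plus; simpl. lra. }
  pose proof (Rint_unit_continuous psi Hpsic) as Ipsi. fold mu in Ipsi.
  destruct (unit_weight_primitive_limits d Hd) as [L0 L1].
  pose proof (is_RInt_gen_antiderivative (V := R_CompleteNormedModule) in_unit (at_right 0) (at_left 1)
    (fun x => (exp (d * ln x) - exp (d * ln (1 - x))) / d) (unit_weight d) (- / d) (/ d)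
    interval_unit (fun x Hx => unit_weight_primitive d x Hd Hx)
    (fun x Hx => continuous_unit_weight d x Hx) L0 L1) as Iw.
  change (Rint_unit (unit_weight d) (/ d - - / d)) in Iw.
  set (K' := Cmod (D a) * K).
  assert (HK' : forall x, in_unit x -> Cmod (D' x) <= K' * unit_weight d x).
  { intros x Hx. unfold D', K'. rewrite Cmod_mult, Cmod_conj, Rmult_assoc.
    apply Rmult_le_compat_l; [apply Cmod_ge_0 | auto]. }
  (* Near a, Bernoulli's inequality gives T^k >= k (T - 1), so the integrand is at least (eta / 2) k
     psi; elsewhere T <= 1 bounds the loss by K' times the weight. The integral being 0, k times a
     positive constant stays bounded. *)
  assert (Hk : forall k : nat, eta / 2 * INR k * mu <= K' * (/ d - - / d)).
  { intros k.
    assert (HI : Rint_unit (fun x => Re (D' x * RtoC (bump c a x) ^ k)%C) 0).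
    { pose proof (Uint_bump_pow D c a k ltac:(lra) HD 0) as H.
      pose proof (CInt_scal _ _ (Cconj (D a)) _ _ _ _ H) as H'.
      assert (H2 : Uint (fun x => D' x * RtoC (bump c a x) ^ k)%C (Cconj (D a) * 0)%C).
      { eapply (CInt_ext in_unit); [exact interval_unit | | exact H'].
        intros x _. unfold D'. rewrite character_0. ring. }
      apply CInt_Re in H2; try apply filter_filter. rewrite Cmult_0_r in H2. exact H2. }
    pose proof (is_RInt_gen_plus (V := R_NormedModule) _ _ _ _ HI
      (is_RInt_gen_minus (V := R_NormedModule) _ _ _ _
        (is_RInt_gen_scal (V := R_NormedModule) _ K' _ Iw)
        (is_RInt_gen_scal (V := R_NormedModule) _ (eta / 2 * INR k) _ Ipsi))) as HF.
    apply Rint_unit_nonneg in HF.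
    - change (0 <= 0 + (K' * (/ d - - / d) - eta / 2 * INR k * mu)) in HF. lra.
    - intros x Hx.
      change (0 <= Re (D' x * RtoC (bump c a x) ^ k)%C + (K' * unit_weight d x - eta / 2 * INR k * psi x)).
      rewrite <- RtoC_pow, Re_mult_RtoC. fold T. pose proof (HT0 x) as Ht. pose proof (pos_INR k) as Hk0.
      specialize (HK' x Hx).
      destruct (Rlt_dec (Rabs (x - a)) r) as [L|L].
      + pose proof (HTin x L) as H1.
        assert (Hre : eta / 2 <= Re (D' x)).
        { specialize (Hnear x (Rlt_trans _ _ _ L Hr1)).
          pose proof (re_le_Cmod (D' x - D' a)) as H2.
          assert (Ea : Re (D' a) = eta).
          { unfold D', eta. rewrite Cmod2_alt. unfold Cconj, Re, Im. cbn. unfold Re, Im. ring. }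
          change (Re (D' x - D' a)%C) with (Re (D' x) - Re (D' a)) in H2. rewrite Ea in H2.
          assert (H3 : Rabs (Re (D' x) - eta) < eta / 2) by lra. apply Rabs_def2 in H3. lra. }
        unfold psi. rewrite Rmax_left by lra.
        assert (Hp : INR k * (T x - 1) <= T x ^ k).
        { assert (Hb : 1 + INR k * (T x - 1) <= T x ^ k).
          { replace (T x ^ k) with ((1 + (T x - 1)) ^ k) by (f_equal; ring). apply poly; lra. }
          lra. }
        assert (0 <= K' * unit_weight d x) by (pose proof (Cmod_ge_0 (D' x)); lra).
        assert (eta / 2 * (INR k * (T x - 1)) <= Re (D' x) * T x ^ k).
        { apply Rmult_le_compat; try lra. apply Rmult_le_pos; lra. }
        lra.
      + pose proof (HTout x Hx ltac:(lra)) as H1.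
        unfold psi. rewrite Rmax_right by lra.
        assert (Hp : 0 <= T x ^ k <= 1).
        { split; [now apply pow_le|]. rewrite <- (pow1 k). apply pow_incr. lra. }
        pose proof (re_le_Cmod (D' x)) as H2. apply Rabs_le_between in H2.
        pose proof (Cmod_ge_0 (D' x)). nra. }
  destruct (INR_unbounded (K' * (/ d - - / d) / (eta / 2 * mu))) as [k Hk'].
  specialize (Hk k). assert (Hem : 0 < eta / 2 * mu) by (apply Rmult_lt_0_compat; lra).
  apply Rmult_lt_compat_r with (r := eta / 2 * mu) in Hk'; [|exact Hem].
  unfold Rdiv in Hk' at 1. rewrite Rmult_assoc, Rinv_l in Hk' by lra. lra.
Qed.

Lemma fourier_zeta_fourier (s : C) : Re s < 1 ->
  ((forall x, in_unit x -> Ccont (fourier_zeta s) x) /\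
   (exists K, forall x, in_unit x -> Cmod (fourier_zeta s x) <= K * unit_weight (tail_exponent (Re s)) x) /\
   (forall n, Uint (fun x => fourier_zeta s x * character (- n) x)%C (zeta_coef s n))) /\
  ((forall x, in_unit x -> Ccont (fourier_zeta_deriv s) x) /\
   (exists K, forall x, in_unit x -> Cmod (fourier_zeta_deriv s x) <= K * unit_weight (tail_exponent (Re s)) x) /\
   (forall n, Uint (fun x => fourier_zeta_deriv s x * character (- n) x)%C (zeta_deriv_coef s n))).
Proof.
  intros Hs. destruct (fourier_zeta_approx s Hs) as [K HK].
  destruct (tail_exponent_bounds (Re s) Hs) as [Hd _].
  assert (Hrho : is_lim_seq (fun N => K * exp (- tail_exponent (Re s) * ln (INR N))) 0).
  { replace 0 with (K * 0) by ring. apply (is_lim_seq_scal_l _ K 0). apply is_lim_seq_INR_power. lra. }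
  assert (Hd1 : 0 < tail_exponent (Re s) < 1) by lra.
  split.
  - exact (fourier_of_approx _ _ _ _ Hd1 eq_refl Hrho (fun N x Hx HN => proj1 (HK x N Hx HN))).
  - exact (fourier_of_approx _ _ _ _ Hd1 eq_refl Hrho (fun N x Hx HN => proj2 (HK x N Hx HN))).
Qed.

Lemma hurwitz_eq_fourier_real (zeta : C -> R -> C) (s a : R) :
  is_hurwitz_zeta zeta -> 0 < s < 1 -> in_unit a -> zeta s a = fourier_zeta s a.
Proof.
  intros Hz Hs Ha.
  destruct (hurwitz_fourier_real zeta s Hz Hs) as [A1 [[K1 A2] A3]].
  assert (Hs1 : Re s < 1) by (cbn; lra).
  destruct (fourier_zeta_fourier s Hs1) as [[B1 [[K2 B2] B3]] _].
  destruct (tail_exponent_bounds (Re s) Hs1) as [Hd _].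
  (* The two functions are bounded by weights of different exponents; the smaller exponent gives the
     larger weight and serves for both. *)
  set (d := tail_exponent (Re s)) in *. set (d' := Rmin (1 - s) d).
  assert (Hd' : 0 < d') by (apply Rmin_pos; lra).
  pose proof (weight_bound_nonneg _ _ _ A2) as HK1. pose proof (weight_bound_nonneg _ _ _ B2) as HK2.
  assert (E : (zeta s a - fourier_zeta s a)%C = 0%C).
  { apply (fourier_uniqueness (fun x => zeta s x - fourier_zeta s x)%C (K1 + K2) d' Hd').
    - intros x Hx. apply Ccont_minus; [now apply A1 | now apply B1].
    - intros x Hx. unfold Cminus. eapply Rle_trans; [apply Cmod_triangle|]. rewrite Cmod_opp.
      specialize (A2 x Hx). specialize (B2 x Hx).
      pose proof (unit_weight_mono (1 - s) d' x (Rmin_l _ _) Hx).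
      pose proof (unit_weight_mono d d' x (Rmin_r _ _) Hx). nra.
    - intros m. replace (RtoC 0) with (zeta_coef s (- m) - zeta_coef s (- m))%C by ring.
      eapply (CInt_ext in_unit); [exact interval_unit | |
        exact (CInt_minus _ _ _ _ _ _ _ _ (A3 (- m)%Z) (B3 (- m)%Z))].
      intros x _. cbv beta. rewrite Z.opp_involutive. ring.
    - exact Ha. }
  replace (zeta s a) with ((zeta s a - fourier_zeta s a) + fourier_zeta s a)%C by ring. rewrite E. ring.
Qed.

(** The segment from 1/2 to s stays in Re z < 1, away from the pole, and the functions agree at real
    points accumulating at 1/2. Agreement on a disc around s then transfers the derivative. *)
Lemma hurwitz_derivative (zeta : C -> R -> C) (s : C) (a : R) :
  is_hurwitz_zeta zeta -> Re s < 1 -> in_unit a ->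
  C_derive (fun w => zeta w a) s = fourier_zeta_deriv s a.
Proof.
  intros Hz Hs Ha.
  assert (Ha0 : 0 < a) by (unfold in_unit in Ha; lra).
  destruct (Hz a Ha0) as [Han _].
  set (f := fun z => (zeta z a + - (1) * fourier_zeta z a)%C).
  destruct (identity_theorem_segment f (RtoC (/ 2)) s) as [r [Hr Hf]].
  - intros t Ht. set (z := (RtoC (/ 2) + t * (s - RtoC (/ 2)))%C).
    assert (Hre : Re z < 1).
    { replace (Re z) with ((1 - t) * / 2 + t * Re s) by (unfold z; cbn; unfold Re, Im; cbn; ring).
      destruct (Req_dec t 0) as [->|Ht0]; [lra|].
      assert (0 < t * (1 - Re s)) by (apply Rmult_lt_0_compat; lra). lra. }
    assert (Hzn : z <> 1%C) by (intros E; rewrite E in Hre; cbn in Hre; lra).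
    destruct (taylor_at_analytic _ _ z Han Hzn) as [r1 [M1 [a1 H1]]].
    destruct (fourier_zeta_taylor z a Hre Ha) as [r2 [M2 [a2 [H2 _]]]].
    assert (Hr : 0 < Rmin r1 r2) by (apply Rmin_pos; [apply H1 | apply H2]).
    apply (taylor_at_shrink _ _ _ (Rmin r1 r2)) in H1; [|split; [exact Hr | apply Rmin_l]].
    apply (taylor_at_shrink _ _ _ (Rmin r1 r2)) in H2; [|split; [exact Hr | apply Rmin_r]].
    do 3 eexists. exact (taylor_at_plus _ _ _ _ _ _ _ _ H1 (taylor_at_scal (- (1)) _ _ _ _ _ H2)).
  (* The bound 1/4 keeps 1/2 + h inside (0, 1), where agreement is known. *)
  - intros e He. set (h := Rmin (/ 4) (e / 2)).
    assert (Hh : 0 < h) by (apply Rmin_pos; lra).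
    pose proof (Rmin_l (/ 4) (e / 2)). pose proof (Rmin_r (/ 4) (e / 2)).
    exists (RtoC h). rewrite Cmod_R, Rabs_right by lra. split; [unfold h in *; lra|].
    unfold f. rewrite <- RtoC_plus. rewrite (hurwitz_eq_fourier_real zeta (/ 2 + h) a Hz); [ring | unfold h in *; lra | exact Ha].
  - destruct (fourier_zeta_taylor s a Hs Ha) as [r2 [M2 [a2 [H2 E2]]]].
    apply taylor_at_Cdiff in H2. rewrite E2 in H2.
    apply Cdiff_C_derive. refine (Cdiff_ext _ _ s _ r Hr _ H2).
    intros h Hh. specialize (Hf h Hh). unfold f in Hf.
    replace (zeta (s + h)%C a) with ((zeta (s + h)%C a + - (1) * fourier_zeta (s + h) a) + fourier_zeta (s + h) a)%C by ring.
    rewrite Hf. ring.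
Qed.

Theorem proposition3 :
  forall zeta : C -> R -> C, is_hurwitz_zeta zeta ->
  forall s : C, Re s < 1 ->
  let dzeta := fun alpha : R => C_derive (fun w : C => zeta w alpha) s in
  let b := fun n : Z =>
    (Cpower (2 * PI * Ci * IZR n) (s - 1)
     * (Clog (2 * PI * Ci * IZR n) - Cdigamma (1 - s)))%C in
  has_fourier_coefficients dzeta
    (fun n : Z => if Z.eqb n 0 then RtoC 0 else (CGamma (1 - s) * b n)%C)
  /\
  (forall alpha : R, 0 < alpha < 1 ->
   exists S : C,
     is_sum_nonzero
       (fun n : Z => (Cexp (2 * PI * Ci * IZR n * alpha) * b n)%C) S
     /\ dzeta alpha = (CGamma (1 - s) * S)%C).
Proof.
  intros zeta Hz s Hs dzeta b.
  assert (Hdz : forall a, in_unit a -> dzeta a = fourier_zeta_deriv s a).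
  { intros a Ha. exact (hurwitz_derivative zeta s a Hz Hs Ha). }
  destruct (fourier_zeta_fourier s Hs) as [_ [HC [[K HK] HF]]].
  destruct (fourier_zeta_approx s Hs) as [K' HK'].
  destruct (tail_exponent_bounds (Re s) Hs) as [Hd _].
  set (d := tail_exponent (Re s)) in *.
  split; [split; [split|]|].
  (* The integral of [dzeta] itself is its coefficient at n = 0, where the character is 1. *)
  - exists (zeta_deriv_coef s 0).
    eapply (CInt_ext in_unit); [exact interval_unit | | exact (HF 0%Z)].
    intros x Hx. cbv beta. rewrite (Hdz x Hx), character_0. ring.
  - destruct (unit_weight_primitive_limits d ltac:(lra)) as [L0 L1].
    destruct (ex_RInt_gen_dominated (V := R_CompleteNormedModule) in_unit (at_right 0) (at_left 1)
      (fun x => Cmod (fourier_zeta_deriv s x)) (fun x => K * unit_weight d x)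
      (fun x => K * ((exp (d * ln x) - exp (d * ln (1 - x))) / d)) (K * (- / d)) (K * (/ d))) as [l [Hl _]].
    + exact interval_unit.
    + intros x Hx. now apply Ccont_Cmod, HC.
    + intros x Hx. apply (continuous_mult (K := R_AbsRing) (fun _ => K)); [apply continuous_const|].
      now apply continuous_unit_weight.
    + intros x Hx. apply (is_derive_scal (fun x => (exp (d * ln x) - exp (d * ln (1 - x))) / d)).
      apply unit_weight_primitive; [lra | exact Hx].
    + intros x Hx. change (Rabs (Cmod (fourier_zeta_deriv s x)) <= K * unit_weight d x).
      rewrite Rabs_right by apply Rle_ge, Cmod_ge_0. now apply HK.
    + exact (filterlim_comp _ _ _ _ _ _ _ _ L0 (filterlim_scal_r K (- / d))).
    + exact (filterlim_comp _ _ _ _ _ _ _ _ L1 (filterlim_scal_r K (/ d))).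
    + exists l. refine (is_RInt_gen_ext (V := R_NormedModule) _ _ _ _ Hl).
      eapply filter_imp; [| exact (ib_prod _ _ _ interval_unit)].
      intros ab [_ [Pa Pb]] x Hx. rewrite Hdz; [reflexivity|].
      apply (ib_convex_minmax _ _ _ interval_unit (fst ab) (snd ab)); auto. lra.
  - intros n.
    eapply (CInt_ext in_unit); [exact interval_unit | | exact (HF n)].
    intros x Hx. cbv beta. rewrite (Hdz x Hx). unfold character. do 2 f_equal.
    rewrite opp_IZR, RtoC_opp. ring.
  - intros alpha Ha.
    assert (HG : CGamma (1 - s) <> 0%C) by (apply CGamma_neq_0; cbn; unfold Re in *; lra).
    (* The terms in the statement do not contain the Gamma factor of [zeta_deriv_coef], so the sum
       is divided by it. *)
    exists (/ CGamma (1 - s) * fourier_zeta_deriv s alpha)%C. split.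
    + apply is_series_Clim.
      apply (Clim_ext (fun N => / CGamma (1 - s)
               * symmetric_sum (fun n => zeta_deriv_coef s n * character n alpha) N)%C _
               (/ CGamma (1 - s) * fourier_zeta_deriv s alpha)%C); [|reflexivity|].
      * intros N. unfold symmetric_sum. rewrite <- Csum_scal. apply Csum_ext. intros k _.
        assert (Hn : forall n, n <> 0%Z -> (/ CGamma (1 - s) * (zeta_deriv_coef s n * character n alpha)
           = Cexp (2 * PI * Ci * IZR n * alpha) * b n)%C).
        { intros n Hn. unfold zeta_deriv_coef. destruct (Z.eqb_spec n 0); [contradiction|].
          change (Cpower (2 * PI * Ci * IZR n) (s - 1) * (Clog (2 * PI * Ci * IZR n) - Cdigamma (1 - s)))%C with (b n).
          unfold character. field. exact HG. }
        rewrite <- !Hn by lia. ring.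
      * apply Clim_scal. unfold Clim.
        (* The remainder bound holds for N >= 1, hence the shift of the index. *)
        apply is_lim_seq_incr_1.
        apply (is_lim_seq_le_0 _ (fun N => K' * unit_weight d alpha * exp (- d * ln (INR (S N))))).
        -- intros N. split; [apply Cmod_ge_0|]. rewrite <- Cmod_opp.
           match goal with |- Cmod ?e <= _ => replace e with (fourier_zeta_deriv s alpha
             - symmetric_sum (fun n => zeta_deriv_coef s n * character n alpha) (S N))%C by ring end.
           destruct (HK' alpha (S N) Ha ltac:(lia)) as [_ H]. lra.
        -- replace 0 with (K' * unit_weight d alpha * 0) by ring.
           apply (is_lim_seq_scal_l _ (K' * unit_weight d alpha) 0).
           exact (proj1 (is_lim_seq_incr_1 (fun n => exp (- d * ln (INR n))) 0) (is_lim_seq_INR_power d ltac:(lra))).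
    + rewrite (Hdz alpha Ha), Cmult_assoc, Cinv_r by exact HG. ring.
Qed.
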